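(* Let $A_1,\ldots,A_n\in\mathbb{P}(\mathcal{H})$ be such that $mI\le A_j\le MI$ $(j=1,\ldots,n)$ for some scalars $0<m<M$, and let $h=M/m$. Let $\mathfrak{M}:\mathbb{P}(\mathcal{H})^n\to\mathbb{P}(\mathcal{H})$ be an $n$-variable operator mean satisfying $\mathcal{H}_\omega\le\mathfrak{M}\le\mathcal{A}_\omega$ for some probability vector $\omega=(\omega_1,\ldots,\omega_n)$, and let $\sigma$ be a ($2$-variable) operator mean with $\sigma\ne\ell$. If $1\le q\le p$, then $$K\left(h^p,-\tfrac qp\right)^{-1/q}\mathfrak{M}_\sigma(A_1^p,\ldots,A_n^p)^{1/p}\le\mathfrak{M}_\sigma(A_1^q,\ldots,A_n^q)^{1/q}\le K\left(h^p,-\tfrac qp\right)^{1/q}\mathfrak{M}_\sigma(A_1^p,\ldots,A_n^p)^{1/p}.$$ If $0<q<1$ and $q<p$, then $$K\left(h^q,\tfrac1q\right)^{-1}K\left(h^p,-\tfrac qp\right)^{-1/q}\mathfrak{M}_\sigma(A_1^p,\ldots,A_n^p)^{1/p}\le\mathfrak{M}_\sigma(A_1^q,\ldots,A_n^q)^{1/q}\le K\left(h^q,\tfrac1q\right)K\left(h^p,-\tfrac qp\right)^{1/q}\mathfrak{M}_\sigma(A_1^p,\ldots,A_n^p)^{1/p}.$$ In particular, letting $q\to0$, $$S(h)^{-1}S(h^p)^{-1/p}\,\mathfrak{M}_\sigma(A_1^p,\ldots,A_n^p)^{1/p}\le\exp\left(\sum_{j=1}^n\omega_j\log A_j\right)\le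 S(h)S(h^p)^{1/p}\,\mathfrak{M}_\sigma(A_1^p,\ldots,A_n^p)^{1/p}$$ for all $p>0$.
   Context: $\mathbb{B}(\mathcal{H})$ is the algebra of bounded linear operators on a Hilbert space $\mathcal{H}$, $\mathbb{B}(\mathcal{H})^+$ its cone of positive operators, $\mathbb{P}(\mathcal{H})$ the set of positive invertible operators; $\le$ is the operator (Loewner) order, $I$ the identity, SOT the strong operator topology. A ($2$-variable, Kubo--Ando) operator mean is a map $\sigma:\mathbb{B}(\mathcal{H})^+\times\mathbb{B}(\mathcal{H})^+\to\mathbb{B}(\mathcal{H})^+$ with: (i) $A\le C,\ B\le D\Rightarrow A\sigma B\le C\sigma D$; (ii) $C(A\sigma B)C\le (CAC)\sigma(CBC)$ for $C\in\mathbb{B}(\mathcal{H})^+$; (iii) $A_k\searrow A,\ B_k\searrow B\Rightarrow A_k\sigma B_k\searrow A\sigma B$ (decreasing sequences converging in SOT); (iv) $I\sigma I=I$. Operator means correspond one-to-one to nonnegative operator monotone functions $f_\sigma$ on $(0,\infty)$ with $f_\sigma(1)=1$ via $A\sigma B=A^{1/2}f_\sigma(A^{-1/2}BA^{-1/2})A^{1/2}$ for positive invertible $A,B$. The left trivial mean is $A\ell B=A$. An $n$-variable operator mean is a map $\mathfrak{M}:\mathbb{P}(\mathcal{H})^n\to\mathbb{P}(\mathcal{H})$ with: (I) $A_j\le B_j$ for all $j$ implies $\mathfrak{M}(A_1,\ldots,A_n)\le\mathfrak{M}(B_1,\ldots,B_n)$; (II) $S^*\mathfrak{M}(A_1,\ldots,A_n)S=\mathfrak{M}(S^*A_1S,\ldots,S^*A_nS)$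 for every invertible $S\in\mathbb{B}(\mathcal{H})$; (III) if either $A_{jk}\nearrow A_j$ or $A_{jk}\searrow A_j$ as $k\to\infty$ for each $j$ (all in $\mathbb{P}(\mathcal{H})$), then $\mathfrak{M}(A_{1k},\ldots,A_{nk})\to\mathfrak{M}(A_1,\ldots,A_n)$ in SOT; (IV) $\mathfrak{M}(I,\ldots,I)=I$. For an $n$-variable operator mean $\mathfrak{M}$ and an operator mean $\sigma\ne\ell$, the deformed mean $\mathfrak{M}_\sigma(A_1,\ldots,A_n)$ is the unique solution $X\in\mathbb{P}(\mathcal{H})$ of $X=\mathfrak{M}(X\sigma A_1,\ldots,X\sigma A_n)$ (existence and uniqueness are known, and $\mathfrak{M}_\sigma$ is again an $n$-variable operator mean). A probability vector has $\omega_j\ge0$, $\sum_j\omega_j=1$. $\mathcal{A}_\omega(A_1,\ldots,A_n)=\sum_j\omega_jA_j$ and $\mathcal{H}_\omega(A_1,\ldots,A_n)=(\sum_j\omega_jA_j^{-1})^{-1}$; $\mathcal{H}_\omega\le\mathfrak{M}\le\mathcal{A}_\omega$ means the inequality holds at every $n$-tuple in $\mathbb{P}(\mathcal{H})$. The generalized Kantorovich constant is $K(h,p)=\frac{h^p-h}{(p-1)(h-1)}\left(\frac{p-1}{p}\frac{h^p-1}{h^p-h}\right)^p$. The Specht ratio is $S(h)=\frac{(h-1)h^{1/(h-1)}}{e\log h}$ for $h\ne1$, $S(1)=1$. *)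

(* Defs.v *)
From HB Require Import structures.
From mathcomp Require Import all_boot all_order all_algebra.
From mathcomp Require Import complex.
From mathcomp Require Import all_classical all_reals all_analysis.
Set Implicit Arguments.
Unset Strict Implicit.
Unset Printing Implicit Defensive.
Import Order.TTheory GRing.Theory Num.Theory.
Import numFieldNormedType.Exports.
Local Open Scope classical_set_scope.
Local Open Scope ring_scope.
Local Open Scope complex_scope.

Record hilbert (R : realType) := Hilbert {
  hilbert_sort :> completeNormedModType R[i] ;
  inner : {dot hilbert_sort for Num.conj} ;
  inner_norm : forall x : hilbert_sort, `|x| ^+ 2 = inner x x }.

Notation "''[' x , y ]" := (inner _ x y) : ring_scope.

(* Operators on H are plain functions H -> H, so that sums and scalar
   multiples are the pointwise ones; the carrier sets B(H), B(H)^+ and P(H) are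
   the predicates [bounded_op], [psd_op] and [pd_op]. *)

Section Operators.
Context {R : realType} {H : hilbert R}.
Implicit Types (A B S T X : H -> H).

Definition bounded_op A :=
  linear A /\ exists c : R[i], forall x, `|A x| <= c * `|x|.

(* The order of R[i] makes [0 <= z] say that z is real and nonnegative. *)
Definition positive A := forall x, 0 <= '[A x, x].

Definition loewner A B := positive (B - A).

Definition psd_op A := bounded_op A /\ positive A.

Definition is_inverse A B :=
  [/\ bounded_op B, A \o B = idfun & B \o A = idfun].

Definition invertible A := bounded_op A /\ exists B, is_inverse A B.

Definition pd_op A := psd_op A /\ invertible A.

Definition opinv A : H -> H := xget 0 [set B | is_inverse A B].

Definition adj S : H -> H :=
  xget 0 [set T | bounded_op T /\ forall x y, '[S x, y] = '[x, T y]].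

Definition scalar_op (c : R) : H -> H := c%:C *: idfun.

Definition sot_cvg (A_ : nat -> H -> H) A :=
  forall x, A_ k x @[k --> \oo] --> A x.

Definition decreasing_to (A_ : nat -> H -> H) A :=
  (forall k, loewner (A_ k.+1) (A_ k)) /\ sot_cvg A_ A.

Definition increasing_to (A_ : nat -> H -> H) A :=
  (forall k, loewner (A_ k) (A_ k.+1)) /\ sot_cvg A_ A.

Definition poly_op (P : {poly R}) A : H -> H :=
  \sum_(i < size P) (P`_i)%:C *: iter i A.

(* Continuous functional calculus of a self-adjoint A: f(A) is the limit in
   operator norm of P_k(A), for real polynomials P_k converging to f uniformly
   on an interval [a, b] that contains the spectrum of A (a I <= A <= b I). *)
Definition is_fcalc (f : R -> R) A B :=
  bounded_op B /\
  exists a b : R,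
    [/\ loewner (scalar_op a) A, loewner A (scalar_op b),
        {within `[a, b], continuous f} &
        exists P : nat -> {poly R},
          (forall e : R, 0 < e -> \forall k \near \oo,
             forall t, t \in `[a, b] -> `|(P k).[t] - f t| <= e) /\
          (forall e : R, 0 < e -> \forall k \near \oo,
             forall x, `|poly_op (P k) A x - B x| <= e%:C * `|x|)].

Definition fcalc (f : R -> R) A : H -> H := xget 0 [set B | is_fcalc f A B].

Definition op_pow A (p : R) : H -> H := fcalc (fun t => t `^ p) A.
Definition op_log A : H -> H := fcalc (@ln R) A.
Definition op_exp A : H -> H := fcalc (@expR R) A.

Definition finite_dim :=
  exists (d : nat) (e : 'I_d -> H),
    forall x, exists c : 'I_d -> R[i], x = \sum_i c i *: e i.

End Operators.

Notation "A <=L B" := (loewner A B) (at level 70, no associativity) : ring_scope.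

(* Operator monotonicity is meant on all Hilbert spaces at once. *)
Definition operator_monotone (R : realType) (f : R -> R) :=
  {in `]0, +oo[, continuous f} /\
  forall (K : hilbert R) (A B : K -> K),
    pd_op A -> pd_op B -> A <=L B -> fcalc f A <=L fcalc f B.

Section Means.
Context {R : realType} {H : hilbert R}.

(* On an infinite-dimensional H the first five fields are the Kubo-Ando axioms
   and the last one is void. On a finite-dimensional H these axioms alone do
   not yield the correspondence with operator monotone functions (on a
   one-dimensional H they allow min(a, b), for which the deformed means are not
   unique), so there the representing function is required. *)
Record operator_mean (sigma : (H -> H) -> (H -> H) -> H -> H) : Prop := {
  mean_psd : forall A B, psd_op A -> psd_op B -> psd_op (sigma A B) ;
  mean_monotone : forall A B C D, psd_op A -> psd_op B -> psd_op C -> psd_op D ->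
    A <=L C -> B <=L D -> sigma A B <=L sigma C D ;
  mean_transformer : forall A B C, psd_op A -> psd_op B -> psd_op C ->
    C \o sigma A B \o C <=L sigma (C \o A \o C) (C \o B \o C) ;
  mean_continuous : forall (A_ B_ : nat -> H -> H) A B,
    (forall k, psd_op (A_ k)) -> (forall k, psd_op (B_ k)) ->
    psd_op A -> psd_op B ->
    decreasing_to A_ A -> decreasing_to B_ B ->
    decreasing_to (fun k => sigma (A_ k) (B_ k)) (sigma A B) ;
  mean_normalized : sigma idfun idfun = idfun ;
  mean_representation : @finite_dim R H ->
    exists f : R -> R,
      [/\ operator_monotone f, forall t, 0 < t -> 0 <= f t, f 1 = 1 &
          forall A B, pd_op A -> pd_op B ->
            sigma A B =
            op_pow A (2^-1)
              \o fcalc f (op_pow A (- 2^-1) \o B \o op_pow A (- 2^-1))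
              \o op_pow A (2^-1)] }.

Definition left_trivial (sigma : (H -> H) -> (H -> H) -> H -> H) :=
  forall A B, psd_op A -> psd_op B -> sigma A B = A.

(* Only the values on tuples in P(H)^n matter. In the monotone continuity
   axiom the n sequences are all increasing or all decreasing. *)
Record multivariate_mean (n : nat) (MM : ('I_n -> H -> H) -> H -> H) : Prop := {
  mmean_pd : forall A, (forall j, pd_op (A j)) -> pd_op (MM A) ;
  mmean_monotone : forall A B,
    (forall j, pd_op (A j)) -> (forall j, pd_op (B j)) ->
    (forall j, A j <=L B j) -> MM A <=L MM B ;
  mmean_congruence : forall S A, invertible S -> (forall j, pd_op (A j)) ->
    adj S \o MM A \o S = MM (fun j => adj S \o A j \o S) ;
  mmean_continuous : forall (A_ : 'I_n -> nat -> H -> H) A,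
    (forall j k, pd_op (A_ j k)) -> (forall j, pd_op (A j)) ->
    (forall j, increasing_to (A_ j) (A j)) \/
    (forall j, decreasing_to (A_ j) (A j)) ->
    sot_cvg (fun k => MM (fun j => A_ j k)) (MM A) ;
  mmean_normalized : MM (fun=> idfun) = idfun }.

Definition deformed (n : nat) (MM : ('I_n -> H -> H) -> H -> H)
    (sigma : (H -> H) -> (H -> H) -> H -> H) (A : 'I_n -> H -> H) : H -> H :=
  xget 0 [set X | pd_op X /\ X = MM (fun j => sigma X (A j))].

Definition arith_mean (n : nat) (w : 'I_n -> R) (A : 'I_n -> H -> H) : H -> H :=
  \sum_j (w j)%:C *: A j.

Definition harm_mean (n : nat) (w : 'I_n -> R) (A : 'I_n -> H -> H) : H -> H :=
  opinv (\sum_j (w j)%:C *: opinv (A j)).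

End Means.

Definition probability_vector (R : realType) (n : nat) (w : 'I_n -> R) :=
  (forall j, 0 <= w j) /\ \sum_j w j = 1.

Definition Kantorovich (R : realType) (h p : R) : R :=
  (h `^ p - h) / ((p - 1) * (h - 1)) *
  ((p - 1) / p * ((h `^ p - 1) / (h `^ p - h))) `^ p.

Definition Specht (R : realType) (h : R) : R :=
  if h == 1 then 1
  else (h - 1) * h `^ ((h - 1)^-1) / (expR 1 * ln h).

(* Main.v *)
(* The representing function f of sigma (1 sigma t = f t) and its adjoint
   t |-> 1 / f (1 / t) are both concave, because compressing by rank-one
   projections P gives <(X sigma A) x, x> <= <X x, x> f (<A x, x> / <X x, x>) and
   the dual bound for (X sigma A)^-1. As sigma is not the left trivial mean, both
   have tangents of positive slope a, b at 1, so X sigma A <= (1 - a) X + a A and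
   (X sigma A)^-1 <= (1 - b) X^-1 + b A^-1. Hence every solution of
   X = M(X sigma A_1, ..., X sigma A_n) lies between the weighted harmonic and
   arithmetic means of the A_j; a solution is the limit of the decreasing
   iteration started at a large scalar.

   Write X_p for the solution with data A_j^p. Replacing t^(-q/p) on the spectral
   interval by its chord L turns the weighted arithmetic mean of the A_j^q into at
   most K times a power of the harmonic mean of the A_j^p; this compares X_q with
   X_p^(q/p). The power 1/q is operator monotone if q >= 1; otherwise
   A^r <= L(A) <= L(B) <= K B^r, again with a chord, replaces monotonicity. The
   logarithmic case is not obtained as a limit q -> 0: the chords of ln and exp
   give it directly, the Specht ratio being exp(c - 1) / c with
   c = ln h / (h - 1). *)
Require Import Defs.
From HB Require Import structures.
From mathcomp Require Import all_boot all_order all_algebra.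
From mathcomp Require Import complex.
From mathcomp Require Import all_classical all_reals all_analysis.
From mathcomp Require Import ring lra.
Set Implicit Arguments.
Unset Strict Implicit.
Unset Printing Implicit Defensive.
Import Order.TTheory GRing.Theory Num.Theory.
Import numFieldNormedType.Exports.
Local Open Scope classical_set_scope.
Local Open Scope ring_scope.
Local Open Scope complex_scope.

(** * Bounded operators and the Loewner order *)

(** Nearly everything is read off from the real quadratic forms [qf T x]. Positivity of p(T), for a
    polynomial p >= 0 on an interval carrying [T], is pure algebra and yields the whole functional
    calculus. Antitonicity of inversion is a Cauchy-Schwarz inequality. Since arithmetic and
    harmonic means keep operator monotonicity, their iteration gives powers with exponents in
    [0, 1].

    The harmonic bound is always used for inverses, where it becomes arithmetic: X_p <= sum w A^p
    and X_p^-1 <= sum w A^-p are treated alike. The exponent -q/p fits this symmetry: with s = q/p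
    in (0, 1], t^-s is convex, s = 1 included, and reverses the operator order. The intervals of A^p
    and of A^-p have the same endpoint ratio h^p, so a single constant serves both sides.

    [deformed] is a choice with default value 0; nothing can be said about it before a solution has
    been constructed. *)

Section RealInner.
Context {R : realType} {H : hilbert R}.
Implicit Types (x y z : H) (r : R).

Definition ip x y : R := complex.Re '[x, y].

Lemma Re_conj (z : R[i]) : complex.Re (Num.conj z) = complex.Re z.
Proof. by case: z. Qed.

Lemma inner_conj x y : '[x, y] = Num.conj '[y, x].
Proof. by rewrite (hermC (inner H)) expr0 mul1r. Qed.

Lemma ipC x y : ip x y = ip y x.
Proof. by rewrite /ip inner_conj Re_conj. Qed.

Lemma ReD (a b : R[i]) : complex.Re (a + b) = complex.Re a + complex.Re b.
Proof. by case: a; case: b. Qed.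

Lemma ReZ r (b : R[i]) : complex.Re (r%:C * b) = r * complex.Re b.
Proof. by case: b => u v /=; rewrite mul0r subr0. Qed.

Lemma ipDl x y z : ip (x + y) z = ip x z + ip y z.
Proof. by rewrite /ip linearDl ReD. Qed.

Lemma ipZl r x z : ip (r%:C *: x) z = r * ip x z.
Proof. by rewrite /ip linearZl_LR ReZ. Qed.

Lemma ipNl x z : ip (- x) z = - ip x z.
Proof.
have -> : - x = (-1)%:C *: x by rewrite rmorphN1 scaleN1r.
by rewrite ipZl mulN1r.
Qed.

Lemma ipBl x y z : ip (x - y) z = ip x z - ip y z.
Proof. by rewrite ipDl ipNl. Qed.

Lemma ipDr x y z : ip z (x + y) = ip z x + ip z y.
Proof. by rewrite ipC ipDl !(ipC z). Qed.
Lemma ipZr r x z : ip z (r%:C *: x) = r * ip z x.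
Proof. by rewrite ipC ipZl (ipC z). Qed.
Lemma ipNr x z : ip z (- x) = - ip z x.
Proof. by rewrite ipC ipNl (ipC z). Qed.
Lemma ipBr x y z : ip z (x - y) = ip z x - ip z y.
Proof. by rewrite ipDr ipNr. Qed.
Lemma ip0l x : ip 0 x = 0.
Proof. by rewrite -(scale0r 0) (_ : 0 = 0%:C) // ipZl mul0r. Qed.
Lemma ip0r x : ip x 0 = 0. Proof. by rewrite ipC ip0l. Qed.

Lemma inner_ip x : '[x, x] = (ip x x)%:C.
Proof.
have := dnorm_ge0 (inner H) x; rewrite /ip.
by case: '[x, x] => a b; rewrite lecE /= => /andP[/eqP -> _].
Qed.

Lemma ip_ge0 x : 0 <= ip x x.
Proof. by have := dnorm_ge0 (inner H) x; rewrite inner_ip lecR. Qed.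

Lemma ip_eq0 x : (ip x x == 0) = (x == 0).
Proof.
rewrite -(dnorm_eq0 (inner H)) inner_ip.
by apply/eqP/eqP => [->//|/complexI].
Qed.

Lemma ip_gt0 x : (0 < ip x x) = (x != 0).
Proof. by rewrite lt_def ip_eq0 ip_ge0 andbT. Qed.

Definition nrm x : R := Num.sqrt (ip x x).

Lemma nrm_ge0 x : 0 <= nrm x. Proof. exact: sqrtr_ge0. Qed.

Lemma sqr_nrm x : nrm x ^+ 2 = ip x x.
Proof. by rewrite sqr_sqrtr ?ip_ge0. Qed.

Lemma norm_nrm x : `|x| = (nrm x)%:C.
Proof.
apply/eqP; rewrite -(@eqrXn2 _ 2) ?normr_ge0 ?lecR ?nrm_ge0 //.
by rewrite inner_norm inner_ip -sqr_nrm rmorphXn.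
Qed.

Lemma ip_CS x y : ip x y ^+ 2 <= ip x x * ip y y.
Proof.
have [->|x0] := eqVneq x 0; first by rewrite !ip0l mul0r expr0n.
have xx : 0 < ip x x by rewrite ip_gt0.
have := ip_ge0 (y - (ip x y / ip x x)%:C *: x).
rewrite ipBl !ipBr !ipZl !ipZr (ipC y x).
set a := ip x x in xx *; set b := ip x y; set c := ip y y.
have -> : c - b / a * b - (b / a * b - b / a * (b / a * a)) = (a * c - b ^+ 2) / a.
  by field; rewrite gt_eqF.
by rewrite pmulr_lge0 ?invr_gt0 // subr_ge0 mulrC.
Qed.

End RealInner.

(** * Bounded operators as a ring and a real vector space *)

Section BoundedOperators.
Context {R : realType} (H : hilbert R).

(** Bundling makes the algebraic structures available; the coercion [bfun] leads back to the bare
    functions of the theorem. *)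
Record bop := Bop { bfun :> H -> H ; bfunP : bounded_op bfun }.

HB.instance Definition _ := gen_eqMixin bop.
HB.instance Definition _ := gen_choiceMixin bop.

Lemma bopP (S T : bop) : (forall x, S x = T x) -> S = T.
Proof.
case: S T => f fP [g gP] /= /funext fg; move: fP; rewrite fg => fP.
by congr Bop; exact: Prop_irrelevance.
Qed.

Lemma bop_lin (T : bop) : linear T. Proof. exact: (bfunP T).1. Qed.

Lemma bopD (T : bop) x y : T (x + y) = T x + T y.
Proof. by have := bop_lin T 1 x y; rewrite !scale1r. Qed.
Lemma bop0 (T : bop) : T 0 = 0.
Proof. by apply: (addIr (T 0)); rewrite -bopD !add0r. Qed.
Lemma bopZ (T : bop) a x : T (a *: x) = a *: T x.
Proof. by have := bop_lin T a x 0; rewrite bop0 !addr0. Qed.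
Lemma bopN (T : bop) x : T (- x) = - T x.
Proof. by rewrite -scaleN1r bopZ scaleN1r. Qed.
Lemma bopB (T : bop) x y : T (x - y) = T x - T y.
Proof. by rewrite bopD bopN. Qed.

Lemma bop_bound (T : bop) :
  exists2 c : R, 0 <= c & forall x, `|T x| <= c%:C * `|x|.
Proof.
have [_ [c cP]] := bfunP T; exists `|complex.Re c| => // x.
apply: (le_trans (cP x)); rewrite norm_nrm.
have := cP x; rewrite !norm_nrm; case: c {cP} => a b; rewrite !lecE /=.
rewrite !mulr0 !mul0r !subr0 addr0 add0r => /andP[/eqP <- _].
by rewrite eqxx /= ler_wpM2r ?nrm_ge0 ?ler_norm.
Qed.

Lemma zero_boundedP : bounded_op (fun _ : H => 0).
Proof.
split; first by move=> a x y; rewrite scaler0 addr0.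
by exists 0 => x; rewrite normr0 mul0r.
Qed.
Lemma id_boundedP : bounded_op (@idfun H).
Proof. by split => //; exists 1 => x; rewrite mul1r. Qed.
Lemma add_boundedP (S T : bop) : bounded_op (fun x => S x + T x).
Proof.
split; first by move=> a x y; rewrite !bop_lin scalerDr addrACA.
have [c _ cP] := bop_bound S; have [d _ dP] := bop_bound T.
exists (c%:C + d%:C) => x; rewrite mulrDl.
by apply: (le_trans (ler_normD _ _)); rewrite lerD.
Qed.
Lemma scale_boundedP a (S : bop) : bounded_op (fun x => a *: S x).
Proof.
split; first by move=> b x y; rewrite bop_lin scalerDr !scalerA mulrC.
have [c c0 cP] := bop_bound S.
exists (`|a| * c%:C) => x; rewrite normrZ -mulrA.
by apply: ler_wpM2l.
Qed.
Lemma comp_boundedP (S T : bop) : bounded_op (fun x => S (T x)).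
Proof.
split; first by move=> a x y; rewrite !bop_lin.
have [c c0 cP] := bop_bound S; have [d d0 dP] := bop_bound T.
exists (c%:C * d%:C) => x; rewrite -mulrA.
by apply: (le_trans (cP _)); rewrite ler_wpM2l ?lecR.
Qed.
Lemma opp_boundedP (S : bop) : bounded_op (fun x => - S x).
Proof.
have := scale_boundedP (-1) S.
by under eq_fun do rewrite scaleN1r.
Qed.

Definition badd S T := Bop (add_boundedP S T).
Definition bopp S := Bop (opp_boundedP S).
Definition bzero := Bop zero_boundedP.

Lemma baddA : associative badd. Proof. by move=> S T U; apply: bopP => x /=; rewrite addrA. Qed.
Lemma baddC : commutative badd. Proof. by move=> S T; apply: bopP => x /=; rewrite addrC. Qed.
Lemma badd0 : left_id bzero badd. Proof. by move=> S; apply: bopP => x /=; rewrite add0r. Qed.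
Lemma baddN : left_inverse bzero bopp badd.
Proof. by move=> S; apply: bopP => x /=; rewrite addNr. Qed.

HB.instance Definition _ := GRing.isZmodule.Build bop baddA baddC badd0 baddN.

Definition bmul S T := Bop (comp_boundedP S T).
Definition bone := Bop id_boundedP.

Lemma bmulA : associative bmul. Proof. by move=> S T U; apply: bopP. Qed.
Lemma bmul1 : left_id bone bmul. Proof. by move=> S; apply: bopP. Qed.
Lemma bmulr1 : right_id bone bmul. Proof. by move=> S; apply: bopP. Qed.
Lemma bmulDl : left_distributive bmul badd. Proof. by move=> S T U; apply: bopP. Qed.
Lemma bmulDr : right_distributive bmul badd.
Proof. by move=> S T U; apply: bopP => x /=; rewrite bopD. Qed.

HB.instance Definition _ := GRing.Zmodule_isPzRing.Build bop bmulA bmul1 bmulr1 bmulDl bmulDr.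

(* Only real scalars are needed on operators. *)
Definition bscale (a : R) S := Bop (scale_boundedP a%:C S).

Lemma bscaleA a b S : bscale a (bscale b S) = bscale (a * b) S.
Proof. by apply: bopP => x /=; rewrite scalerA rmorphM. Qed.
Lemma bscale1 : left_id 1 bscale.
Proof. by move=> S; apply: bopP => x /=; rewrite scale1r. Qed.
Lemma bscaleDr : right_distributive bscale +%R.
Proof. by move=> a S T; apply: bopP => x /=; rewrite scalerDr. Qed.
Lemma bscaleDl S : {morph bscale^~ S : a b / a + b}.
Proof. by move=> a b; apply: bopP => x /=; rewrite rmorphD scalerDl. Qed.

HB.instance Definition _ := GRing.Zmodule_isLmodule.Build R bop bscaleA bscale1 bscaleDr bscaleDl.

Lemma bscaleAl a (S T : bop) : a *: (S * T) = (a *: S) * T.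
Proof. by apply: bopP. Qed.
Lemma bscaleAr a (S T : bop) : a *: (S * T) = S * (a *: T).
Proof. by apply: bopP => x /=; rewrite bopZ. Qed.

End BoundedOperators.

(** * Quadratic forms, self-adjointness and Cauchy-Schwarz for positive operators *)

Section Order.
Context {R : realType} {H : hilbert R}.
Implicit Types (x y z : H) (r : R) (S T : bop H).

Lemma addE S T x : (S + T) x = S x + T x. Proof. by []. Qed.
Lemma oppE T x : (- T) x = - T x. Proof. by []. Qed.
Lemma mulE S T x : (S * T) x = S (T x). Proof. by []. Qed.
Lemma scaleE r T x : (r *: T) x = r%:C *: T x. Proof. by []. Qed.
Lemma oneE x : (1 : bop H) x = x. Proof. by []. Qed.
Lemma zeroE x : (0 : bop H) x = 0. Proof. by []. Qed.

(** Real parts suffice: replacing y by i y recovers the imaginary parts, as [T] is complex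
    linear. *)
Definition sa T := forall x y, ip (T x) y = ip x (T y).

Definition qf T x : R := ip (T x) x.

Definition ble S T := forall x, qf S x <= qf T x.

Lemma qfD S T x : qf (S + T) x = qf S x + qf T x.
Proof. by rewrite /qf addE ipDl. Qed.
Lemma qfN T x : qf (- T) x = - qf T x.
Proof. by rewrite /qf oppE ipNl. Qed.
Lemma qfB S T x : qf (S - T) x = qf S x - qf T x.
Proof. by rewrite qfD qfN. Qed.
Lemma qfZ r T x : qf (r *: T) x = r * qf T x.
Proof. by rewrite /qf scaleE ipZl. Qed.
Lemma qf1 x : qf 1 x = ip x x. Proof. by []. Qed.
Lemma qf0 x : qf 0 x = 0. Proof. exact: ip0l. Qed.

Lemma saD S T : sa S -> sa T -> sa (S + T).
Proof. by move=> sS sT x y; rewrite !addE ipDl ipDr sS sT. Qed.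
Lemma saN T : sa T -> sa (- T).
Proof. by move=> sT x y; rewrite !oppE ipNl ipNr sT. Qed.
Lemma saB S T : sa S -> sa T -> sa (S - T).
Proof. by move=> sS sT; apply: saD => //; apply: saN. Qed.
Lemma saZ r T : sa T -> sa (r *: T).
Proof. by move=> sT x y; rewrite !scaleE ipZl ipZr sT. Qed.
Lemma sa1 : sa 1. Proof. by []. Qed.
Lemma sa0 : sa 0. Proof. by move=> x y; rewrite !zeroE ip0l ip0r. Qed.
Lemma saM S T : sa S -> sa T -> S * T = T * S -> sa (S * T).
Proof. by move=> sS sT ST x y; rewrite {2}ST !mulE sS sT. Qed.

Lemma saX T n : sa T -> sa (T ^+ n).
Proof.
move=> sT; elim: n => [|n IH]; first by rewrite expr0; exact: sa1.
by rewrite exprS; apply: saM => //; rewrite -exprS -exprSr.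
Qed.
Lemma sa_sum (I : Type) (s : seq I) (P : pred I) (F : I -> bop H) :
  (forall i, P i -> sa (F i)) -> sa (\sum_(i <- s | P i) F i).
Proof. by move=> sF; apply: big_ind => //; [exact: sa0 | exact: saD]. Qed.
Lemma qf_sum (I : Type) (s : seq I) (P : pred I) (F : I -> bop H) x :
  qf (\sum_(i <- s | P i) F i) x = \sum_(i <- s | P i) qf (F i) x.
Proof. by elim/big_rec2: _ => [|i a b _ <-]; rewrite ?qf0 ?qfD. Qed.

Lemma qf_conj S T x : sa S -> qf (S * T * S) x = qf T (S x).
Proof. by move=> sS; rewrite /qf !mulE sS. Qed.

Lemma ble_trans S T (U : bop H) : ble T S -> ble S U -> ble T U.
Proof. by move=> ts su x; apply: le_trans (ts x) (su x). Qed.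

(** [positive] contains that the form is real; at x + i y its imaginary part is the difference of
    the real parts of <T y, x> and <T x, y>. *)
Lemma positive_sa T : positive T -> sa T.
Proof.
move=> pT x y; rewrite (ipC x).
have im u : complex.Im '[T u, u] = 0 by apply: ger0_Im.
have := im (x + 'i%C *: y).
rewrite bopD bopZ linearDl !linearDr /= !linearZr_LR !linearZl_LR /=.
have := im x; have := im y; rewrite /ip.
rewrite linearZr_LR /=.
case: '[T x, x] => a1 b1; case: '[T x, y] => a2 b2; case: '[T y, x] => a3 b3.
case: '[T y, y] => a4 b4 /= -> ->.
by rewrite !(mul0r, mulr0, mul1r, mulN1r, oppr0, add0r, addr0, sub0r, opprK, subr0) => h; lra.
Qed.

Lemma sa_Im T x : sa T -> complex.Im '[T x, x] = 0.
Proof.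
move=> sT; have := sT x ('i%C *: x); rewrite bopZ /ip !linearZr_LR /=.
rewrite (inner_conj x (T x)).
case: '[T x, x] => a b /=.
by rewrite !(mul0r, mulr0, mul1r, mulN1r, oppr0, add0r, addr0, sub0r, opprK, subr0) => h; lra.
Qed.

Lemma positiveP T : positive T <-> sa T /\ forall x, 0 <= qf T x.
Proof.
split=> [pT|[sT qT] x].
  split=> [|x]; first exact: positive_sa.
  by have := pT x; rewrite lecE => /andP[].
by have := qT x; have := sa_Im x sT; rewrite lecE /qf /ip /= => -> ->; rewrite eqxx.
Qed.

Lemma loewnerP S T : sa S -> sa T -> loewner S T <-> ble S T.
Proof.
move=> sS sT; have -> : loewner S T = positive (T - S : bop H) by [].
rewrite positiveP; split=> [[_ h] x|h].
  by have := h x; rewrite qfB subr_ge0.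
by split=> [|x]; [apply: saB | rewrite qfB subr_ge0].
Qed.

Lemma psd_CS T x y : sa T -> (forall x, 0 <= qf T x) ->
  ip (T x) y ^+ 2 <= qf T x * qf T y.
Proof.
move=> sT T0; have key (t : R) : 0 <= qf T x + 2 * t * ip (T x) y + t ^+ 2 * qf T y.
  have := T0 (x + t%:C *: y).
  rewrite /qf bopD bopZ ipDl !ipDr !ipZl !ipZr (sT y x) (ipC y (T x)).
  by congr (0 <= _); ring.
have [y0|y0] := eqVneq (qf T y) 0.
  have [->|b0] := eqVneq (ip (T x) y) 0; first by rewrite expr0n /= mulr_ge0.
  (* Without quadratic term, a nonnegative polynomial in t has no linear term either; this t would
     give it the value -1. *)
  have := key (- (qf T x + 1) / (2 * ip (T x) y)); rewrite y0 mulr0 addr0.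
  have -> : 2 * (- (qf T x + 1) / (2 * ip (T x) y)) * ip (T x) y = - (qf T x + 1).
    by field.
  by lra.
have y1 : 0 < qf T y by rewrite lt_def y0 T0.
have := key (- ip (T x) y / qf T y).
have -> : qf T x + 2 * (- ip (T x) y / qf T y) * ip (T x) y +
   (- ip (T x) y / qf T y) ^+ 2 * qf T y =
   (qf T x * qf T y - ip (T x) y ^+ 2) / qf T y by field.
by rewrite pmulr_lge0 ?invr_gt0 // subr_ge0.
Qed.

(** Cauchy-Schwarz for the form of [T] at x and T x. It turns convergence of forms into strong
    convergence in [decreasing_sot_limit]. *)
Lemma psd_nrm T c x : sa T -> (forall x, 0 <= qf T x) ->
  (forall x, qf T x <= c * ip x x) -> ip (T x) (T x) <= c * qf T x.
Proof.
move=> sT T0 Tc; have [->|n0] := eqVneq (T x) 0.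
  rewrite ip0l; have [->|x0] := eqVneq x 0; first by rewrite /qf ip0r mulr0.
  rewrite mulr_ge0 ?T0 //; have := le_trans (T0 x) (Tc x).
  by rewrite pmulr_lge0 // ip_gt0.
have n1 : 0 < ip (T x) (T x) by rewrite ip_gt0.
rewrite -(ler_pM2r n1) -expr2.
apply: le_trans (psd_CS x (T x) sT T0) _.
by rewrite mulrAC mulrC ler_wpM2r ?T0.
Qed.

Lemma psd_qf0 T x : sa T -> (forall x, 0 <= qf T x) -> qf T x = 0 -> T x = 0.
Proof.
move=> sT T0 x0; apply/eqP; rewrite -ip_eq0 -sqrf_eq0 eq_le sqr_ge0 andbT.
by have := psd_CS x (T x) sT T0; rewrite x0 mul0r.
Qed.

Lemma ble_anti S T : sa S -> sa T -> ble S T -> ble T S -> S = T.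
Proof.
move=> sS sT ST TS; apply: bopP => x; apply/eqP; rewrite -subr_eq0 -oppE -addE.
apply/eqP; apply: psd_qf0; first exact: saB.
  by move=> y; rewrite qfB subr_ge0.
by rewrite qfB; apply/eqP; rewrite subr_eq0 eq_le ST TS.
Qed.

End Order.

(** * Real polynomials in a self-adjoint operator *)

Section PolyEval.
Context {R : realType} {H : hilbert R}.
Implicit Types (p q : {poly R}) (T : bop H).

Definition peval p T : bop H := \sum_(i < size p) p`_i *: T ^+ i.

Lemma peval_wide p T n : (size p <= n)%N -> peval p T = \sum_(i < n) p`_i *: T ^+ i.
Proof.
move=> pn; rewrite /peval (big_ord_widen _ (fun i => p`_i *: T ^+ i) pn).
rewrite big_mkcond; apply: eq_bigr => i _; case: ltnP => // h.
by rewrite nth_default // scale0r.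
Qed.

Lemma pevalD p q T : peval (p + q) T = peval p T + peval q T.
Proof.
pose n := maxn (size p) (size q).
rewrite (@peval_wide _ _ n) ?size_polyD // (@peval_wide p _ n) ?leq_maxl //.
rewrite (@peval_wide q _ n) ?leq_maxr // -big_split; apply: eq_bigr => i _.
by rewrite coefD scalerDl.
Qed.

Lemma pevalZ r p T : peval (r *: p) T = r *: peval p T.
Proof.
rewrite (@peval_wide _ _ (size p)) ?size_scale_leq // scaler_sumr.
by apply: eq_bigr => i _; rewrite coefZ scalerA.
Qed.

Lemma pevalN p T : peval (- p) T = - peval p T.
Proof. by rewrite -scaleN1r pevalZ scaleN1r. Qed.

Lemma pevalB p q T : peval (p - q) T = peval p T - peval q T.
Proof. by rewrite pevalD pevalN. Qed.

Lemma pevalC c T : peval c%:P T = c *: (1 : bop H).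
Proof.
by rewrite (@peval_wide _ _ 1) ?size_polyC ?leq_b1 // big_ord1 coefC eqxx expr0.
Qed.

Lemma pevalMX p T : peval (p * 'X) T = peval p T * T.
Proof.
rewrite (@peval_wide _ _ (size p).+1); last first.
  by apply: (leq_trans (size_polyMleq _ _)); rewrite size_polyX addn2.
rewrite big_ord_recl coefMX eqxx scale0r add0r mulr_suml.
by apply: eq_bigr => i _; rewrite coefMX /= exprSr -bscaleAl.
Qed.

Lemma pevalX T : peval 'X T = T.
Proof. by rewrite -['X]mul1r pevalMX -[1]/1%:P pevalC scale1r mul1r. Qed.

Lemma peval_comm1 p T : peval p T * T = T * peval p T.
Proof.
rewrite mulr_suml mulr_sumr; apply: eq_bigr => i _.
by rewrite -bscaleAl -bscaleAr -exprS -exprSr.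
Qed.

Lemma pevalM p q T : peval (p * q) T = peval p T * peval q T.
Proof.
elim/poly_ind: p => [|p c IH].
  by rewrite mul0r -[0]/0%:P pevalC scale0r mul0r.
rewrite mulrDl pevalD -mulrA ['X * q]mulrC mulrA pevalMX IH mul_polyC pevalZ.
rewrite pevalD pevalMX pevalC mulrDl -bscaleAl mul1r; congr (_ + _).
by rewrite -!mulrA peval_comm1.
Qed.

Lemma sa_peval p T : sa T -> sa (peval p T).
Proof. by move=> sT; apply: sa_sum => i _; apply: saZ; apply: saX. Qed.

Lemma bop_sumE (I : Type) (s : seq I) (P : pred I) (F : I -> bop H) x :
  (\sum_(i <- s | P i) F i) x = \sum_(i <- s | P i) F i x.
Proof. by elim/big_rec2: _ => [|i a b _ <-]; rewrite ?zeroE ?addE. Qed.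

Lemma poly_opE p T : poly_op p T = peval p T.
Proof.
apply/funext => x; rewrite /poly_op /peval bop_sumE fct_sumE.
apply: eq_bigr => i _; rewrite scaleE; congr (_ *: _).
by elim: (nat_of_ord i) => [|k IH] //=; rewrite exprS mulE IH.
Qed.

(** Plays the role of the spectrum lying in [a, b], in terms of forms only. The interval need not be
    tight, so several operators can share one. *)
Definition spec a b T := sa T /\ forall x, a * ip x x <= qf T x <= b * ip x x.

Lemma spec_sa a b T : spec a b T -> sa T. Proof. by case. Qed.

(* A polynomial nonnegative on [a, b] equals its minimum plus (X - x0)^2 q, or
   (X - a) q, or (b - X) q with q again nonnegative; the four-fold statement is
   what this descent on the degree preserves. *)
Definition weight_pos a b p T :=
  [/\ forall x, 0 <= qf (peval p T) x,
      forall x, 0 <= qf (peval (('X - a%:P) * p) T) x,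
      forall x, 0 <= qf (peval ((b%:P - 'X) * p) T) x &
      forall x, 0 <= qf (peval (('X - a%:P) * (b%:P - 'X) * p) T) x].

Lemma peval_sqr p q T x : sa T -> qf (peval (p ^+ 2 * q) T) x = qf (peval q T) (peval p T x).
Proof.
move=> sT; rewrite expr2 -mulrA mulrCA [_ * q]mulrC mulrA pevalM pevalM.
by rewrite qf_conj //; apply: sa_peval.
Qed.

Lemma weight_posD a b p q T : weight_pos a b p T -> weight_pos a b q T ->
  weight_pos a b (p + q) T.
Proof.
move=> [p1 p2 p3 p4] [q1 q2 q3 q4].
by split=> x; rewrite ?[_ * (p + q)]mulrDr pevalD qfD; apply: addr_ge0.
Qed.

Lemma weight_posZ a b c p T : 0 <= c -> weight_pos a b p T -> weight_pos a b (c *: p) T.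
Proof.
move=> c0 [p1 p2 p3 p4].
by split=> x; rewrite -?scalerAr pevalZ qfZ; apply: mulr_ge0.
Qed.

Lemma weight_pos1 a b T : a < b -> spec a b T -> weight_pos a b 1 T.
Proof.
move=> ab [sT Tab].
have h1 x : 0 <= qf (peval 1 T) x by rewrite -[1]/1%:P pevalC scale1r ip_ge0.
have h2 x : 0 <= qf (peval ('X - a%:P) T) x.
  by rewrite pevalB pevalX pevalC qfB qfZ qf1 subr_ge0; have /andP[] := Tab x.
have h3 x : 0 <= qf (peval (b%:P - 'X) T) x.
  by rewrite pevalB pevalX pevalC qfB qfZ qf1 subr_ge0; have /andP[] := Tab x.
split=> x; rewrite ?mulr1 //.
have ba : 0 < b - a by rewrite subr_gt0.
(* Each summand is a square times a linear factor whose form is nonnegative by hypothesis. *)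
have -> : ('X - a%:P) * (b%:P - 'X) = (b - a)^-1 *:
   (('X - a%:P) ^+ 2 * (b%:P - 'X) + (b%:P - 'X) ^+ 2 * ('X - a%:P)).
  have -> : ('X - a%:P) ^+ 2 * (b%:P - 'X) + (b%:P - 'X) ^+ 2 * ('X - a%:P) =
     (b - a)%:P * (('X - a%:P) * (b%:P - 'X)) by rewrite polyCB; ring.
  by rewrite mul_polyC scalerA mulVf ?scale1r ?gt_eqF.
rewrite pevalZ qfZ pmulr_rge0 ?invr_gt0 // pevalD qfD !peval_sqr //.
exact: addr_ge0.
Qed.

Lemma weight_pos_sqr a b p q T : sa T -> weight_pos a b q T -> weight_pos a b (p ^+ 2 * q) T.
Proof.
move=> sT [q1 q2 q3 q4].
by split=> x; rewrite ?[_ * (p ^+ 2 * q)]mulrCA peval_sqr.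
Qed.

Lemma weight_posXa a b q T : sa T -> weight_pos a b q T -> weight_pos a b (('X - a%:P) * q) T.
Proof.
move=> sT [q1 q2 q3 q4]; split=> x //.
- by rewrite mulrA -expr2 peval_sqr.
- by rewrite mulrCA mulrA.
- rewrite [X in peval X](_ : _ = ('X - a%:P) ^+ 2 * ((b%:P - 'X) * q)); last by ring.
  by rewrite peval_sqr.
Qed.

Lemma weight_posbX a b q T : sa T -> weight_pos a b q T -> weight_pos a b ((b%:P - 'X) * q) T.
Proof.
move=> sT [q1 q2 q3 q4]; split=> x //.
- by rewrite mulrA.
- by rewrite mulrA -expr2 peval_sqr.
- rewrite [X in peval X](_ : _ = (b%:P - 'X) ^+ 2 * (('X - a%:P) * q)); last by ring.
  by rewrite peval_sqr.
Qed.

End PolyEval.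

(** * Weierstrass approximation *)

Section Weierstrass.
Context {R : realType}.
Implicit Types (f : R -> R) (g : nat -> R) (a b x : R).

Lemma unif_cont a b f : {within `[a, b], continuous f} ->
  forall e, 0 < e -> exists2 d, 0 < d &
    forall s t, s \in `[a, b] -> t \in `[a, b] -> `|s - t| < d -> `|f s - f t| <= e.
Proof.
move=> /subspace_continuousP cf e e0.
have /compact_near_coveringP cov := @segment_compact _ a b.
have := cov _ (nbhs (0 : R)^'+) (fun d x => x \in `[a, b] -> forall t, t \in `[a, b] ->
   `|x - t| < d -> `|f x - f t| <= e) _.
case.
  move=> x xab; have e2 : 0 < e / 2 by rewrite divr_gt0.
  have /cvgrPdist_le /(_ _ e2) := cf x xab.
  rewrite near_withinE => /nbhs_ballP[d /= d0 dP].
  have d2 : 0 < d / 2 by rewrite divr_gt0.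
  exists (ball x (d / 2), [set r | 0 < r < d / 2]) => /=.
    split; first exact: nbhsx_ballx.
    exists (d / 2) => //= r /=; rewrite sub0r normrN => r1 r0.
    by rewrite r0 /= (le_lt_trans (ler_norm _)).
  move=> [y r] /= [xy /andP[r0 rd] yab t tab yt].
  have h z : z \in `[a, b] -> `|x - z| < d -> `|f x - f z| <= e / 2.
    by move=> zab xz; apply: dP => //; exact: zab.
  have h1 : `|f x - f y| <= e / 2.
    by apply: h => //; apply: lt_trans xy _; rewrite ltr_pdivrMr // ltr_pMr // ltr1n.
  have h2 : `|f x - f t| <= e / 2.
    apply: h => //; apply: le_lt_trans (ler_distD y _ _) _.
    by rewrite [d]splitr ltrD // (lt_trans yt).
  apply: le_trans (ler_distD (f x) _ _) _.
  by rewrite [e]splitr lerD // distrC.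
move=> d /= d0 dP; exists (d / 2); first by rewrite divr_gt0.
move=> s t sab tab st; apply: (dP (d / 2)) => //=.
  rewrite sub0r normrN gtr0_norm ?divr_gt0 //.
  by rewrite ltr_pdivrMr // ltr_pMr // ltr1n.
by rewrite divr_gt0.
Qed.

(* The Bernstein polynomial sum_k g k C(n, k) X^k (1 - X)^(n - k). *)
Fixpoint bernstein n g : {poly R} :=
  if n is n'.+1 then (1 - 'X) * bernstein n' g + 'X * bernstein n' (g \o S)
  else (g 0)%:P.

Lemma bernsteinS n g x : (bernstein n.+1 g).[x] =
  (1 - x) * (bernstein n g).[x] + x * (bernstein n (g \o S)).[x].
Proof. by rewrite /= !hornerE. Qed.

Lemma bernstein_le n g h x : 0 <= x <= 1 -> (forall k, (k <= n)%N -> g k <= h k) ->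
  (bernstein n g).[x] <= (bernstein n h).[x].
Proof.
move=> /andP[x0 x1]; elim: n g h => [|n IH] g h gh; first by rewrite !hornerC gh.
rewrite !bernsteinS lerD // ler_wpM2l ?subr_ge0 //; apply: IH => k kn; apply: gh => //.
exact: leqW.
Qed.

(** The moments of order 0, 1 and 2 of the binomial law in one formula; quadratics in k are stable
    under the shift [g \o S], so the induction closes. *)
Lemma bernstein_quad n (c d e : R) x :
  (bernstein n (fun k => c + d * k%:R + e * k%:R ^+ 2)).[x] =
  c + d * n%:R * x + e * (n%:R * x * (1 - x) + (n%:R * x) ^+ 2).
Proof.
elim: n c d e => [|n IH] c d e; first by rewrite /= hornerC; ring.
rewrite bernsteinS IH.
have -> : (fun k => c + d * k%:R + e * k%:R ^+ 2) \o S =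
  (fun k => (c + d + e) + (d + 2 * e) * k%:R + e * k%:R ^+ 2).
  by apply/funext => k /=; rewrite -natr1; ring.
by rewrite IH -natr1; ring.
Qed.

(** For fixed t, f lies between two parabolas centred at t. The Bernstein operator is monotone and
    explicit on parabolas, so its value at t is off by at most e / 2 + C t (1 - t) / n. *)
Lemma weierstrass01 f : {within `[0, 1], continuous f} -> forall e, 0 < e ->
  exists p : {poly R}, forall t, t \in `[0, 1] -> `|p.[t] - f t| <= e.
Proof.
move=> cf e e0; have e2 : 0 < e / 2 by rewrite divr_gt0.
have [d d0 dP] := unif_cont cf e2.
have [u uI uP] := EVT_max ler01 cf.
have [v vI vP] := EVT_min ler01 cf.
(* The oscillation of f over d^2: the parabola takes over as soon as |s - t| >= d. The added 1 keeps
   C positive for constant f. *)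
pose C := (f u - f v + 1) / d ^+ 2.
have C0 : 0 < C.
  rewrite divr_gt0 ?exprn_gt0 //.
  by have := uP _ vI; lra.
have key s t : s \in `[0, 1] -> t \in `[0, 1] -> `|f s - f t| <= e / 2 + C * (s - t) ^+ 2.
  move=> sI tI; have [st|st] := ltP `|s - t| d.
    apply: le_trans (dP _ _ sI tI st) _.
    by rewrite lerDl mulr_ge0 ?sqr_ge0 // ltW.
  have h : 1 <= (s - t) ^+ 2 / d ^+ 2.
    rewrite ler_pdivlMr ?exprn_gt0 // mul1r -[(s - t) ^+ 2]real_normK ?num_real //.
    by rewrite ler_sqr ?nnegrE // ltW.
  have : `|f s - f t| <= f u - f v + 1.
    have := uP _ sI; have := uP _ tI; have := vP _ sI; have := vP _ tI.
    by rewrite ler_norml => ? ? ? ?; apply/andP; split; lra.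
  move=> h1; have : f u - f v + 1 <= C * (s - t) ^+ 2.
    rewrite /C mulrAC -mulrA ler_peMr //.
    have := normr_ge0 (f s - f t); lra.
  lra.
pose n := (Num.trunc (C / e * 2)).+1.
have n0 : 0 < n%:R :> R by rewrite ltr0n.
have nC : C / n%:R <= e / 2.
  rewrite ler_pdivrMr // mulrC -ler_pdivrMr //.
  have -> : C / (e / 2) = C / e * 2 by field; rewrite gt_eqF.
  by apply/ltW/truncnS_gt.
exists (bernstein n (fun k => f (k%:R / n%:R))) => t tI.
have t01 : 0 <= t <= 1 by [].
have kI k : (k <= n)%N -> (k%:R / n%:R : R) \in `[0, 1].
  move=> kn; rewrite in_itv /= divr_ge0 //= ler_pdivrMr // mul1r ler_nat //.
have tt : t * (1 - t) <= 1 by case/andP: t01 => ? ?; nra.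
have bnd : C * (t * (1 - t)) / n%:R <= e / 2.
  apply: le_trans nC; rewrite ler_pM2r ?invr_gt0 //.
  by rewrite ler_piMr // ltW.
rewrite ler_norml; apply/andP; split.
  have /(bernstein_le t01) : forall k, (k <= n)%N ->
      (f t - e / 2 - C * t ^+ 2) + (2 * C * t / n%:R) * k%:R +
      (- C / n%:R ^+ 2) * k%:R ^+ 2 <= f (k%:R / n%:R).
    move=> k kn; have := key _ _ (kI _ kn) tI; rewrite ler_norml => /andP[h _].
    have -> : f t - e / 2 - C * t ^+ 2 + 2 * C * t / n%:R * k%:R + - C / n%:R ^+ 2 * k%:R ^+ 2
     = f t - (e / 2 + C * (k%:R / n%:R - t) ^+ 2) by field; rewrite gt_eqF.
    lra.
  rewrite bernstein_quad; set L := (X in X <= _ -> _); have -> : L = f t - e / 2 - C * (t * (1 - t)) / n%:R.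
    by rewrite /L; field; rewrite gt_eqF.
  lra.
have /(bernstein_le t01) : forall k, (k <= n)%N ->
    f (k%:R / n%:R) <= (f t + e / 2 + C * t ^+ 2) + (- 2 * C * t / n%:R) * k%:R +
    (C / n%:R ^+ 2) * k%:R ^+ 2.
  move=> k kn; have := key _ _ (kI _ kn) tI; rewrite ler_norml => /andP[_ h].
  have -> : f t + e / 2 + C * t ^+ 2 + - 2 * C * t / n%:R * k%:R + C / n%:R ^+ 2 * k%:R ^+ 2
   = f t + (e / 2 + C * (k%:R / n%:R - t) ^+ 2) by field; rewrite gt_eqF.
  lra.
rewrite bernstein_quad; set L := (X in _ <= X -> _); have -> : L = f t + e / 2 + C * (t * (1 - t)) / n%:R.
  by rewrite /L; field; rewrite gt_eqF.
lra.
Qed.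

Lemma weierstrass a b f : {within `[a, b], continuous f} -> forall e, 0 < e ->
  exists p : {poly R}, forall t, t \in `[a, b] -> `|p.[t] - f t| <= e.
Proof.
move=> cf e e0; have [ab|] := ltP a b; last first.
  rewrite le_eqVlt => /orP[/eqP ba|ba].
    exists (f a)%:P => t; rewrite ba in_itv /= => /andP[t1 t2].
    by rewrite (le_anti (introT andP (conj t1 t2))) hornerC subrr normr0 ltW.
  by exists 0 => t; rewrite in_itv /= => /andP[t1 t2]; have := le_trans t1 t2; rewrite leNgt ba.
have ba : 0 < b - a by rewrite subr_gt0.
pose g u := f (a + (b - a) * u).
have gI u : u \in `[0, 1] -> a + (b - a) * u \in `[a, b].
  by rewrite !in_itv /= => /andP[u0 u1]; apply/andP; split; nra.
have cg : {within `[0, 1], continuous g}.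
  apply/subspace_continuousP => u uI; apply/cvgrPdist_le => d d0.
  have [r r0 rP] := unif_cont cf d0.
  rewrite near_withinE; near=> v => vI; apply: rP; [exact: gI|exact: gI|].
  have -> : a + (b - a) * u - (a + (b - a) * v) = (b - a) * (u - v) by ring.
  rewrite normrM gtr0_norm // mulrC -ltr_pdivlMr //.
  near: v; apply: cvgr_dist_lt; last by rewrite divr_gt0.
  exact: cvg_id.
have [p pP] := weierstrass01 cg e0.
exists (p \Po ((b - a)^-1 *: ('X - a%:P))) => t tI.
rewrite horner_comp !hornerE.
have := pP ((b - a)^-1 * (t - a)); rewrite /g mulVKf ?gt_eqF // subrKC; apply.
move: tI; rewrite !in_itv /= => /andP[ta tb].
by rewrite mulr_ge0 ?invr_ge0 ?subr_ge0 ?(ltW ab) //= mulrC ler_pdivrMr // mul1r lerB.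
Unshelve. all: by end_near.
Qed.

End Weierstrass.

(** * Continuous functional calculus *)

Section PolyPositivity.
Context {R : realType} {H : hilbert R}.
Implicit Types (p q : {poly R}) (T : bop H) (a b c : R).

(** Dividing by a linear factor tells the sign of the quotient only away from the root c; this
    supplies the sign at c. *)
Lemma poly_ge0_closure a b c p : a < b -> c \in `[a, b] ->
  (forall t, t \in `[a, b] -> t != c -> 0 <= p.[t]) -> 0 <= p.[c].
Proof.
move=> ab cab pos; rewrite leNgt; apply/negP => pc.
have := @continuous_horner R p c => /cvgr_lt /(_ _ pc) /nbhs_ballP[d /= d0 dP].
move: cab; rewrite in_itv /= => /andP[ac cb].
pose r := Num.min (d / 2) ((b - a) / 2).
have r0 : 0 < r by rewrite lt_min !divr_gt0 // subr_gt0.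
have rd : r < d by rewrite gt_min ltr_pdivrMr // ltr_pMr // ltr1n.
have rb : r <= (b - a) / 2 by rewrite ge_min lexx orbT.
have [h|h] := leP c ((a + b) / 2).
  have /dP /= : ball c d (c + r) by rewrite /ball /= opprD addrA subrr sub0r normrN gtr0_norm.
  by rewrite ltNge pos // ?gt_eqF ?ltrDl // in_itv /=; apply/andP; split; lra.
have /dP /= : ball c d (c - r) by rewrite /ball /= opprB addrC subrK gtr0_norm.
by rewrite ltNge pos // ?lt_eqF ?gtrBl // in_itv /=; apply/andP; split; lra.
Qed.

Lemma poly_weight_pos a b p T : a < b -> spec a b T ->
  (forall t, t \in `[a, b] -> 0 <= p.[t]) -> weight_pos a b p T.
Proof.
move=> ab specT; have sT := spec_sa specT.
have W1 := weight_pos1 ab specT.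
have [n] := ubnP (size p); elim: n p => // n IH p; rewrite ltnS => pn p0.
have [x0 x0I x0P] := EVT_min (ltW ab) (continuous_subspaceT (@continuous_horner R p)).
have Wmu : weight_pos a b (p.[x0])%:P T.
  by rewrite -[X in weight_pos _ _ X]mulr1 mul_polyC; apply: weight_posZ => //; apply: p0.
have [p1|p1] := leqP (size p) 1.
  by rewrite (size1_polyC p1) in Wmu *; rewrite hornerC in Wmu.
have rt : root (p - (p.[x0])%:P) x0 by rewrite rootE !hornerE subrr.
have [q qE] := factor_theorem _ _ rt.
have pE : p = (p.[x0])%:P + q * ('X - x0%:P) by rewrite -qE; ring.
have sq : (size q < size p)%N.
  have [->|q0] := eqVneq q 0; first by rewrite size_poly0 (ltn_trans _ p1).
  have : size (q * ('X - x0%:P)) = (size q).+1.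
    by rewrite size_Mmonic ?monicXsubC // size_XsubC addn2.
  rewrite -qE size_polyDl => [->//|].
  by rewrite size_polyN (leq_ltn_trans (size_polyC_leq1 _)).
have qP t : t \in `[a, b] -> 0 <= q.[t] * (t - x0).
  move=> tI; have := x0P _ tI; rewrite -subr_ge0.
  by rewrite {1}pE !hornerE addrC addKr.
rewrite pE; apply: weight_posD => //; rewrite mulrC.
move: (x0I); rewrite in_itv /= => /andP[]; rewrite le_eqVlt => /orP[/eqP ax _|ax].
  rewrite -ax; apply: weight_posXa => //; apply: IH; first exact: leq_trans sq pn.
  move=> t tI; have [->|ta] := eqVneq t a; last first.
    have := qP _ tI; rewrite pmulr_lge0 // subr_gt0 -ax lt_neqAle eq_sym ta.
    by move: tI; rewrite in_itv => /andP[].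
  apply: (poly_ge0_closure ab); first by rewrite in_itv /= lexx ltW.
  move=> s sI sa; have := qP _ sI; rewrite pmulr_lge0 // subr_gt0 -ax lt_neqAle eq_sym sa.
  by move: sI; rewrite in_itv => /andP[].
rewrite le_eqVlt => /orP[/eqP xb|xb].
  rewrite xb -mulrNN opprB; apply: weight_posbX => //; apply: IH.
    by rewrite size_polyN; exact: leq_trans sq pn.
  have nP s : s \in `[a, b] -> s != b -> 0 <= (- q).[s].
    move=> sI sb; have := qP _ sI; rewrite -mulrNN -hornerN pmulr_lge0 //.
    rewrite opprB subr_gt0 xb lt_neqAle sb.
    by move: sI; rewrite in_itv => /andP[].
  move=> t tI; have [->|tb] := eqVneq t b; last exact: nP.
  by apply: (poly_ge0_closure ab) => //; rewrite in_itv /= lexx ltW.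
(* At an interior minimum q is nonnegative to the right and nonpositive to the left, so x0 is a root
   of q as well and the factor is a square. *)
have qr s : s \in `[a, b] -> x0 < s -> 0 <= q.[s].
  by move=> sI xs; have := qP _ sI; rewrite pmulr_lge0 // subr_gt0.
have ql s : s \in `[a, b] -> s < x0 -> 0 <= (- q).[s].
  by move=> sI xs; have := qP _ sI; rewrite -mulrNN -hornerN pmulr_lge0 // opprB subr_gt0.
have q00 : root q x0.
  rewrite rootE eq_le; apply/andP; split.
    rewrite -oppr_ge0 -hornerN; apply: (poly_ge0_closure ax).
      by rewrite in_itv /= lexx (ltW ax).
    move=> s; rewrite in_itv /= => /andP[s1 s2] s3; apply: ql; last by rewrite lt_neqAle s3.
    by rewrite in_itv /= s1 (le_trans s2 (ltW xb)).
  apply: (poly_ge0_closure xb).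
    by rewrite in_itv /= lexx (ltW xb).
  move=> s; rewrite in_itv /= => /andP[s1 s2] s3.
  apply: qr; last by rewrite lt_neqAle eq_sym s3.
  by rewrite in_itv /= s2 (le_trans (ltW ax) s1).
have [r rE] := factor_theorem _ _ q00.
rewrite rE [X in weight_pos _ _ X _](_ : _ = ('X - x0%:P) ^+ 2 * r); last by ring.
apply: weight_pos_sqr => //; apply: IH.
  apply: leq_trans pn; apply: leq_trans sq.
  have [->|r0] := eqVneq r 0; first by rewrite size_poly0.
  by rewrite rE size_Mmonic ?monicXsubC // size_XsubC addn2 /=.
have rP s : s \in `[a, b] -> s != x0 -> 0 <= r.[s].
  move=> sI sx; have := qP _ sI; rewrite rE !hornerE -mulrA -expr2 pmulr_lge0 //.
  by rewrite exprn_even_gt0 //= subr_eq0.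
move=> t tI; have [->|tx] := eqVneq t x0; last exact: rP.
exact: (poly_ge0_closure ab).
Qed.

Lemma peval_ge0 a b p T x : spec a b T ->
  (forall t, t \in `[a, b] -> 0 <= p.[t]) -> 0 <= qf (peval p T) x.
Proof.
move=> specT p0; have [ab|] := ltP a b.
  by have [] := poly_weight_pos ab specT p0.
have [sT Tab] := specT.
rewrite le_eqVlt => /orP[/eqP ba|ba].
  have TE : T = a *: (1 : bop H).
    apply: ble_anti => //; first exact/saZ/sa1; move=> y; rewrite qfZ qf1.
      by have /andP[_] := Tab y; rewrite ba.
    by have /andP[] := Tab y.
  have rt : root (p - (p.[a])%:P) a by rewrite rootE !hornerE subrr.
  have [q qE] := factor_theorem _ _ rt.
  have -> : p = (p.[a])%:P + q * ('X - a%:P) by rewrite -qE; ring.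
  rewrite pevalD pevalM pevalB pevalX !pevalC {2}TE subrr mulr0 addr0 qfZ.
  by rewrite mulr_ge0 ?ip_ge0 // p0 // ba in_itv /= lexx.
(* If b < a, the two bounds on the form force x = 0. *)
have /andP[h1 h2] := Tab x; have := le_trans h1 h2.
rewrite -subr_ge0 -mulrBl nmulr_rge0 ?subr_lt0 // => h.
have /eqP : ip x x = 0 by apply/eqP; rewrite eq_le h ip_ge0.
by rewrite ip_eq0 => /eqP ->; rewrite /qf ip0r.
Qed.

End PolyPositivity.

(** * Limits of operators in norm *)

Section NormLimits.
Context {R : realType} {H : hilbert R}.
Implicit Types (x y : H) (T : bop H).

Lemma nrmD x y : nrm (x + y) <= nrm x + nrm y.
Proof. by rewrite -lecR rmorphD /= -!norm_nrm ler_normD. Qed.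
Lemma nrmN x : nrm (- x) = nrm x.
Proof. by rewrite /nrm ipNl ipNr opprK. Qed.
Lemma nrmB x y : nrm (x - y) = nrm (y - x).
Proof. by rewrite -nrmN opprB. Qed.
Lemma nrm_dist y x z : nrm (x - z) <= nrm (x - y) + nrm (y - z).
Proof. by apply: le_trans (nrmD _ _); rewrite addrA subrK. Qed.
Lemma nrmZ (r : R) x : nrm (r%:C *: x) = `|r| * nrm x.
Proof. by rewrite /nrm ipZl ipZr mulrA -expr2 sqrtrM ?sqr_ge0 // sqrtr_sqr. Qed.
Lemma nrm0 : nrm (0 : H) = 0. Proof. by rewrite /nrm ip0l sqrtr0. Qed.
Lemma nrm_eq0 x : (nrm x == 0) = (x == 0).
Proof. by rewrite -sqrf_eq0 sqr_nrm ip_eq0. Qed.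

Lemma ip_nrm x y : `|ip x y| <= nrm x * nrm y.
Proof.
rewrite -(@ler_sqr _ _ _) ?nnegrE ?mulr_ge0 ?nrm_ge0 //.
by rewrite real_normK ?num_real // exprMn !sqr_nrm ip_CS.
Qed.

Lemma le_nrm_eps x (c : R) : (forall e, 0 < e -> nrm x <= c + e) -> nrm x <= c.
Proof. by move=> h; apply/ler_addgt0Pr => e /h. Qed.

Lemma cvg_nrmP (u : nat -> H) x : (u k @[k --> \oo] --> x) <->
  (forall e : R, 0 < e -> \forall k \near \oo, nrm (u k - x) <= e).
Proof.
split=> [/cvgrPdist_le h e e0|h].
  have e0' : 0 < e%:C :> R[i] by rewrite (ltcR 0).
  near=> k; rewrite -lecR -norm_nrm distrC; near: k; exact: h.
apply/cvgrPdist_le => e; case: e => a b; rewrite ltcE /= => /andP[/eqP -> a0].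
near=> k; rewrite distrC norm_nrm (lecR _ a); near: k; exact: h.
Unshelve. all: by end_near.
Qed.

Lemma pointwise_limit (T_ : nat -> bop H) (L : H -> H) (c : R) :
  (forall k x, nrm (T_ k x) <= c * nrm x) ->
  (forall x, T_ k x @[k --> \oo] --> L x) -> bounded_op L.
Proof.
move=> Tc cvL; split.
  move=> a x y; have h1 := cvL (a *: x + y).
  have h2 : T_ k (a *: x + y) @[k --> \oo] --> a *: L x + L y.
    have -> : (fun k => T_ k (a *: x + y)) = (fun k => a *: T_ k x + T_ k y).
      by apply/funext => k; rewrite bop_lin.
    by apply: cvgD; [apply: cvgZr|]; exact: cvL.
  exact: cvg_unique h1 h2.
exists c%:C => x; rewrite !norm_nrm -rmorphM lecR.
apply: le_nrm_eps => e e0; have /cvg_nrmP/(_ _ e0) := cvL x.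
move=> [k _ /(_ k (leqnn k)) /= h].
have := nrmD (T_ k x) (L x - T_ k x); rewrite subrKC => /le_trans; apply.
by rewrite lerD // nrmB.
Qed.

Lemma nrm_cauchy_cvg (u : nat -> H) :
  (forall e : R, 0 < e -> exists N, forall j k, (N <= j)%N -> (N <= k)%N ->
     nrm (u j - u k) <= e) ->
  exists l : H, u k @[k --> \oo] --> l.
Proof.
move=> h; suff /cauchy_cvgP cu : cauchy (u @ \oo) by exists (lim (u @ \oo)).
apply/cauchy_ballP => -[a b]; rewrite ltcE /= => /andP[/eqP -> a0].
have [N hN] := h (a / 2) (divr_gt0 a0 (ltr0Sn _ 1)).
exists ([set v | exists2 k, (N <= k)%N & v = u k], [set v | exists2 k, (N <= k)%N & v = u k]) => /=.
  by split; exists N => // k /= Nk; exists k.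
move=> [v1 v2] /= [[j Nj ->] [k Nk ->]]; rewrite -ball_normE /= norm_nrm.
rewrite (ltcR _ a); apply: le_lt_trans (hN _ _ Nj Nk) _.
by rewrite ltr_pdivrMr // ltr_pMr // ltr1n.
Qed.

Lemma bop_nrm_bound T : exists2 c : R, 0 <= c & forall x, nrm (T x) <= c * nrm x.
Proof.
have [c c0 cP] := bop_bound T; exists c => // x.
by have := cP x; rewrite !norm_nrm -rmorphM lecR.
Qed.

Lemma bop_cauchy (T_ : nat -> bop H) :
  (forall e : R, 0 < e -> exists N, forall j k, (N <= j)%N -> (N <= k)%N ->
     forall x, nrm (T_ j x - T_ k x) <= e * nrm x) ->
  exists B : bop H, forall e : R, 0 < e -> \forall k \near \oo,
     forall x, nrm (T_ k x - B x) <= e * nrm x.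
Proof.
move=> h.
have cv x : exists l : H, T_ k x @[k --> \oo] --> l.
  apply: nrm_cauchy_cvg => e e0; have n0 : 0 < nrm x + 1 by rewrite ltr_wpDl ?nrm_ge0.
  have [N hN] := h (e / (nrm x + 1)) (divr_gt0 e0 n0).
  exists N => j k Nj Nk; apply: le_trans (hN _ _ Nj Nk x) _.
  by rewrite -mulrA ler_piMr ?(ltW e0) // mulrC ler_pdivrMr // mul1r lerDl.
pose L x := projT1 (cid (cv x)).
have cvL x : T_ k x @[k --> \oo] --> L x by exact: (projT2 (cid (cv x))).
have unif e : 0 < e -> \forall k \near \oo, forall x, nrm (T_ k x - L x) <= e * nrm x.
  move=> /h[N hN]; exists N => // k /= Nk x; apply: le_nrm_eps => d d0.
  have /cvg_nrmP/(_ _ d0) := cvL x; move=> [N' _ h'].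
  apply: le_trans (nrm_dist (T_ (maxn N N') x) _ _) _; rewrite lerD //.
    by apply: hN => //; exact: leq_maxl.
  by apply: h' => /=; exact: leq_maxr.
have [N hN] := h 1 ltr01.
have [c c0 cP] := bop_nrm_bound (T_ N).
have LP : bounded_op L.
  apply: (@pointwise_limit (fun k => T_ (N + k)%N) L (1 + c)).
    move=> k x; have := nrmD (T_ (N + k)%N x - T_ N x) (T_ N x); rewrite subrK.
    by move=> /le_trans; apply; rewrite mulrDl lerD // hN // leq_addr.
  move=> x; have := cvL x; rewrite -(cvg_shiftn N).
  by under [in X in X -> _]eq_fun do rewrite addnC.
by exists (Bop LP).
Qed.

End NormLimits.

Section FunctionalCalculus.
Context {R : realType} {H : hilbert R}.
Implicit Types (p q : {poly R}) (T S B : bop H) (a b c d e : R) (f g : R -> R) (x : H).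

Definition near_on a b (f g : R -> R) e := forall t, t \in `[a, b] -> `|f t - g t| <= e.

Lemma near_onC a b f g e : near_on a b f g e -> near_on a b g f e.
Proof. by move=> h t /h; rewrite distrC. Qed.

Lemma near_on_trans a b f g k e d :
  near_on a b f g e -> near_on a b g k d -> near_on a b f k (e + d).
Proof.
by move=> fg gk t tI; apply: le_trans (ler_distD (g t) _ _) _; rewrite lerD ?fg ?gk.
Qed.

Definition near_op S T e := forall x, nrm (S x - T x) <= e * nrm x.

Lemma near_opC S T e : near_op S T e -> near_op T S e.
Proof. by move=> h x; rewrite nrmB h. Qed.
Lemma near_op_trans S T B e d : near_op S T e -> near_op T B d -> near_op S B (e + d).
Proof. by move=> h h' x; rewrite mulrDl (le_trans (nrm_dist (T x) _ _)) // lerD. Qed.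

Lemma near_op_eq S T (c : R) : (forall e, 0 < e -> near_op S T (c * e)) -> S = T.
Proof.
move=> h; apply: bopP => x; apply/eqP; rewrite -subr_eq0 -nrm_eq0 eq_le nrm_ge0 andbT.
apply: le_nrm_eps => e e0; rewrite add0r.
have k0 : 0 < `|c| * nrm x + 1 by rewrite ltr_wpDl // mulr_ge0 ?nrm_ge0.
apply: le_trans (h _ (divr_gt0 e0 k0) x) _.
rewrite mulrAC mulrA ler_pdivrMr // mulrC ler_wpM2l ?(ltW e0) //.
by rewrite (@le_trans _ _ (`|c| * nrm x)) ?lerDl // ler_wpM2r ?nrm_ge0 // ler_norm.
Qed.

(** Positivity of [peval] applied to e^2 - p^2, which is nonnegative on [a, b]. *)
Lemma peval_norm a b p T e : 0 <= e -> spec a b T ->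
  (forall t, t \in `[a, b] -> `|p.[t]| <= e) -> forall x, nrm (peval p T x) <= e * nrm x.
Proof.
move=> e0 sT pe x; have := @peval_ge0 _ _ a b ((e ^+ 2)%:P - p * p) T x sT.
have -> : qf (peval ((e ^+ 2)%:P - p * p) T) x = (e * nrm x) ^+ 2 - nrm (peval p T x) ^+ 2.
  rewrite pevalB pevalC pevalM qfB qfZ qf1 exprMn !sqr_nrm; congr (_ - _).
  by rewrite /qf mulE (sa_peval _ (spec_sa sT)).
move=> h; rewrite -ler_sqr ?nnegrE ?mulr_ge0 ?nrm_ge0 // -subr_ge0; apply: h.
move=> t tI; rewrite !hornerE subr_ge0 -expr2 -[_.[t] ^+ 2]real_normK ?num_real //.
by rewrite ler_sqr ?nnegrE ?pe.
Qed.

Lemma peval_near a b p q T e : 0 <= e -> spec a b T ->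
  near_on a b (horner p) (horner q) e -> near_op (peval p T) (peval q T) e.
Proof.
move=> e0 sT pq x; have -> : peval p T x - peval q T x = peval (p - q) T x by rewrite pevalB.
by apply: (peval_norm e0 sT) => t tI; rewrite hornerD hornerN pq.
Qed.

Lemma loewner_spec a b T :
  loewner (scalar_op a) T -> loewner T (scalar_op b) -> spec a b T.
Proof.
move=> aT Tb; have pa : positive (T - a *: (1 : bop H) : bop H) by exact: aT.
have pb : positive (b *: (1 : bop H) - T : bop H) by exact: Tb.
move: pa pb => /positiveP[sa0 h1] /positiveP[_ h2]; split.
  by rewrite -(subrK (a *: (1 : bop H)) T); apply: saD => //; exact/saZ/sa1.
move=> x; have := h1 x; have := h2 x; rewrite !qfB !qfZ !qf1 !subr_ge0.
by move=> -> ->.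
Qed.

Lemma spec_loewner a b T : spec a b T ->
  loewner (scalar_op a) T /\ loewner T (scalar_op b).
Proof.
move=> [sT Tab]; split.
  apply: (loewnerP (saZ a (@sa1 _ H)) sT).2 => x.
  by rewrite qfZ qf1; have /andP[] := Tab x.
apply: (loewnerP sT (saZ b (@sa1 _ H))).2 => x.
by rewrite qfZ qf1; have /andP[] := Tab x.
Qed.

Lemma spec_inter a b c d T : spec a b T -> spec c d T ->
  spec (Num.max a c) (Num.min b d) T.
Proof.
move=> [sT h] [_ h']; split=> // x.
have /andP[h1 h2] := h x; have /andP[h3 h4] := h' x.
by apply/andP; split; [case: (leP a c)|case: (leP b d)].
Qed.

Lemma near_on_subl a b c d f g e : near_on a b f g e ->
  near_on (Num.max a c) (Num.min b d) f g e.
Proof.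
move=> h t; rewrite in_itv /= ge_max le_min => /andP[/andP[h1 _] /andP[h2 _]].
by apply: h; rewrite in_itv /= h1.
Qed.

(** The working form of the definition: one polynomial per tolerance in place of a sequence. *)
Lemma is_fcalcP f T B : is_fcalc f T B <-> exists a b,
  [/\ spec a b T, {within `[a, b], continuous f} &
    forall e, 0 < e -> exists p, near_on a b (horner p) f e /\ near_op (peval p T) B e].
Proof.
split=> [[_ [a [b [h1 h2 cf [P [h3 h4]]]]]]|[a [b [sT cf h]]]].
  exists a, b; split => //; first exact: loewner_spec.
  move=> e e0; have [N _ hN] := h3 _ e0; have [N' _ hN'] := h4 _ e0.
  exists (P (maxn N N')); split; first by apply: hN => /=; exact: leq_maxl.
  move=> x; have := hN' (maxn N N') (leq_maxr _ _) x.
  by rewrite poly_opE !norm_nrm -rmorphM lecR.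
split; first exact: bfunP.
have [aT Tb] := spec_loewner sT.
exists a, b; split => //.
have kP (k : nat) : 0 < k.+1%:R^-1 :> R by rewrite invr_gt0.
exists (fun k => projT1 (cid (h _ (kP k)))); split=> e e0.
  near=> k => t tI; have [h1 _] := projT2 (cid (h _ (kP k))).
  apply: le_trans (h1 t tI) _; near: k.
  by apply: filterS (near_infty_natSinv_lt (PosNum e0)) => k /ltW.
near=> k => x; have [_ h1] := projT2 (cid (h _ (kP k))).
rewrite poly_opE !norm_nrm -rmorphM lecR.
apply: le_trans (h1 x) _; rewrite ler_wpM2r ?nrm_ge0 //; near: k.
by apply: filterS (near_infty_natSinv_lt (PosNum e0)) => k /ltW.
Unshelve. all: by end_near.
Qed.

Lemma near_on_subr a b c d f g e : near_on c d f g e ->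
  near_on (Num.max a c) (Num.min b d) f g e.
Proof.
move=> h t; rewrite in_itv /= ge_max le_min => /andP[/andP[_ h1] /andP[_ h2]].
by apply: h; rewrite in_itv /= h1.
Qed.

(** The intervals of two approximations may differ; the approximations are compared on the
    intersection, which still carries [T]. Hence the calculus does not depend on the interval. *)
Lemma fcalc_near a b f T p e c d B : spec a b T -> near_on a b (horner p) f e -> 0 <= e ->
  spec c d T ->
  (forall e, 0 < e -> exists p, near_on c d (horner p) f e /\ near_op (peval p T) B e) ->
  near_op (peval p T) B e.
Proof.
move=> sT pf e0 sT' h x; apply: le_nrm_eps => r r0.
have n0 : 0 < 2 * (nrm x + 1) by rewrite mulr_gt0 // ltr_wpDl ?nrm_ge0.
have s0 := divr_gt0 r0 n0; have [q [qf qB]] := h _ s0.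
have pq := peval_near (addr_ge0 e0 (ltW s0)) (spec_inter sT sT')
   (near_on_trans (near_on_subl (c := c) (d := d) pf)
     (near_onC (near_on_subr (a := a) (b := b) qf))).
apply: le_trans (near_op_trans pq qB x) _.
have rE : r / (2 * (nrm x + 1)) * (2 * (nrm x + 1)) = r by rewrite divfK ?gt_eqF.
move: rE s0; set s := r / _ => rE s0; lra.
Qed.

Lemma is_fcalc_uniq f T B B' : is_fcalc f T B -> is_fcalc f T B' -> B = B'.
Proof.
move=> /is_fcalcP[a [b [sT _ h]]] /is_fcalcP[c [d [sT' _ h']]].
apply: (@near_op_eq _ _ 2) => e e0; have [p [pf pB]] := h _ e0.
have pB' := fcalc_near sT pf (ltW e0) sT' h'.
rewrite mulr_natl mulr2n; exact: near_op_trans (near_opC pB) pB'.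
Qed.

Lemma is_fcalc_ex a b f T : spec a b T -> {within `[a, b], continuous f} ->
  exists B : bop H, is_fcalc f T B.
Proof.
move=> sT cf.
have kP (k : nat) : 0 < k.+1%:R^-1 :> R by rewrite invr_gt0.
pose P k := projT1 (cid (weierstrass cf (kP k))).
have PP k : near_on a b (horner (P k)) f k.+1%:R^-1 by exact: (projT2 (cid (weierstrass cf (kP k)))).
have PQ j k : near_op (peval (P j) T) (peval (P k) T) (j.+1%:R^-1 + k.+1%:R^-1).
  apply: (peval_near _ sT (near_on_trans (PP j) (near_onC (PP k)))).
  by rewrite addr_ge0 // ltW.
have hN e : 0 < e -> exists N, forall k, (N <= k)%N -> k.+1%:R^-1 <= e.
  move=> e0; have [N _ hN] := near_infty_natSinv_lt (PosNum e0).
  by exists N => k /hN /ltW.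
have [B BP] : exists B : bop H, forall e : R, 0 < e -> \forall k \near \oo,
     forall x, nrm (peval (P k) T x - B x) <= e * nrm x.
  apply: bop_cauchy => e e0; have [N NP] := hN (e / 2) (divr_gt0 e0 (ltr0Sn _ 1)).
  exists N => j k Nj Nk x; apply: le_trans (PQ j k x) _.
  by rewrite ler_wpM2r ?nrm_ge0 // [leRHS]splitr lerD // NP.
exists B; apply/is_fcalcP; exists a, b; split => // e e0.
have [N NP] := hN _ e0; have [M _ MP] := BP _ e0.
exists (P (maxn N M)); split; last by apply: MP => /=; exact: leq_maxr.
by move=> t tI; apply: le_trans (PP _ t tI) _; apply: NP; exact: leq_maxl.
Qed.

Definition bfc f T : bop H := xget 0 [set B : bop H | is_fcalc f T B].

Lemma bfcP a b f T : spec a b T -> {within `[a, b], continuous f} ->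
  is_fcalc f T (bfc f T).
Proof.
move=> sT cf; have [B BP] := is_fcalc_ex sT cf.
by have := @xgetPex _ 0 [set B : bop H | is_fcalc f T B] (ex_intro _ B BP).
Qed.

Lemma fcalcE a b f T : spec a b T -> {within `[a, b], continuous f} ->
  fcalc f T = bfc f T.
Proof.
move=> sT cf; have h := bfcP sT cf; rewrite /fcalc.
have : is_fcalc f T (fcalc f T) by have := @xgetPex _ 0 [set B : H -> H | is_fcalc f T B] (ex_intro _ _ h).
rewrite /fcalc; set B := xget _ _ => hB.
have := @is_fcalc_uniq f T (Bop hB.1) (bfc f T) hB h.
by move=> <-.
Qed.

Lemma bfc_near a b f T p e : spec a b T -> {within `[a, b], continuous f} -> 0 <= e ->
  near_on a b (horner p) f e -> near_op (peval p T) (bfc f T) e.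
Proof.
move=> sT cf e0 pf; have /is_fcalcP[c [d [sT' _ h]]] := bfcP sT cf.
exact: fcalc_near sT pf e0 sT' h.
Qed.

(** The free factor k saves tuning tolerances, and e <= 1 bounds the approximating polynomials
    uniformly, as products require. *)
Lemma bfc_eq a b f T B (k : R) : spec a b T -> {within `[a, b], continuous f} -> 0 <= k ->
  (forall e, 0 < e -> e <= 1 ->
    exists p, near_on a b (horner p) f (k * e) /\ near_op (peval p T) B (k * e)) ->
  bfc f T = B.
Proof.
move=> sT cf k0 h; apply: (@is_fcalc_uniq f T); first exact: bfcP sT cf.
apply/is_fcalcP; exists a, b; split => // e e0.
have k1 : 0 < k + 1 by rewrite ltr_wpDl.
have [||p [pf pB]] := h (Num.min 1 (e / (k + 1))).
- by rewrite lt_min ltr01 divr_gt0.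
- by rewrite ge_min lexx.
have le : k * Num.min 1 (e / (k + 1)) <= e.
  apply: (@le_trans _ _ (k * (e / (k + 1)))).
    by rewrite ler_wpM2l // ge_min lexx orbT.
  by rewrite mulrA ler_pdivrMr // mulrC ler_pM2l // lerDl.
exists p; split=> [t tI|x]; first exact: le_trans (pf _ tI) le.
by apply: le_trans (pB x) _; rewrite ler_wpM2r ?nrm_ge0.
Qed.

End FunctionalCalculus.

(** * Continuity on a segment and the algebra of the calculus *)

Section Continuity.
Context {R : realType}.
Implicit Types (f g : R -> R) (a b c d : R).

Definition cont a b f := {within `[a, b], continuous f}.

Lemma cont_pt a b f : (forall t, t \in `[a, b] -> {for t, continuous f}) -> cont a b f.
Proof. by move=> h; apply: continuous_in_subspaceT => t; rewrite inE /= => tI; apply: h. Qed.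

Lemma cont_cst a b c : cont a b (fun=> c).
Proof. by apply: cont_pt => t _; exact: cst_continuous. Qed.
Lemma cont_id a b : cont a b id.
Proof. by apply: cont_pt => t _; exact: cvg_id. Qed.
Lemma contD a b f g : cont a b f -> cont a b g -> cont a b (fun t => f t + g t).
Proof.
move=> /subspace_continuousP cf /subspace_continuousP cg.
by apply/subspace_continuousP => x xI; apply: cvgD; [exact: cf|exact: cg].
Qed.
Lemma contM a b f g : cont a b f -> cont a b g -> cont a b (fun t => f t * g t).
Proof.
move=> /subspace_continuousP cf /subspace_continuousP cg.
by apply/subspace_continuousP => x xI; apply: cvgM; [exact: cf|exact: cg].
Qed.
Lemma contZ a b c f : cont a b f -> cont a b (fun t => c * f t).
Proof. by move=> cf; apply: contM => //; exact: cont_cst. Qed.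
Lemma contV a b f : (forall t, t \in `[a, b] -> f t != 0) ->
  cont a b f -> cont a b (fun t => (f t)^-1).
Proof.
move=> f0 /subspace_continuousP cf.
by apply/subspace_continuousP => x xI; apply: cvgV; [exact: f0|exact: cf].
Qed.

Lemma cont_horner a b (q : {poly R}) f : cont a b f -> cont a b (fun t => q.[f t]).
Proof.
move=> cf; elim/poly_ind: q => [|r c IH].
  have -> : (fun t => (0 : {poly R}).[f t]) = (fun=> 0).
    by apply/funext => t; rewrite horner0.
  exact: cont_cst.
have -> : (fun t => (r * 'X + c%:P).[f t]) = (fun t => r.[f t] * f t + c).
  by apply/funext => t; rewrite !hornerE.
by apply: contD; [apply: contM|exact: cont_cst].
Qed.

Lemma cont_bounded a b f : cont a b f ->
  exists2 M, 0 <= M & forall t, t \in `[a, b] -> `|f t| <= M.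
Proof.
move=> cf; have [p pP] := weierstrass cf ltr01.
have [ab|ab] := leP a b; last first.
  by exists 0 => // t; rewrite in_itv /= => /andP[h1 h2]; have := le_trans h1 h2; rewrite leNgt ab.
have [u uI uP] := EVT_max ab cf; have [v vI vP] := EVT_min ab cf.
exists (`|f u| + `|f v|); first by rewrite addr_ge0.
move=> t tI; have := uP _ tI; have := vP _ tI.
have := ler_norm (f u); have := ler_norm (- f v); rewrite normrN.
have := normr_ge0 (f u); have := normr_ge0 (f v).
by rewrite ler_norml => ? ? ? ? ? ?; apply/andP; split; lra.
Qed.

End Continuity.

Section Calculus.
Context {R : realType} {H : hilbert R}.
Implicit Types (p q : {poly R}) (T S B : bop H) (a b c d e : R) (f g : R -> R) (x : H).

Lemma near_op_ip S B e x y : near_op S B e -> `|ip (S x) y - ip (B x) y| <= e * (nrm x * nrm y).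
Proof.
by move=> h; rewrite -ipBl (le_trans (ip_nrm _ _)) // mulrA ler_wpM2r ?nrm_ge0.
Qed.

Lemma near_op_qf S B e x : near_op S B e -> `|qf S x - qf B x| <= e * ip x x.
Proof. by move=> h; rewrite -sqr_nrm expr2; exact: near_op_ip. Qed.

Lemma sa_lim B : (forall e, 0 < e -> exists2 S : bop H, sa S & near_op S B e) -> sa B.
Proof.
move=> h x y; apply/eqP; rewrite -subr_eq0 -normr_eq0 eq_le normr_ge0 andbT.
apply/ler_addgt0Pr => e e0; rewrite add0r.
have k0 : 0 < 2 * (nrm x * nrm y) + 1 by rewrite ltr_wpDl // !mulr_ge0 ?nrm_ge0.
have [S sS SB] := h _ (divr_gt0 e0 k0); set r := e / _ in SB.
have h1 := near_op_ip x y SB; have h2 := near_op_ip y x SB.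
rewrite [nrm y * _]mulrC in h2.
have -> : ip (B x) y - ip x (B y) = (ip (S y) x - ip (B y) x) * -1 * -1 - (ip (S x) y - ip (B x) y).
  by rewrite [ip (S y) x]ipC -sS [ip (B y) x]ipC; ring.
have er : r * (2 * (nrm x * nrm y) + 1) = e by rewrite divfK ?gt_eqF.
have r0 : 0 < r by rewrite divr_gt0.
rewrite mulrN1 mulrN1 opprK; apply: le_trans (ler_normB _ _) _.
move: h1 h2; set u := `|_|; set v := `|_|; set n := nrm x * nrm y in er *; lra.
Qed.

Lemma ge0_lim B x : (forall e, 0 < e -> exists2 S : bop H, - e * ip x x <= qf S x & near_op S B e) ->
  0 <= qf B x.
Proof.
move=> h; apply/ler_addgt0Pr => e e0.
have k0 : 0 < 2 * ip x x + 1 by rewrite ltr_wpDl // mulr_ge0 ?ip_ge0.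
have [S sS SB] := h _ (divr_gt0 e0 k0); set r := e / _ in sS SB.
have := near_op_qf x SB; rewrite ler_norml => /andP[h1 h2].
have er : r * (2 * ip x x + 1) = e by rewrite divfK ?gt_eqF.
have r0 : 0 < r by rewrite divr_gt0.
lra.
Qed.

Variables (a b : R) (T : bop H).
Hypothesis sT : spec a b T.

Lemma bfc_sa f : cont a b f -> sa (bfc f T).
Proof.
move=> cf; apply: sa_lim => e e0; have [p pf] := weierstrass cf e0.
exists (peval p T); first exact/sa_peval/(spec_sa sT).
exact: (bfc_near sT cf (ltW e0) pf).
Qed.

Lemma bfc_ge0 f x : cont a b f -> (forall t, t \in `[a, b] -> 0 <= f t) ->
  0 <= qf (bfc f T) x.
Proof.
move=> cf f0; apply: ge0_lim => e e0; have [p pf] := weierstrass cf e0.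
exists (peval p T); last exact: (bfc_near sT cf (ltW e0) pf).
(* The approximation p may dip below 0, but by at most e. *)
have := @peval_ge0 _ _ a b (p + e%:P) T x sT; rewrite pevalD pevalC qfD qfZ qf1 => h.
have {h} : 0 <= qf (peval p T) x + e * ip x x.
  apply: h => t tI; rewrite !hornerE; have := pf _ tI; have := f0 _ tI.
  by rewrite ler_norml => h1 /andP[h2 h3]; lra.
lra.
Qed.

Lemma bfc_cst c : bfc (fun=> c) T = c *: (1 : bop H).
Proof.
apply: (bfc_eq (k := 0) sT (@cont_cst _ a b c)) => // e e0 _; exists c%:P.
split=> [t _|x]; first by rewrite hornerC subrr normr0 mul0r.
by rewrite pevalC subrr nrm0 !mul0r.
Qed.

Lemma bfc_id : bfc id T = T.
Proof.
apply: (bfc_eq (k := 0) sT (@cont_id _ a b)) => // e e0 _; exists 'X.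
split=> [t _|x]; first by rewrite hornerX subrr normr0 mul0r.
by rewrite pevalX subrr nrm0 !mul0r.
Qed.

Lemma bfcD f g : cont a b f -> cont a b g ->
  bfc (fun t => f t + g t) T = bfc f T + bfc g T.
Proof.
move=> cf cg; apply: (bfc_eq (k := 2) sT (contD cf cg)) => // e e0 _.
have [p pf] := weierstrass cf e0; have [q qg] := weierstrass cg e0.
exists (p + q); split=> [t tI|x].
  rewrite hornerD opprD addrACA (le_trans (ler_normD _ _)) //.
  by rewrite mulr_natl mulr2n lerD ?pf ?qg.
rewrite pevalD !addE opprD addrACA (le_trans (nrmD _ _)) //.
rewrite mulr_natl mulr2n mulrDl lerD //.
  exact: (bfc_near sT cf (ltW e0) pf).
exact: (bfc_near sT cg (ltW e0) qg).
Qed.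

Lemma bfcZ c f : cont a b f -> bfc (fun t => c * f t) T = c *: bfc f T.
Proof.
move=> cf; apply: (bfc_eq (k := `|c|) sT (contZ cf)) => // e e0 _.
have [p pf] := weierstrass cf e0.
exists (c *: p); split=> [t tI|x].
  by rewrite hornerZ -mulrBr normrM ler_wpM2l ?pf.
rewrite pevalZ !scaleE -scalerBr nrmZ -mulrA ler_wpM2l //.
exact: (bfc_near sT cf (ltW e0) pf).
Qed.

Lemma bfcM f g : cont a b f -> cont a b g ->
  bfc (fun t => f t * g t) T = bfc f T * bfc g T.
Proof.
move=> cf cg.
have [Mf Mf0 fP] := cont_bounded cf; have [Mg Mg0 gP] := cont_bounded cg.
have [c c0 cP] := bop_nrm_bound (bfc f T).
have k0 : 0 <= Mf + Mg + 1 + c by rewrite !addr_ge0.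
apply: (bfc_eq sT (contM cf cg) k0) => // e e0 e1.
have [p pf] := weierstrass cf e0; have [q qg] := weierstrass cg e0.
have qM t : t \in `[a, b] -> `|q.[t]| <= Mg + 1.
  move=> tI; rewrite -(subrK (g t) q.[t]) (le_trans (ler_normD _ _)) //.
  by rewrite addrC lerD ?gP // (le_trans (qg _ tI)).
exists (p * q); split=> [t tI|x].
  have -> : (p * q).[t] - f t * g t = (p.[t] - f t) * q.[t] + f t * (q.[t] - g t).
    by rewrite hornerM; ring.
  rewrite (le_trans (ler_normD _ _)) // !normrM.
  apply: (@le_trans _ _ (e * (Mg + 1) + Mf * e)).
    by rewrite lerD // ler_pM // ?pf ?qM ?fP ?qg.
  have := mulr_ge0 c0 (ltW e0); lra.
have -> : peval (p * q) T x - (bfc f T * bfc g T) x =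
   (peval p T (peval q T x) - bfc f T (peval q T x)) + bfc f T (peval q T x - bfc g T x).
  by rewrite pevalM !mulE bopB addrA subrK.
rewrite (le_trans (nrmD _ _)) //.
apply: (@le_trans _ _ (e * ((Mg + 1) * nrm x) + c * (e * nrm x))).
  apply: lerD.
    apply: le_trans (bfc_near sT cf (ltW e0) pf _) _.
    rewrite ler_wpM2l ?(ltW e0) //.
    by apply: (peval_norm _ sT qM); rewrite addr_ge0.
  apply: le_trans (cP _) _; rewrite ler_wpM2l //.
  exact: (bfc_near sT cg (ltW e0) qg).
have : 0 <= Mf * (e * nrm x) by rewrite !mulr_ge0 ?nrm_ge0 // ltW.
lra.
Qed.

Lemma eq_bfc f g : cont a b g -> (forall t, t \in `[a, b] -> f t = g t) -> bfc f T = bfc g T.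
Proof.
move=> cg fg; have cf : cont a b f.
  move/subspace_continuousP: cg => cg; apply/subspace_continuousP => x xI.
  apply/cvgrPdist_le => e e0; have /cvgrPdist_le/(_ _ e0) := cg x xI.
  rewrite !near_withinE; apply: filterS => t h tI.
  by rewrite /from_subspace (fg t tI) (fg x xI); exact: h tI.
apply: (bfc_eq (k := 1) sT cf) => // e e0 _; have [p pg] := weierstrass cg e0.
exists p; rewrite mul1r; split=> [t tI|]; first by rewrite fg // pg.
exact: (bfc_near sT cg (ltW e0) pg).
Qed.

Lemma bfc_le f g : cont a b f -> cont a b g -> (forall t, t \in `[a, b] -> f t <= g t) ->
  ble (bfc f T) (bfc g T).
Proof.
move=> cf cg fg x; have cNf : cont a b (fun t => -1 * f t) by exact: contZ.
have := bfc_ge0 x (contD cg cNf); rewrite bfcD // bfcZ // qfD qfZ mulN1r subr_ge0; apply.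
by move=> t tI; rewrite mulN1r subr_ge0 fg.
Qed.

Lemma bfc_norm f e : cont a b f -> 0 <= e -> (forall t, t \in `[a, b] -> `|f t| <= e) ->
  forall x, nrm (bfc f T x) <= e * nrm x.
Proof.
move=> cf e0 fe x.
have h : near_op (peval 0 T) (bfc f T) e.
  by apply: (bfc_near sT cf e0) => t tI; rewrite horner0 sub0r normrN fe.
by have := h x; rewrite -[0]/0%:P pevalC scale0r zeroE sub0r nrmN.
Qed.

Lemma bfc_spec f c d : cont a b f -> (forall t, t \in `[a, b] -> f t \in `[c, d]) ->
  spec c d (bfc f T).
Proof.
move=> cf fI; split=> [|x]; first exact: bfc_sa.
have := bfc_le cf (@cont_cst _ a b d) _ x; have := bfc_le (@cont_cst _ a b c) cf _ x.
rewrite !bfc_cst !qfZ !qf1 => -> => [->//|]; move=> t /fI; by rewrite in_itv => /andP[].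
Qed.

Lemma peval_bfc q f : cont a b f -> peval q (bfc f T) = bfc (fun t => q.[f t]) T.
Proof.
move=> cf.
elim/poly_ind: q => [|q c IH].
  under eq_fun do rewrite horner0.
  by rewrite -[0]/0%:P pevalC bfc_cst.
rewrite pevalD pevalMX pevalC IH.
have -> : (fun t => (q * 'X + c%:P).[f t]) = (fun t => q.[f t] * f t + c).
  by apply/funext => t; rewrite !hornerE.
rewrite (bfcD (contM (cont_horner (q := q) cf) cf) (@cont_cst _ a b c)) bfc_cst bfcM //.
exact: cont_horner.
Qed.

Lemma bfc_comp c d f g : cont a b f -> (forall t, t \in `[a, b] -> f t \in `[c, d]) ->
  cont c d g -> cont a b (g \o f) -> bfc g (bfc f T) = bfc (g \o f) T.
Proof.
move=> cf fI cg cgf; have sf := bfc_spec cf fI.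
apply: (bfc_eq (k := 1) sf cg) => // e e0 _; rewrite mul1r.
have [q qg] := weierstrass cg e0; exists q; split=> //.
rewrite peval_bfc //.
have cq := cont_horner (q := q) cf.
move=> x; have cN : cont a b (fun t => -1 * (g \o f) t) by exact: contZ.
have -> : bfc (fun t => q.[f t]) T x - bfc (g \o f) T x =
  bfc (fun t => q.[f t] + -1 * (g \o f) t) T x.
  by rewrite bfcD // bfcZ // addE scaleN1r.
apply: bfc_norm; [exact: contD|exact: ltW|] => t tI.
by rewrite mulN1r qg // fI.
Qed.

(** Polynomials act on an eigenvector through the eigenvalue, and so do their limits. This reads
    scalar values of f off operators. *)
Lemma bfc_eigen f t x : cont a b f -> t \in `[a, b] -> T x = t%:C *: x ->
  bfc f T x = (f t)%:C *: x.
Proof.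
move=> cf tI Tx.
have px p : peval p T x = (p.[t])%:C *: x.
  elim/poly_ind: p => [|p c IH].
    by rewrite -[0]/0%:P pevalC hornerC scale0r scale0r.
  rewrite pevalD pevalMX pevalC addE mulE scaleE Tx bopZ IH !hornerE.
  by rewrite rmorphD rmorphM scalerDl scalerA [in RHS]mulrC.
apply/eqP; rewrite -subr_eq0 -nrm_eq0 eq_le nrm_ge0 andbT.
apply: le_nrm_eps => e e0; rewrite add0r.
have k0 : 0 < 2 * nrm x + 1 by rewrite ltr_wpDl // mulr_ge0 ?nrm_ge0.
have r0 := divr_gt0 e0 k0; have [p pf] := weierstrass cf r0.
apply: le_trans (nrm_dist (peval p T x) _ _) _.
have h1 := bfc_near sT cf (ltW r0) pf x.
rewrite nrmB {2}px -scalerBl -rmorphB nrmZ.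
have h2 := pf _ tI.
have er : e / (2 * nrm x + 1) * (2 * nrm x + 1) = e by rewrite divfK ?gt_eqF.
have := ler_wpM2r (nrm_ge0 x) h2.
move: h1 er r0; set r := e / _ => *; lra.
Qed.

End Calculus.

(** * Operator monotonicity of powers and of the logarithm *)

Section PowExp.
Context {R : realType}.
Implicit Types (s t u v L : R).

Lemma powRE t s : 0 < t -> t `^ s = expR (s * ln t).
Proof. by move=> t0; rewrite /powR gt_eqF. Qed.

Lemma cont_pow t s : 0 < t -> {for t, continuous (fun t => t `^ s)}.
Proof.
move=> t0; apply: differentiable_continuous; apply/derivable1_diffP.
by apply: derivable_powR; rewrite in_itv /= t0.
Qed.

Lemma expR_lip u v L : u <= L -> v <= L -> `|expR u - expR v| <= `|u - v| * expR L.
Proof.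
wlog uv : u v / v <= u => [h uL vL|uL vL].
  have [/h|/ltW/h] := leP v u; first exact.
  by rewrite distrC [`|u - v|]distrC; exact.
rewrite ger0_norm ?subr_ge0 ?ler_expR // ger0_norm ?subr_ge0 //.
have -> : expR u - expR v = (1 - expR (v - u)) * expR u.
  by rewrite mulrBl mul1r -expRD subrK.
apply: ler_pM; rewrite ?expR_ge0 ?ler_expR //.
  by rewrite subr_ge0 -expR0 ler_expR subr_le0.
by have := expR_ge1Dx (v - u); lra.
Qed.

Lemma ln_bound a b : 0 < a -> exists2 L : R, 0 <= L &
  forall t, t \in `[a, b] -> `|ln t| <= L.
Proof.
move=> a0; exists (`|ln a| + `|ln b|) => [|t]; first by rewrite addr_ge0.
rewrite in_itv /= => /andP[at_ tb]; have t0 := lt_le_trans a0 at_; have b0 := lt_le_trans t0 tb.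
have h1 : ln a <= ln t by rewrite ler_ln.
have h2 : ln t <= ln b by rewrite ler_ln.
have := ler_norm (ln b); have := ler_norm (- ln a); rewrite normrN.
have := normr_ge0 (ln a); have := normr_ge0 (ln b).
by rewrite ler_norml => ? ? ? ?; apply/andP; split; lra.
Qed.

End PowExp.

Section OperatorMonotone.
Context {R : realType} {H : hilbert R}.
Implicit Types (S T : bop H) (a b c e r s t : R) (f g : R -> R) (x : H).

Lemma spec_wide a b c d T : c <= a -> b <= d -> spec a b T -> spec c d T.
Proof.
move=> ca bd [sT h]; split=> // x; have /andP[h1 h2] := h x.
apply/andP; split.
  by apply: le_trans h1; rewrite ler_wpM2r ?ip_ge0.
by apply: le_trans h2 _; rewrite ler_wpM2r ?ip_ge0.
Qed.

(** Cauchy-Schwarz for the form of [S] at S' x and T' x bounds <T' x, x>^2 by <S' x, x> <S T' x, T'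
    x>, and the last factor is at most <T T' x, T' x> = <T' x, x>, which cancels. *)
Lemma ble_inv S T S' T' : sa S -> (forall x, 0 <= qf S x) ->
  S * S' = 1 -> T * T' = 1 -> ble S T -> ble T' S'.
Proof.
move=> sS S0 SS TT ST x.
have SK y : S (S' y) = y by rewrite -mulE SS.
have TK y : T (T' y) = y by rewrite -mulE TT.
have sE : qf S (S' x) = qf S' x by rewrite /qf SK ipC.
have tE : qf T (T' x) = qf T' x by rewrite /qf TK ipC.
have := psd_CS (S' x) (T' x) sS S0.
rewrite SK sE ipC -/(qf T' x) => h.
have h2 := ST (T' x); rewrite tE in h2.
have s0 : 0 <= qf S' x by rewrite -sE.
have := le_trans (S0 (T' x)) h2; rewrite le_eqVlt => /orP[/eqP <- //|t0].
rewrite -(ler_pM2r t0) -expr2; apply: le_trans h _.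
by rewrite ler_wpM2l.
Qed.

Lemma bfc_inv a b T f : spec a b T -> cont a b f -> (forall t, t \in `[a, b] -> f t != 0) ->
  bfc f T * bfc (fun t => (f t)^-1) T = 1 /\ bfc (fun t => (f t)^-1) T * bfc f T = 1.
Proof.
move=> sT cf f0; have cV := contV f0 cf.
rewrite -(bfcM sT cf cV) -(bfcM sT cV cf) -[1]scale1r -(bfc_cst sT).
by split; apply: (eq_bfc sT (@cont_cst _ a b 1)) => t /f0 ?; rewrite ?mulfV ?mulVf.
Qed.

Definition opmon f := forall a b S T, 0 < a -> spec a b S -> spec a b T -> ble S T ->
  ble (bfc f S) (bfc f T).

Definition pos_cont f := forall t, 0 < t -> 0 < f t /\ {for t, continuous f}.

Lemma itv_gt0 a b t : 0 < a -> t \in `[a, b] -> 0 < t.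
Proof. by move=> a0; rewrite in_itv /= => /andP[/(lt_le_trans a0)]. Qed.

Lemma pos_cont_cont a b f : 0 < a -> pos_cont f -> cont a b f.
Proof. by move=> a0 pf; apply: cont_pt => t tI; have [] := pf t (itv_gt0 a0 tI). Qed.

Lemma pos_cont_neq0 a b f : 0 < a -> pos_cont f -> forall t, t \in `[a, b] -> f t != 0.
Proof. by move=> a0 pf t tI; have [h _] := pf t (itv_gt0 a0 tI); rewrite gt_eqF. Qed.

Lemma bfc_inv_anti a b S T f : 0 < a -> spec a b S -> spec a b T -> pos_cont f ->
  ble (bfc f S) (bfc f T) ->
  ble (bfc (fun t => (f t)^-1) T) (bfc (fun t => (f t)^-1) S).
Proof.
move=> a0 sS sT pf fST.
have cf := pos_cont_cont (b := b) a0 pf; have f0 := pos_cont_neq0 (b := b) a0 pf.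
apply: (ble_inv (bfc_sa sS cf) _ (bfc_inv sS cf f0).1 (bfc_inv sT cf f0).1 fST).
by move=> x; apply: (bfc_ge0 sS) => // t tI; have [/ltW] := pf t (itv_gt0 a0 tI).
Qed.

Lemma opmon_mean f g : pos_cont f -> pos_cont g -> opmon f -> opmon g ->
  opmon (fun t => 2^-1 * (f t + g t)).
Proof.
move=> pf pg mf mg a b S T a0 sS sT ST x.
have cf := pos_cont_cont (b := b) a0 pf; have cg := pos_cont_cont (b := b) a0 pg.
rewrite (bfcZ sS _ (contD cf cg)) (bfcZ sT _ (contD cf cg)).
rewrite (bfcD sS cf cg) (bfcD sT cf cg) !qfZ !qfD ler_pM2l ?invr_gt0 //.
by rewrite lerD ?(mf a b) ?(mg a b).
Qed.

Lemma pos_cont_mean f g : pos_cont f -> pos_cont g -> pos_cont (fun t => 2^-1 * (f t + g t)).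
Proof.
move=> pf pg t t0; have [f0 cf] := pf t t0; have [g0 cg] := pg t t0.
split; first by rewrite mulr_gt0 ?invr_gt0 ?addr_gt0.
by apply: cvgM; [exact: cvg_cst|apply: cvgD].
Qed.

Lemma pos_cont_inv f : pos_cont f -> pos_cont (fun t => (f t)^-1).
Proof.
move=> pf t t0; have [f0 cf] := pf t t0; split; first by rewrite invr_gt0.
by apply: cvgV => //; rewrite gt_eqF.
Qed.

Definition hmean f g t := (2^-1 * ((f t)^-1 + (g t)^-1))^-1 : R.

Lemma pos_cont_hmean f g : pos_cont f -> pos_cont g -> pos_cont (hmean f g).
Proof.
by move=> pf pg; apply: pos_cont_inv; apply: pos_cont_mean; exact: pos_cont_inv.
Qed.

Lemma opmon_hmean f g : pos_cont f -> pos_cont g -> opmon f -> opmon g -> opmon (hmean f g).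
Proof.
move=> pf pg mf mg a b S T a0 sS sT ST.
apply: (bfc_inv_anti a0 sT sS (pos_cont_mean (pos_cont_inv pf) (pos_cont_inv pg))) => x.
have cf := pos_cont_cont (b := b) a0 (pos_cont_inv pf).
have cg := pos_cont_cont (b := b) a0 (pos_cont_inv pg).
rewrite (bfcZ sS _ (contD cf cg)) (bfcZ sT _ (contD cf cg)).
rewrite (bfcD sS cf cg) (bfcD sT cf cg) !qfZ !qfD ler_pM2l ?invr_gt0 //.
apply: lerD.
  exact: (bfc_inv_anti a0 sS sT pf (mf a b S T a0 sS sT ST)).
exact: (bfc_inv_anti a0 sS sT pg (mg a b S T a0 sS sT ST)).
Qed.

(** The approximating function may depend on the interval, because [opmon] compares operators on one
    interval at a time. *)
Lemma opmon_lim f : (forall t, 0 < t -> {for t, continuous f}) ->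
  (forall a b e, 0 < a -> 0 < e -> exists g, [/\ forall t, 0 < t -> {for t, continuous g},
     opmon g & forall t, t \in `[a, b] -> `|g t - f t| <= e]) -> opmon f.
Proof.
move=> pf h a b S T a0 sS sT ST x; apply/ler_addgt0Pr => e e0.
have k0 : 0 < 2 * ip x x + 1 by rewrite ltr_wpDl // mulr_ge0 ?ip_ge0.
have [g [pg mg gf]] := h a b _ a0 (divr_gt0 e0 k0).
have cf : cont a b f by apply: cont_pt => t tI; apply: pf (itv_gt0 a0 tI).
have cg : cont a b g by apply: cont_pt => t tI; apply: pg (itv_gt0 a0 tI).
set d := e / _ in gf.
have ed : d * (2 * ip x x + 1) = e by rewrite divfK ?gt_eqF.
have d0 : 0 < d by rewrite divr_gt0.
have cd := @cont_cst _ a b d.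
have h1 := bfc_le sS cf (contD cg cd) _ x.
have h2 := bfc_le sT cg (contD cf cd) _ x.
rewrite (bfcD sS cg cd) (bfc_cst sS) qfD qfZ qf1 in h1.
rewrite (bfcD sT cf cd) (bfc_cst sT) qfD qfZ qf1 in h2.
have := mg a b S T a0 sS sT ST x.
have {}h1 : qf (bfc f S) x <= qf (bfc g S) x + d * ip x x.
  by apply: h1 => t /gf; rewrite ler_norml => /andP[? ?]; lra.
have {}h2 : qf (bfc g T) x <= qf (bfc f T) x + d * ip x x.
  by apply: h2 => t /gf; rewrite ler_norml => /andP[? ?]; lra.
lra.
Qed.

(* The arithmetic-harmonic iteration preserves the product and converges to the
   geometric mean of its two starting functions. *)
Fixpoint ah_iter f g n : (R -> R) * (R -> R) :=
  if n is n'.+1 then let: (u, v) := ah_iter f g n' in (fun t => 2^-1 * (u t + v t), hmean u v)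
  else (f, g).

Lemma ah_iter_opmon f g n : pos_cont f -> pos_cont g -> opmon f -> opmon g ->
  [/\ pos_cont (ah_iter f g n).1, pos_cont (ah_iter f g n).2, opmon (ah_iter f g n).1 & opmon (ah_iter f g n).2].
Proof.
move=> pf pg mf mg; elim: n => [|n] //=; case: (ah_iter f g n) => u v /= [pu pv mu mv].
split; [exact: pos_cont_mean|exact: pos_cont_hmean|exact: opmon_mean|exact: opmon_hmean].
Qed.

Lemma ah_iter_prod f g n t : pos_cont f -> pos_cont g -> 0 < t ->
  [/\ 0 < (ah_iter f g n).1 t, 0 < (ah_iter f g n).2 t, (ah_iter f g n).1 t * (ah_iter f g n).2 t = f t * g t &
   `|(ah_iter f g n).1 t - (ah_iter f g n).2 t| <= `|f t - g t| / 2 ^+ n].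
Proof.
move=> pf pg t0; elim: n => [|n] /=.
  by have [? _] := pf t t0; have [? _] := pg t t0; split => //; rewrite expr0 divr1.
case: (ah_iter f g n) => u v /= [u0 v0 uv h]; rewrite /hmean.
have uv0 : 0 < u t + v t by rewrite addr_gt0.
have iv0 : 0 < 2^-1 * ((u t)^-1 + (v t)^-1) by rewrite mulr_gt0 ?invr_gt0 ?addr_gt0 ?invr_gt0.
have hE : (2^-1 * ((u t)^-1 + (v t)^-1))^-1 = 2 * u t * v t / (u t + v t).
  by field; rewrite !gt_eqF //= addr_gt0.
split.
- by rewrite mulr_gt0 ?invr_gt0.
- by rewrite invr_gt0.
- by rewrite hE -uv; field; rewrite gt_eqF.
rewrite hE.
(* The new gap is (u - v)^2 / (2 (u + v)), at most half the old one since |u - v| <= u + v. *)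
have -> : 2^-1 * (u t + v t) - 2 * u t * v t / (u t + v t) =
  (u t - v t) * ((u t - v t) / (u t + v t) / 2) by field; rewrite gt_eqF.
rewrite normrM exprS invfM mulrCA mulrC; apply: ler_pM => //.
rewrite normrM [`|2^-1|]gtr0_norm ?invr_gt0 // ler_piMl ?invr_ge0 //.
rewrite normrM [`|(u t + v t)^-1|]gtr0_norm ?invr_gt0 // ler_pdivrMr // mul1r.
by rewrite ler_norml; apply/andP; split; lra.
Qed.

Lemma pos_cont_pow s : pos_cont (fun t => t `^ s).
Proof. by move=> t t0; split; [exact: powR_gt0|exact: cont_pow]. Qed.

Lemma half_expn_small (K e : R) : 0 <= K -> 0 < e -> exists n, K / 2 ^+ n <= e.
Proof.
move=> K0 e0; exists (Num.trunc (K / e)).+1.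
rewrite ler_pdivrMr ?exprn_gt0 // mulrC -ler_pdivrMr //.
apply: le_trans (ltW (truncnS_gt _)) _.
by rewrite -natrX ler_nat ltnW // ltn_expl.
Qed.

(** The power with the midpoint exponent is the geometric mean of the two powers, hence a uniform
    limit of their arithmetic-harmonic iterates. *)
Lemma opmon_pow_mid r s : opmon (fun t => t `^ r) -> opmon (fun t => t `^ s) ->
  opmon (fun t => t `^ ((r + s) / 2)).
Proof.
move=> mr ms; apply: opmon_lim => [t t0|a b e a0 e0]; first exact: cont_pow.
have pr := pos_cont_pow r; have ps := pos_cont_pow s.
have cr := pos_cont_cont (b := b) a0 pr; have cs := pos_cont_cont (b := b) a0 ps.
have [M M0 Mr] := cont_bounded cr; have [N N0 Ns] := cont_bounded cs.
have [n hn] := half_expn_small (addr_ge0 M0 N0) e0.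
have [p1 p2 m1 m2] := ah_iter_opmon n pr ps mr ms.
exists (ah_iter (fun t => t `^ r) (fun t => t `^ s) n).1; split=> // [t t0|t tI].
  by have [] := p1 t t0.
have t0 := itv_gt0 a0 tI.
have [] := ah_iter_prod n pr ps t0.
set u := _.1 t; set v := _.2 t => u0 v0 uv h.
have {}h : `|u - v| <= e.
  apply: le_trans h _; apply: le_trans hn; rewrite ler_pM2r ?invr_gt0 ?exprn_gt0 //.
  by rewrite (le_trans (ler_normB _ _)) // lerD ?Mr ?Ns.
set w := t `^ _; have w0 : 0 < w by exact: powR_gt0.
have wE : w * w = u * v.
  have c0 z : (z == 0) ==> (t != 0) by rewrite (gt_eqF t0) implybT.
  by rewrite uv /w /= -!powRD ?c0 //; congr (_ `^ _); field.
clearbody u v w; move: h; rewrite !ler_norml => /andP[h1 h2].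
(* As w^2 = u v, w lies between u and v, hence within e of u. *)
have [uw|uw] := leP u w.
  have : w <= v by rewrite -(ler_pM2l u0) -wE ler_pM2r.
  by move=> ?; apply/andP; split; lra.
have : v <= w by rewrite -(ler_pM2l u0) -wE ler_pM2r // ltW.
by move=> ?; apply/andP; split; lra.
Qed.

(** The Loewner-Heinz inequality by bisection: the exponents 0 and 1 are clear, midpoints are
    admissible, and the dyadic lower ends l tend to r. *)
Lemma opmon_pow r : 0 <= r -> r <= 1 -> opmon (fun t => t `^ r).
Proof.
move=> r0 r1.
have bis n : exists l, [/\ opmon (fun t => t `^ l), opmon (fun t => t `^ (l + 2 ^- n)),
    0 <= l <= 1 & l <= r <= l + 2 ^- n].
  elim: n => [|n [l [ml mh /andP[l0 l1] /andP[lr rh]]]].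
    exists 0; rewrite expr0 invr1 add0r lexx ler01 r0 r1; split=> // a b S T a0 sS sT ST.
      have -> : (fun t => t `^ 0) = (fun=> 1) :> (R -> R) by apply/funext => t; rewrite powRr0.
      by rewrite (bfc_cst sS) (bfc_cst sT).
    have e1 t : t \in `[a, b] -> t `^ 1 = id t.
      by move=> tI; rewrite powRr1 // ltW // (itv_gt0 a0 tI).
    by rewrite (eq_bfc sS (@cont_id _ a b) e1) (eq_bfc sT (@cont_id _ a b) e1) (bfc_id sS) (bfc_id sT).
  have mm := opmon_pow_mid ml mh.
  have E : (l + (l + 2 ^- n)) / 2 = l + 2 ^- n.+1.
    by rewrite exprS invfM; field; rewrite expf_neq0.
  rewrite E in mm.
  have n0 : 0 < 2 ^- n :> R by rewrite invr_gt0 exprn_gt0.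
  have nE : 2 ^- n.+1 = 2 ^- n / 2 :> R by rewrite exprSr invfM mulrC.
  have [h|h] := leP r (l + 2 ^- n.+1).
    by exists l; split; [exact: ml|exact: mm|apply/andP|apply/andP].
  have EE : l + 2 ^- n.+1 + 2 ^- n.+1 = l + 2 ^- n by rewrite nE; field.
  exists (l + 2 ^- n.+1); rewrite EE; split.
  - exact: mm.
  - exact: mh.
  - by apply/andP; split; lra.
  - by apply/andP; split; lra.
apply: opmon_lim => [t t0|a b e a0 e0]; first exact: cont_pow.
have [L L0 LP] := @ln_bound R a b a0.
have [n hn] := half_expn_small (mulr_ge0 L0 (expR_ge0 L)) e0.
have [l [ml mh /andP[l0 l1] /andP[lr rh]]] := bis n.
exists (fun t => t `^ l); split=> // [t t0|t tI]; first exact: cont_pow.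
have t0 := itv_gt0 a0 tI; rewrite !powRE //.
have bd s : 0 <= s -> s <= 1 -> s * ln t <= L.
  move=> s0 s1; apply: le_trans (ler_norm _) _; rewrite normrM ger0_norm //.
  by rewrite -[leRHS]mul1r ler_pM ?LP.
apply: le_trans (expR_lip (bd _ l0 l1) (bd _ r0 r1)) _.
rewrite -mulrBl normrM; apply: le_trans hn.
have -> : L * expR L / 2 ^+ n = 2 ^- n * L * expR L by ring.
rewrite ler_pM2r ?expR_gt0 // ler_pM ?LP //.
by rewrite distrC ger0_norm ?subr_ge0 //; lra.
Qed.

(** ln is the limit of (t^s - 1) / s as s = 2^-n tends to 0, locally uniformly with error at most s
    L^2 exp L, where L bounds |ln| on the interval. *)
Lemma opmon_ln : opmon (@ln R).
Proof.
apply: opmon_lim => [t t0|a b e a0 e0]; first exact: continuous_ln.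
have [L L0 LP] := @ln_bound R a b a0.
have [n hn] := half_expn_small (mulr_ge0 (mulr_ge0 L0 L0) (expR_ge0 L)) e0.
pose s : R := 2 ^- n; have s0 : 0 < s by rewrite invr_gt0 exprn_gt0.
have s1 : s <= 1 by rewrite invf_le1 ?exprn_gt0 // exprn_ege1 // ler1n.
exists (fun t => s^-1 * (t `^ s + (-1))); split=> [t t0|c d S T c0 sS sT ST x|t tI].
- by apply: cvgM; [exact: cvg_cst|apply: cvgD; [exact: cont_pow|exact: cvg_cst]].
- have cs := pos_cont_cont (b := d) c0 (pos_cont_pow s); have c1 := @cont_cst _ c d (-1).
  rewrite (bfcZ sS _ (contD cs c1)) (bfcZ sT _ (contD cs c1)).
  rewrite (bfcD sS cs c1) (bfcD sT cs c1) !qfZ !qfD (bfc_cst sS) (bfc_cst sT).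
  by rewrite ler_pM2l ?invr_gt0 // lerD2r; apply: (opmon_pow (ltW s0) s1 c0 sS sT ST).
have t0 := itv_gt0 a0 tI; rewrite powRE //.
set u := s * ln t; have -> : ln t = s^-1 * u by rewrite /u mulKf ?gt_eqF.
rewrite -mulrBr normrM gtr0_norm ?invr_gt0 //.
have uL : `|u| <= s * L by rewrite normrM gtr0_norm // ler_pM2l // LP.
have uL' : `|u| <= L by apply: le_trans uL _; rewrite ler_piMl.
have k1 : 0 <= expR u + -1 - u by have := expR_ge1Dx u; lra.
have k2 : expR u + -1 - u <= u * (expR u - 1).
  have := expR_ge1Dx (- u); rewrite expRN => h.
  have : (1 - u) * expR u <= 1.
    by rewrite -ler_pdivlMr ?expR_gt0 // div1r.
  lra.
rewrite ger0_norm //; apply: le_trans hn.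
have k3 : u * (expR u - 1) <= `|u| * (`|u| * expR L).
  apply: le_trans (ler_norm _) _; rewrite normrM ler_wpM2l //.
  have := @expR_lip R u 0 L (le_trans (ler_norm _) uL') L0.
  by rewrite expR0 subr0.
rewrite -[2 ^+ n]invrK -/s mulrC ler_pdivrMr //.
apply: le_trans k2 _; apply: le_trans k3 _.
have -> : L * L * expR L / s^-1 * s = (s * L) * ((s * L) * expR L) by rewrite invrK; ring.
by rewrite ler_pM ?mulr_ge0 ?expR_ge0 // ler_pM2r ?expR_gt0.
Qed.

End OperatorMonotone.

(** * Kantorovich and Specht inequalities *)

Section Scalar.
Context {R : realType}.
Implicit Types (h m M r s t u c : R).

Lemma ln_leB1 u : 0 < u -> ln u <= u - 1.
Proof. by move=> u0; have := @le_ln1Dx R (u - 1); rewrite subrKC; apply; lra. Qed.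

Lemma bernoulli_powR r u : (r < 0) || (1 < r) -> 0 < u -> 1 + r * (u - 1) <= u `^ r.
Proof.
move=> hr u0; case/orP: hr => r1.
  rewrite powRE //; apply: le_trans (expR_ge1Dx _).
  by rewrite lerD2l ler_wnM2l ?(ltW r1) // ln_leB1.
(* For r > 1 the bound ln u <= u - 1 points the wrong way; splitting off one factor u brings in u ln
   u >= u - 1 instead. *)
have -> : u `^ r = u * u `^ (r - 1).
  by rewrite -{2}(powRr1 (ltW u0)) -powRD ?subrKC // (gt_eqF u0) implybT.
have h1 : 1 + (r - 1) * ln u <= u `^ (r - 1) by rewrite powRE // expR_ge1Dx.
have h2 : u - 1 <= u * ln u.
  have := @ln_leB1 u^-1; rewrite invr_gt0 lnV ?posrE // => /(_ u0) h.
  have := ler_wpM2l (ltW u0) h; rewrite mulrBr mulfV ?gt_eqF //; lra.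
have h3 := ler_wpM2l (ltW u0) h1.
have r10 : 0 <= r - 1 by lra.
have := ler_wpM2l r10 h2; lra.
Qed.

(** The tangent at u lies below the power at both 1 and h ([key]); averaging the two inequalities
    with weights h - u and u - 1 gives the chord. *)
Lemma chord_powR h r u : 1 < h -> (r < 0) || (1 < r) -> 1 <= u <= h ->
  u `^ r <= (h `^ r - 1) / (h - 1) * u - (h `^ r - h) / (h - 1).
Proof.
move=> h1 hr /andP[u1 uh]; have u0 : 0 < u by lra.
have h0 : 0 < h by lra.
have hm : 0 < h - 1 by lra.
have key v : 0 < v -> u `^ r * (1 + r * (v / u - 1)) <= v `^ r.
  move=> v0; have := bernoulli_powR hr (divr_gt0 v0 u0).
  move=> /(ler_wpM2l (powR_ge0 u r)); rewrite -powRM ?divr_ge0 ?(ltW u0) ?(ltW v0) //.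
  by rewrite mulrCA mulfV ?gt_eqF // mulr1.
have k1 := key 1 ltr01; have k2 := key h h0; rewrite powR1 in k1.
rewrite -subr_ge0.
have -> : (h `^ r - 1) / (h - 1) * u - (h `^ r - h) / (h - 1) - u `^ r =
  ((h - u) * (1 - u `^ r * (1 + r * (1 / u - 1))) +
   (u - 1) * (h `^ r - u `^ r * (1 + r * (h / u - 1)))) / (h - 1).
  by field; rewrite !gt_eqF.
apply: divr_ge0; last exact: ltW.
by apply: addr_ge0; apply: mulr_ge0; rewrite subr_ge0.
Qed.

(** The prefactor and the base of the power in the Kantorovich constant. For r < 0 every quotient in
    them has negative numerator and denominator. *)
Lemma kantorovich_signs h r : 1 < h -> (r < 0) || (1 < r) ->
  0 < (h `^ r - h) / ((r - 1) * (h - 1)) /\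
  0 < (r - 1) / r * ((h `^ r - 1) / (h `^ r - h)).
Proof.
move=> h1 /orP[r0|r1]; have h0 : 0 < h by lra.
  have hr : h `^ r < 1 by rewrite powRE // -expR0 ltr_expR nmulr_rlt0 // ln_gt0.
  split.
    by rewrite -mulrNN -invrN -mulNr !divr_gt0 ?mulr_gt0 //; lra.
  apply: mulr_gt0; first by rewrite -mulrNN -invrN divr_gt0 //; lra.
  by rewrite -mulrNN -invrN divr_gt0 //; lra.
have hr : h < h `^ r.
  by rewrite -{1}(powRr1 (ltW h0)) !powRE // ltr_expR ltr_pM2r // ln_gt0.
split; first by rewrite divr_gt0 ?mulr_gt0 //; lra.
by rewrite mulr_gt0 ?divr_gt0 //; lra.
Qed.

Lemma Kantorovich_gt0 h r : 1 < h -> (r < 0) || (1 < r) -> 0 < Kantorovich h r.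
Proof.
by move=> h1 hr; have [k1 k2] := kantorovich_signs h1 hr; rewrite mulr_gt0 ?powR_gt0.
Qed.

(** The origin of the constant: z and k are the numbers for which the chord equals k (1 + r (z u -
    1)). Bernoulli bounds this by k (z u)^r, and k z^r is the Kantorovich constant, with equality at
    u = 1 / z. *)
Lemma Kantorovich_chord h r u : 1 < h -> (r < 0) || (1 < r) -> 0 < u ->
  (h `^ r - 1) / (h - 1) * u - (h `^ r - h) / (h - 1) <= Kantorovich h r * u `^ r.
Proof.
move=> h1 hr u0; have [k1 k2] := kantorovich_signs h1 hr.
rewrite /Kantorovich; set z := (r - 1) / r * _ in k2 *; set k := _ / (_ * _) in k1 *.
rewrite -[leRHS]mulrA -powRM ?(ltW k2) ?(ltW u0) //.
have := ler_wpM2l (ltW k1) (bernoulli_powR hr (mulr_gt0 k2 u0)).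
apply: le_trans; rewrite le_eqVlt; apply/orP; left; apply/eqP.
have hh : h `^ r - h != 0.
  by apply: contraTneq k1 => E; rewrite /k E mul0r ltxx.
have r0 : r != 0 by case/orP: hr => ?; [rewrite lt_eqF|rewrite gt_eqF //; lra].
have r1 : r - 1 != 0 by rewrite subr_eq0; case/orP: hr => ?; [rewrite lt_eqF //; lra|rewrite gt_eqF].
have h10 : h - 1 != 0 by rewrite subr_eq0 gt_eqF.
by rewrite /k /z; field; rewrite ?hh ?r0 ?r1 ?h10.
Qed.

(** The chord over [m, M], rescaled to [1, M / m]. It dominates the power on [m, M] only, while its
    upper bound holds on the whole half-line. The sign of the slope matters when the chord is
    applied to an operator inequality. *)
Lemma powR_chord m M r : 0 < m -> m < M -> (r < 0) || (1 < r) -> exists mu nu : R,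
  [/\ 1 < r -> 0 <= mu, forall t, t \in `[m, M] -> t `^ r <= mu * t + nu &
     forall t, 0 < t -> mu * t + nu <= Kantorovich (M / m) r * t `^ r].
Proof.
move=> m0 mM hr; set h := M / m.
have h1 : 1 < h by rewrite ltr_pdivlMr // mul1r.
have tE t : 0 < t -> t `^ r = m `^ r * (t / m) `^ r.
  by move=> t0; rewrite -powRM ?divr_ge0 ?(ltW m0) ?(ltW t0) // mulrCA mulfV ?gt_eqF // mulr1.
exists (m `^ r * ((h `^ r - 1) / (h - 1)) / m), (- (m `^ r * ((h `^ r - h) / (h - 1)))).
have E t : m `^ r * ((h `^ r - 1) / (h - 1)) / m * t + - (m `^ r * ((h `^ r - h) / (h - 1))) =
   m `^ r * ((h `^ r - 1) / (h - 1) * (t / m) - (h `^ r - h) / (h - 1)) by ring.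
split=> [r1|t|t t0].
- have hr1 : 1 <= h `^ r by rewrite powRE ?(lt_trans ltr01) // -expR0 ler_expR mulr_ge0 ?ln_ge0 ?ltW //; lra.
  by rewrite !(mulr_ge0, divr_ge0, powR_ge0) ?invr_ge0 ?subr_ge0 ?(ltW m0) ?(ltW h1).
- rewrite in_itv /= => /andP[mt tM]; have t0 := lt_le_trans m0 mt.
  rewrite E tE // ler_wpM2l ?powR_ge0 // chord_powR // ler_pdivlMr // mul1r mt /=.
  by rewrite ler_pM2r ?invr_gt0.
rewrite E (tE t t0) [leRHS]mulrCA ler_wpM2l ?powR_ge0 // Kantorovich_chord // divr_gt0 //.
Qed.

Definition log_slope h := ln h / (h - 1).

Lemma log_slope_gt0 h : 1 < h -> 0 < log_slope h.
Proof. by move=> h1; rewrite divr_gt0 ?ln_gt0 ?subr_gt0. Qed.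

Lemma SpechtE h : 1 < h -> Specht h = expR (log_slope h - 1) / log_slope h.
Proof.
move=> h1; rewrite /Specht gt_eqF // powRE ?(lt_trans ltr01) //.
rewrite expRB /log_slope [_^-1 * ln h]mulrC.
by field; rewrite !gt_eqF ?subr_gt0 ?ln_gt0 ?expR_gt0.
Qed.

Lemma Specht_gt0 h : 1 < h -> 0 < Specht h.
Proof. by move=> h1; rewrite SpechtE // divr_gt0 ?expR_gt0 ?log_slope_gt0. Qed.

Lemma chord_ln h u : 1 < h -> 1 <= u <= h -> log_slope h * (u - 1) <= ln u.
Proof.
move=> h1 /andP[u1 uh]; have u0 : 0 < u by lra.
have h0 : 0 < h by lra.
have k1 : - ln u <= 1 / u - 1.
  by rewrite -lnV ?posrE // div1r ln_leB1 ?invr_gt0.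
have k2 : ln h - ln u <= h / u - 1 by rewrite -ln_div ?posrE // ln_leB1 ?divr_gt0.
rewrite /log_slope mulrAC ler_pdivrMr ?subr_gt0 // mulrC.
have e1 := ler_wpM2l (_ : 0 <= h - u) k1; have e2 := ler_wpM2l (_ : 0 <= u - 1) k2.
(* The weights of the endpoints 1 and h for which the two tangent bounds cancel. *)
have E : (h - u) * (1 / u - 1) + (u - 1) * (h / u - 1) = 0.
  by field; rewrite gt_eqF.
have {}e1 := e1 ltac:(lra); have {}e2 := e2 ltac:(lra); lra.
Qed.

(** With c the slope, the tangent of ln parallel to the chord touches at 1 / c, and ln (c u) <= c u
    - 1 puts it c - 1 - ln c = ln (Specht h) above the chord. *)
Lemma ln_Specht h u : 1 < h -> 0 < u -> ln u <= log_slope h * (u - 1) + ln (Specht h).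
Proof.
move=> h1 u0; have c0 := log_slope_gt0 h1; set c := log_slope h in c0 *.
rewrite SpechtE // ln_div ?posrE ?expR_gt0 // expRK.
have := ln_leB1 (mulr_gt0 c0 u0); rewrite lnM ?posrE //; rewrite -/c; lra.
Qed.

(** The left side is the chord of exp over [0, ln h], of slope 1 / c. It equals (c + s) / c, at most
    exp (c + s - 1) / c. *)
Lemma exp_Specht h s : 1 < h -> 1 + s / log_slope h <= Specht h * expR s.
Proof.
move=> h1; have c0 := log_slope_gt0 h1; rewrite SpechtE //; set c := log_slope h in c0 *.
have -> : 1 + s / c = (c + s) / c by field; rewrite gt_eqF.
rewrite mulrAC ler_pM2r ?invr_gt0 // -expRD.
by apply: le_trans (expR_ge1Dx _); lra.
Qed.

Lemma ln_chord m M : 0 < m -> m < M -> exists mu nu : R,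
  [/\ 0 <= mu, forall t, t \in `[m, M] -> mu * t + nu <= ln t &
     forall t, 0 < t -> ln t <= mu * t + nu + ln (Specht (M / m))].
Proof.
move=> m0 mM; set h := M / m.
have h1 : 1 < h by rewrite ltr_pdivlMr // mul1r.
exists (log_slope h / m), (ln m - log_slope h).
have E t : log_slope h / m * t + (ln m - log_slope h) = ln m + log_slope h * (t / m - 1) by ring.
have lE t : 0 < t -> ln t = ln m + ln (t / m) by move=> t0; rewrite ln_div ?posrE //; ring.
split=> [|t|t t0]; first by rewrite divr_ge0 ?ltW ?log_slope_gt0.
- rewrite in_itv /= => /andP[mt tM]; have t0 := lt_le_trans m0 mt.
  rewrite E (lE t t0) lerD2l chord_ln // ler_pdivlMr // mul1r mt /=.
  by rewrite ler_pM2r ?invr_gt0.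
by rewrite E (lE t t0) -addrA lerD2l ln_Specht // divr_gt0.
Qed.

Lemma exp_chord h l : 1 < h -> exists mu nu : R,
  [/\ 0 <= mu, forall t, t \in `[l, l + ln h] -> expR t <= mu * t + nu &
     forall t, mu * t + nu <= Specht h * expR t].
Proof.
move=> h1; have c0 := log_slope_gt0 h1; have h0 : 0 < h by lra.
exists (expR l / log_slope h), (expR l * (1 - l / log_slope h)).
have E t : expR l / log_slope h * t + expR l * (1 - l / log_slope h) =
   expR l * (1 + (t - l) / log_slope h) by ring.
have eE t : expR t = expR l * expR (t - l) by rewrite -expRD subrKC.
split=> [|t|t]; first by rewrite divr_ge0 ?expR_ge0 ?ltW.
- rewrite in_itv /= => /andP[lt tl]; rewrite E (eE t) ler_pM2l ?expR_gt0 //.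
  (* The chord of exp is that of ln read through the inverse function. *)
  have := @chord_ln h (expR (t - l)) h1.
  rewrite expRK -expR0 ler_expR subr_ge0 lt /= -{1}(lnK (x := h)) ?posrE // ler_expR expR0.
  rewrite lerBlDl tl => /(_ isT) k.
  by rewrite -lerBlDl ler_pdivlMr // mulrC.
by rewrite E (eE t) [leRHS]mulrCA ler_pM2l ?expR_gt0 // exp_Specht.
Qed.

End Scalar.

(** * Chord inequalities for operators and weighted sums *)

Section ReverseInequalities.
Context {R : realType} {H : hilbert R}.
Implicit Types (S T : bop H) (a b c e h m M r s t p q : R) (f g : R -> R) (x : H).

Lemma bfc_affine a b T mu nu : spec a b T ->
  bfc (fun t => mu * t + nu) T = mu *: T + nu *: (1 : bop H).
Proof.
move=> sT; rewrite (bfcD sT (contZ (@cont_id _ a b)) (@cont_cst _ a b nu)).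
by rewrite (bfcZ sT _ (@cont_id _ a b)) (bfc_id sT) (bfc_cst sT).
Qed.

Lemma cont_affine a b mu nu : cont a b (fun t : R => mu * t + nu).
Proof. exact: contD (contZ (@cont_id _ a b)) (@cont_cst _ a b nu). Qed.
Arguments cont_affine : clear implicits.

Lemma qf_affine_le a b f T mu nu x : spec a b T -> cont a b f ->
  (forall t, t \in `[a, b] -> f t <= mu * t + nu) ->
  qf (bfc f T) x <= mu * qf T x + nu * ip x x.
Proof.
move=> sT cf h; have := bfc_le sT cf (cont_affine a b mu nu) h x.
by rewrite (bfc_affine _ _ sT) qfD !qfZ qf1.
Qed.

Lemma qf_affine_ge a b f T mu nu x : spec a b T -> cont a b f ->
  (forall t, t \in `[a, b] -> mu * t + nu <= f t) ->
  mu * qf T x + nu * ip x x <= qf (bfc f T) x.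
Proof.
move=> sT cf h; have := bfc_le sT (cont_affine a b mu nu) cf h x.
by rewrite (bfc_affine _ _ sT) qfD !qfZ qf1.
Qed.

Lemma cont_powR a b r : 0 < a -> cont a b (fun t => t `^ r).
Proof. by move=> a0; exact: pos_cont_cont (pos_cont_pow r). Qed.

Lemma cont_ln a b : 0 < a -> cont a b (@ln R).
Proof. by move=> a0; apply: cont_pt => t tI; apply: continuous_ln; exact: itv_gt0 tI. Qed.

Lemma cont_exp a b : cont a b (@expR R).
Proof. by apply: cont_pt => t _; exact: continuous_expR. Qed.

(** Only the smaller operator must live on the chord interval; [T] may have any positive bounds,
    which admits the multiples of powers to which this is applied. *)
Lemma pow_reverse_monotone m M a b r S T : 0 < m -> m < M -> spec m M S -> 0 < a -> spec a b T ->
  1 < r -> ble S T ->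
  ble (bfc (fun t => t `^ r) S) (Kantorovich (M / m) r *: bfc (fun t => t `^ r) T).
Proof.
move=> m0 mM sS a0 sT r1 ST x.
have [|mu [nu [mu0 h1 h2]]] := @powR_chord R m M r m0 mM; first by rewrite r1 orbT.
apply: le_trans (qf_affine_le x sS (cont_powR m0) h1) _.
have cK : cont a b (fun t => Kantorovich (M / m) r * t `^ r) by exact/contZ/cont_powR.
rewrite -(bfcZ sT _ (cont_powR a0)).
apply: le_trans (qf_affine_ge x sT cK _); last by move=> t /(itv_gt0 a0); exact: h2.
by rewrite lerD2r ler_wpM2l ?mu0.
Qed.

Lemma exp_reverse_monotone h l a b S T : 1 < h -> spec l (l + ln h) S -> spec a b T ->
  ble S T -> ble (bfc (@expR R) S) (Specht h *: bfc (@expR R) T).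
Proof.
move=> h1 sS sT ST x; have [mu [nu [mu0 k1 k2]]] := exp_chord l h1.
apply: le_trans (qf_affine_le x sS (@cont_exp _ _) k1) _.
have cK : cont a b (fun t => Specht h * expR t) by exact/contZ/cont_exp.
rewrite -(bfcZ sT _ (@cont_exp _ _)).
apply: le_trans (qf_affine_ge x sT cK _); last by move=> t _; exact: k2.
by rewrite lerD2r ler_wpM2l.
Qed.

Section Weights.
Variables (n : nat) (w : 'I_n -> R).
Hypothesis w_prob : probability_vector w.

Definition wsum (B : 'I_n -> bop H) : bop H := \sum_j w j *: B j.

Lemma qf_wsum B x : qf (wsum B) x = \sum_j w j * qf (B j) x.
Proof. by rewrite qf_sum; apply: eq_bigr => j _; rewrite qfZ. Qed.

Lemma wsum_cst c : \sum_j w j * c = c.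
Proof. by rewrite -mulr_suml w_prob.2 mul1r. Qed.

Lemma wsum_affine B mu nu x :
  mu * qf (wsum B) x + nu * ip x x = \sum_j w j * (mu * qf (B j) x + nu * ip x x).
Proof.
rewrite qf_wsum -{1}(wsum_cst (nu * ip x x)) mulr_sumr -big_split /=.
by apply: eq_bigr => j _; ring.
Qed.

Lemma le_wsum (f g : 'I_n -> R) : (forall j, f j <= g j) ->
  \sum_j w j * f j <= \sum_j w j * g j.
Proof. by move=> fg; apply: ler_sum => j _; rewrite ler_wpM2l ?w_prob.1. Qed.

Lemma spec_wsum a b B : (forall j, spec a b (B j)) -> spec a b (wsum B).
Proof.
move=> sB; split=> [|x]; first by apply: sa_sum => j _; apply: saZ; apply: spec_sa (sB j).
rewrite qf_wsum -(wsum_cst (a * ip x x)) -(wsum_cst (b * ip x x)).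
by apply/andP; split; apply: le_wsum => j; have /andP[] := (sB j).2 x.
Qed.

Lemma pow_reverse_jensen m M r B : 0 < m -> m < M -> (forall j, spec m M (B j)) ->
  (r < 0) || (1 < r) ->
  ble (wsum (fun j => bfc (fun t => t `^ r) (B j)))
      (Kantorovich (M / m) r *: bfc (fun t => t `^ r) (wsum B)).
Proof.
move=> m0 mM sB hr x; have [mu [nu [_ h1 h2]]] := powR_chord m0 mM hr.
have sW := spec_wsum sB.
have cK : cont m M (fun t => Kantorovich (M / m) r * t `^ r) by exact/contZ/cont_powR.
rewrite -(bfcZ sW _ (cont_powR m0)).
apply: le_trans (qf_affine_ge x sW cK _); last by move=> t /(itv_gt0 m0); exact: h2.
rewrite wsum_affine qf_wsum; apply: le_wsum => j.
exact: (qf_affine_le x (sB j) (cont_powR m0) h1).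
Qed.

Lemma ln_reverse_jensen m M B : 0 < m -> m < M -> (forall j, spec m M (B j)) ->
  ble (bfc (@ln R) (wsum B))
      (wsum (fun j => bfc (@ln R) (B j)) + ln (Specht (M / m)) *: (1 : bop H)).
Proof.
move=> m0 mM sB x; have [mu [nu [_ h1 h2]]] := ln_chord m0 mM.
have sW := spec_wsum sB.
apply: (@le_trans _ _ (mu * qf (wsum B) x + (nu + ln (Specht (M / m))) * ip x x)).
  apply: (qf_affine_le x sW (cont_ln m0)) => t /(itv_gt0 m0) /h2; rewrite addrA; exact.
rewrite qfD qfZ qf1 mulrDl addrA lerD2r wsum_affine qf_wsum; apply: le_wsum => j.
exact: (qf_affine_ge x (sB j) (cont_ln m0) h1).
Qed.

End Weights.

Lemma powR_itv a b t p : 0 < a -> 0 <= p -> t \in `[a, b] -> t `^ p \in `[a `^ p, b `^ p].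
Proof.
move=> a0 p0; rewrite !in_itv /= => /andP[h1 h2]; have t0 := lt_le_trans a0 h1.
have b0 := lt_le_trans t0 h2.
by rewrite !ge0_ler_powR ?nnegrE // ltW.
Qed.

Lemma powRN_itv a b t p : 0 < a -> 0 <= p -> t \in `[a, b] -> t `^ (- p) \in `[b `^ (- p), a `^ (- p)].
Proof.
move=> a0 p0 tI; have := powR_itv a0 p0 tI; have t0 := itv_gt0 a0 tI.
move: tI; rewrite !in_itv /= => /andP[h1 h2] /andP[k1 k2].
have b0 := lt_le_trans t0 h2.
by rewrite !powRN !lef_pV2 ?posrE ?powR_gt0 // k1 k2.
Qed.

Definition bpow p T := bfc (fun t => t `^ p) T.

Lemma spec_bpow a b p T : 0 < a -> 0 <= p -> spec a b T -> spec (a `^ p) (b `^ p) (bpow p T).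
Proof. by move=> a0 p0 sT; apply: (bfc_spec sT (cont_powR a0)) => t; exact: powR_itv. Qed.

Lemma spec_bpowN a b p T : 0 < a -> 0 <= p -> spec a b T ->
  spec (b `^ (- p)) (a `^ (- p)) (bpow (- p) T).
Proof. by move=> a0 p0 sT; apply: (bfc_spec sT (cont_powR a0)) => t; exact: powRN_itv. Qed.

Lemma bfc_comp_pos a b f g T : 0 < a -> spec a b T -> pos_cont f ->
  (forall t, 0 < t -> {for t, continuous g}) ->
  bfc g (bfc f T) = bfc (g \o f) T.
Proof.
move=> a0 sT pf cg; have cf := pos_cont_cont (b := b) a0 pf.
have [M M0 MP] := cont_bounded cf.
have [N N0 NP] := cont_bounded (contV (pos_cont_neq0 (b := b) a0 pf) cf).
(* A positive lower bound of f, from the bound N on 1 / f; the added 1 covers N = 0. *)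
have c0 : 0 < (N + 1)^-1 by rewrite invr_gt0 ltr_wpDl.
apply: (bfc_comp sT (c := (N + 1)^-1) (d := M) cf).
- move=> t tI; have [f0 _] := pf t (itv_gt0 a0 tI).
  rewrite in_itv /=; have := MP _ tI; have := NP _ tI.
  rewrite !gtr0_norm ?invr_gt0 // => h ->; rewrite andbT.
  by rewrite -[f t]invrK lef_pV2 ?posrE ?invr_gt0 ?ltr_wpDl //; lra.
- by apply: cont_pt => t tI; apply: cg; exact: itv_gt0 tI.
apply: cont_pt => t tI; have [f0 cft] := pf t (itv_gt0 a0 tI).
by apply: continuous_comp => //; exact: cg.
Qed.

Lemma bpow_comp a b r s T : 0 < a -> spec a b T -> bpow s (bpow r T) = bpow (r * s) T.
Proof.
move=> a0 sT; rewrite /bpow (bfc_comp_pos a0 sT (pos_cont_pow r)).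
  by apply: (eq_bfc sT (cont_powR a0)) => t tI /=; rewrite powRrM.
by move=> t; exact: cont_pow.
Qed.

Lemma bpowZ a b r s c T : 0 < a -> 0 < c -> spec a b T ->
  bpow s (c *: bpow r T) = c `^ s *: bpow (r * s) T.
Proof.
move=> a0 c0 sT; rewrite /bpow.
have pc : pos_cont (fun t : R => c * t `^ r).
  move=> t t0; split; first by rewrite mulr_gt0 ?powR_gt0.
  by apply: cvgM; [exact: cvg_cst|exact: cont_pow].
rewrite -!(bfcZ sT _ (cont_powR a0)) (bfc_comp_pos a0 sT pc).
  apply: (eq_bfc sT (contZ (cont_powR a0))) => t tI /=.
  by rewrite powRM ?powR_ge0 ?(ltW c0) // powRrM.
by move=> t; exact: cont_pow.
Qed.

Lemma spec_scale a b c T : 0 < c -> spec a b T -> spec (c * a) (c * b) (c *: T).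
Proof.
move=> c0 [sT Tab]; split=> [|x]; first exact: saZ.
have /andP[h1 h2] := Tab x.
by rewrite qfZ -!mulrA (ler_pM2l c0) h1 (ler_pM2l c0) h2.
Qed.

Lemma bpow1 a b T : 0 < a -> spec a b T -> bpow 1 T = T.
Proof.
move=> a0 sT; rewrite -[RHS](bfc_id sT); apply: (eq_bfc sT (@cont_id _ a b)) => t tI.
by rewrite powRr1 // ltW // (itv_gt0 a0 tI).
Qed.

Lemma bpowNl a b p T : 0 < a -> spec a b T -> bpow (- p) T * bpow p T = 1.
Proof.
move=> a0 sT; rewrite /bpow -(bfcM sT (cont_powR a0) (cont_powR a0)).
rewrite -[1]scale1r -(bfc_cst sT); apply: (eq_bfc sT (@cont_cst _ a b 1)) => t tI.
by rewrite powRN mulVf // gt_eqF // powR_gt0 // (itv_gt0 a0 tI).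
Qed.

Lemma bpowNr a b p T : 0 < a -> spec a b T -> bpow p T * bpow (- p) T = 1.
Proof. by move=> a0 sT; have := bpowNl (- p) a0 sT; rewrite opprK. Qed.

Lemma bpow_ge0 a b p T x : 0 < a -> spec a b T -> 0 <= qf (bpow p T) x.
Proof. by move=> a0 sT; apply: (bfc_ge0 sT x (cont_powR a0)) => t _; exact: powR_ge0. Qed.

Lemma bpow_sa a b p T : 0 < a -> spec a b T -> sa (bpow p T).
Proof. by move=> a0 sT; exact: (bfc_sa sT (cont_powR a0)). Qed.

Lemma bpow_mono a b c d s S T : 0 < a -> 0 < c -> spec a b S -> spec c d T -> 0 <= s -> s <= 1 ->
  ble S T -> ble (bpow s S) (bpow s T).
Proof.
move=> a0 c0 sS sT s0 s1 ST.
have sS' := spec_wide (c := Num.min a c) (d := Num.max b d) _ _ sS.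
have sT' := spec_wide (c := Num.min a c) (d := Num.max b d) _ _ sT.
apply: (opmon_pow s0 s1 (a := Num.min a c) (b := Num.max b d)) => //.
- by rewrite lt_min a0.
- by apply: sS'; rewrite ?ge_min ?le_max lexx ?orbT.
- by apply: sT'; rewrite ?ge_min ?le_max lexx ?orbT.
Qed.

Lemma bpow_antimono a b c d s S T : 0 < a -> 0 < c -> spec a b S -> spec c d T -> 0 <= s -> s <= 1 ->
  ble S T -> ble (bpow (- s) T) (bpow (- s) S).
Proof.
move=> a0 c0 sS sT s0 s1 ST.
apply: (ble_inv (bpow_sa s a0 sS) _ (bpowNr s a0 sS) (bpowNr s c0 sT)).
  by move=> x; exact: bpow_ge0 sS.
exact: bpow_mono sS sT s0 s1 ST.
Qed.

Lemma ln_mono a b c d S T : 0 < a -> 0 < c -> spec a b S -> spec c d T ->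
  ble S T -> ble (bfc (@ln R) S) (bfc (@ln R) T).
Proof.
move=> a0 c0 sS sT ST.
have sS' := spec_wide (c := Num.min a c) (d := Num.max b d) _ _ sS.
have sT' := spec_wide (c := Num.min a c) (d := Num.max b d) _ _ sT.
apply: (@opmon_ln _ _ (Num.min a c) (Num.max b d)) => //.
- by rewrite lt_min a0.
- by apply: sS'; rewrite ?ge_min ?le_max lexx ?orbT.
- by apply: sT'; rewrite ?ge_min ?le_max lexx ?orbT.
Qed.

End ReverseInequalities.

(** * Comparison of operators lying between weighted means of powers *)

Section Core.
Context {R : realType} {H : hilbert R}.
Variables (n : nat) (w : 'I_n -> R).
Hypothesis w_prob : probability_vector w.
Variables (A : 'I_n -> bop H) (m M : R).
Hypotheses (m0 : 0 < m) (mM : m < M) (sA : forall j, spec m M (A j)).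
Let M0 : 0 < M. Proof. exact: lt_trans mM. Qed.
Let h : R := M / m.
Let h1 : 1 < h. Proof. by rewrite ltr_pdivlMr // mul1r. Qed.

(** All that the comparison uses about X_p. The harmonic bound is put on the inverse, where it reads
    as an arithmetic one. *)
Definition between p (X : bop H) :=
  [/\ spec (m `^ p) (M `^ p) X, ble X (wsum w (fun j => bpow p (A j))) &
      ble (bpow (- 1) X) (wsum w (fun j => bpow (- p) (A j)))].

Lemma powR_ratio (p : R) : (M `^ p) / (m `^ p) = h `^ p.
Proof. by rewrite !powRE ?divr_gt0 // ln_div ?posrE // mulrBr expRB. Qed.

Lemma powR_ratioN (p : R) : (m `^ (- p)) / (M `^ (- p)) = h `^ p.
Proof. by rewrite !powRN invrK mulrC powR_ratio. Qed.

Lemma powR_invN (c r : R) : 0 < c -> c `^ (- r) = c^-1 `^ r.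
Proof. by move=> c0; rewrite !powRE ?invr_gt0 // lnV ?posrE // mulrN mulNr. Qed.

Lemma powR_strict (p : R) : 0 < p -> m `^ p < M `^ p.
Proof. by move=> p0; rewrite gt0_ltr_powR ?nnegrE // ltW. Qed.

Lemma powRN_strict (p : R) : 0 < p -> M `^ (- p) < m `^ (- p).
Proof. by move=> p0; rewrite !powRN ltf_pV2 ?posrE ?powR_gt0 // powR_strict. Qed.

Lemma powR_ratio_gt1 (p : R) : 0 < p -> 1 < h `^ p.
Proof. by move=> p0; rewrite powRE ?(lt_trans ltr01) // -expR0 ltr_expR mulr_gt0 // ln_gt0. Qed.

Lemma eq_wsum (B C : 'I_n -> bop H) : B =1 C -> wsum w B = wsum w C.
Proof. by move=> BC; apply: eq_bigr => j _; rewrite BC. Qed.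

(** With s = q / p the upper bound is Y <= sum w A^q = sum w (A^-p)^-s <= K (sum w A^-p)^-s <= K
    X^s. The lower bound runs the same chain for Y^-1, with A^p in place of A^-p, and inverts the
    outcome. *)
Lemma between_compare p q X Y : 0 < q -> q <= p -> between p X -> between q Y ->
  let K := Kantorovich (h `^ p) (- (q / p)) in
  [/\ 0 < K, ble Y (K *: bpow (q / p) X) & ble (K^-1 *: bpow (q / p) X) Y].
Proof.
move=> q0 qp [sX X1 X2] [sY Y1 Y2] K; have p0 := lt_le_trans q0 qp.
have mp0 : 0 < m `^ p by exact: powR_gt0.
have mq0 : 0 < m `^ q by exact: powR_gt0.
have mn0 : 0 < M `^ (- p) by exact: powR_gt0.
set s := q / p in K *; have s0 : 0 < s by rewrite divr_gt0.
have s1 : s <= 1 by rewrite ler_pdivrMr // mul1r.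
have hs : (- s < 0) || (1 < - s) by rewrite oppr_lt0 s0.
have ps : p * s = q by rewrite /s mulrCA mulfV ?mulr1 // gt_eqF.
have K0 : 0 < K by rewrite Kantorovich_gt0 // powR_ratio_gt1.
have sB j : spec (M `^ (- p)) (m `^ (- p)) (bpow (- p) (A j)).
  exact: spec_bpowN (ltW p0) (sA j).
have sC j : spec (m `^ p) (M `^ p) (bpow p (A j)) by exact: spec_bpow (ltW p0) (sA j).
have sX1 : spec ((M `^ p) `^ (- 1)) ((m `^ p) `^ (- 1)) (bpow (- 1) X).
  exact: spec_bpowN ler01 sX.
split=> //.
  apply: ble_trans Y1 _.
  rewrite (_ : wsum w _ = wsum w (fun j => bpow (- s) (bpow (- p) (A j)))); last first.
    by apply: eq_wsum => j; rewrite (bpow_comp _ _ m0 (sA j)) mulrNN ps.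
  have := pow_reverse_jensen w_prob mn0 (powRN_strict p0) sB hs.
  rewrite powR_ratioN => /ble_trans; apply => x.
  rewrite !qfZ ler_pM2l //.
  have -> : bpow s X = bpow (- s) (bpow (- 1) X).
    by rewrite (bpow_comp _ _ mp0 sX) mulrNN mul1r.
  apply: (bpow_antimono _ mn0 sX1 (spec_wsum w_prob sB) (ltW s0) s1 X2).
  by rewrite powR_gt0 // powR_gt0.
have sN := spec_wsum w_prob sC.
have YX : ble (bpow (- 1) Y) (K *: bpow (- s) X).
  apply: ble_trans Y2 _.
  rewrite (_ : wsum w _ = wsum w (fun j => bpow (- s) (bpow p (A j)))); last first.
    by apply: eq_wsum => j; rewrite (bpow_comp _ _ m0 (sA j)) mulrN ps.
  have := pow_reverse_jensen w_prob mp0 (powR_strict p0) sC hs.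
  rewrite powR_ratio => /ble_trans; apply => x.
  rewrite !qfZ ler_pM2l //.
  exact: (bpow_antimono mp0 mp0 sX sN (ltW s0) s1 X1).
apply: (ble_inv (bpow_sa (- 1) mq0 sY) _ _ _ YX).
- by move=> x; exact: bpow_ge0 mq0 sY.
- by rewrite -{2}(bpow1 mq0 sY) (bpowNl 1 mq0 sY).
rewrite -bscaleAl -bscaleAr (bpowNl s mp0 sX) scalerA mulfV ?scale1r // gt_eqF //.
Qed.

Lemma between_spec1 p X : 0 < p -> between p X -> spec m M (bpow p^-1 X).
Proof.
move=> p0 [sX _ _]; have p1 : 0 <= p^-1 by rewrite invr_ge0 ltW.
have := spec_bpow (powR_gt0 p m0) p1 sX.
by rewrite -!powRrM mulfV ?gt_eqF // !powRr1 // ltW.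
Qed.

Lemma power_mean_ge1 p q X Y : 1 <= q -> q <= p -> between p X -> between q Y ->
  let K := Kantorovich (h `^ p) (- (q / p)) in
  ble (K `^ (- q^-1) *: bpow p^-1 X) (bpow q^-1 Y) /\
  ble (bpow q^-1 Y) (K `^ (q^-1) *: bpow p^-1 X).
Proof.
move=> q1 qp bX bY K; have q0 : 0 < q by lra.
have p0 := lt_le_trans q0 qp.
have [K0 YX XY] := between_compare q0 qp bX bY.
rewrite -/K in K0 YX XY; clearbody K.
have [[sX _ _] [sY _ _]] := (bX, bY).
have mp0 : 0 < m `^ p by exact: powR_gt0.
have mq0 : 0 < m `^ q by exact: powR_gt0.
have e : q / p * q^-1 = p^-1 by field; rewrite !gt_eqF.
have iq0 : 0 <= q^-1 by rewrite invr_ge0 ltW.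
have iq1 : q^-1 <= 1 by rewrite invf_le1.
have qp0 : 0 <= q / p by rewrite divr_ge0 // ltW.
have sXs := spec_bpow mp0 qp0 sX.
have spZ c (c0 : 0 < c) := spec_scale c0 sXs.
have pZ c : 0 < c -> 0 < c * (m `^ p) `^ (q / p) by move=> c0; rewrite mulr_gt0 ?powR_gt0.
have V0 : 0 < K^-1 by rewrite invr_gt0.
split.
  rewrite powR_invN // -e -(bpowZ _ _ mp0 V0 sX).
  exact: (bpow_mono (pZ _ V0) mq0 (spZ _ V0) sY iq0 iq1 XY).
rewrite -e -(bpowZ _ _ mp0 K0 sX).
exact: (bpow_mono mq0 (pZ _ K0) sY (spZ _ K0) iq0 iq1 YX).
Qed.

Lemma power_mean_lt1 p q X Y : 0 < q -> q < 1 -> q < p -> between p X -> between q Y ->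
  let K := Kantorovich (h `^ p) (- (q / p)) in
  let K1 := Kantorovich (h `^ q) q^-1 in
  ble ((K1^-1 * K `^ (- q^-1)) *: bpow p^-1 X) (bpow q^-1 Y) /\
  ble (bpow q^-1 Y) ((K1 * K `^ (q^-1)) *: bpow p^-1 X).
Proof.
move=> q0 q1 /ltW qp bX bY K K1.
have p0 := lt_le_trans q0 qp.
have [K0 YX XY] := between_compare q0 qp bX bY.
rewrite -/K in K0 YX XY; clearbody K.
have [[sX _ _] [sY _ _]] := (bX, bY).
have mp0 : 0 < m `^ p by exact: powR_gt0.
have mq0 : 0 < m `^ q by exact: powR_gt0.
have e : q / p * q^-1 = p^-1 by field; rewrite !gt_eqF.
have iq1 : 1 < q^-1 by rewrite invf_gt1.
have K10 : 0 < K1 by apply: Kantorovich_gt0; [exact: powR_ratio_gt1|rewrite iq1 orbT].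
have K1E : Kantorovich (h `^ q) q^-1 = K1 by [].
clearbody K1.
have qp0 : 0 <= q / p by rewrite divr_ge0 // ltW.
have sXs := spec_bpow mp0 qp0 sX.
have pq : p * (q / p) = q by field; rewrite gt_eqF.
rewrite -!powRrM pq in sXs.
have spZ c (c0 : 0 < c) := spec_scale c0 sXs.
have V0 : 0 < K^-1 by rewrite invr_gt0.
split.
  (* The chord is now taken over the interval of the rescaled power of X. Scaling keeps the endpoint
     ratio h^q, so the constant is the same as in the other half. *)
  have mq := ltr_pM2l V0 (m `^ q) (M `^ q); rewrite powR_strict // in mq.
  have := pow_reverse_monotone (mulr_gt0 V0 mq0) mq (spZ _ V0) mq0 sY iq1 XY.
  rewrite -mulf_div mulfV ?gt_eqF // mul1r powR_ratio K1E -/(bpow _ _) (bpowZ _ _ mp0 V0 sX) e.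
  move=> k x; move: (k x); rewrite !qfZ => kx.
  by rewrite -mulrA ler_pdivrMl // powR_invN.
have := pow_reverse_monotone mq0 (powR_strict q0) sY _ (spZ _ K0) iq1 YX.
rewrite powR_ratio K1E -!/(bpow _ _) (bpowZ _ _ mp0 K0 sX) e scalerA.
by apply; rewrite mulr_gt0.
Qed.

(** On the logarithmic side the order is preserved: Z = log X^(1/p) and L differ by at most k = p^-1
    ln S(h^p) both ways. Returning through exp, which is not operator monotone, costs the factor
    S(h). *)
Lemma power_mean_exp p X : 0 < p -> between p X ->
  let E := bfc (@expR R) (wsum w (fun j => bfc (@ln R) (A j))) in
  ble (((Specht h)^-1 * Specht (h `^ p) `^ (- p^-1)) *: bpow p^-1 X) E /\
  ble E ((Specht h * Specht (h `^ p) `^ (p^-1)) *: bpow p^-1 X).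
Proof.
move=> p0 bX; have [sX X1 X2] := bX => E.
have mp0 : 0 < m `^ p by exact: powR_gt0.
have mn0 : 0 < M `^ (- p) by exact: powR_gt0.
have S0 := Specht_gt0 h1; have Sp0 := Specht_gt0 (powR_ratio_gt1 p0).
pose L := wsum w (fun j => bfc (@ln R) (A j)); rewrite -/L in E *.
have lnI (a b t : R) : 0 < a -> t \in `[a, b] -> ln t \in `[ln a, ln b].
  move=> a0; rewrite !in_itv /= => /andP[k1 k2]; have t0 := lt_le_trans a0 k1.
  by rewrite !ler_ln ?posrE ?k1 // (lt_le_trans t0).
have sL : spec (ln m) (ln m + ln h) L.
  rewrite ln_div ?posrE // subrKC; apply: (spec_wsum w_prob) => j.
  by apply: (bfc_spec (sA j) (cont_ln m0)) => t; exact: lnI.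
pose Z := bfc (@ln R) (bpow p^-1 X); have sG := between_spec1 p0 bX.
have sZ : spec (ln m) (ln m + ln h) Z.
  rewrite ln_div ?posrE // subrKC.
  by apply: (bfc_spec sG (cont_ln m0)) => t; exact: lnI.
have GZ : bfc (@expR R) Z = bpow p^-1 X.
  rewrite (bfc_comp sG (cont_ln m0) (fun t => lnI m M t m0) (@cont_exp _ _ _)).
    rewrite -[RHS](bfc_id sG); apply: (eq_bfc sG (@cont_id _ m M)) => t tI /=.
    by rewrite lnK // posrE (itv_gt0 m0 tI).
  apply: cont_pt => t tI; apply: continuous_comp; last exact: continuous_expR.
  by apply: continuous_ln; exact: itv_gt0 tI.
have lnpow (a b r : R) (T : bop H) : 0 < a -> spec a b T -> bfc (@ln R) (bpow r T) = r *: bfc (@ln R) T.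
  move=> a0 sT; rewrite (bfc_comp_pos a0 sT (pos_cont_pow r)); last exact: continuous_ln.
  rewrite -(bfcZ sT _ (cont_ln a0)); apply: (eq_bfc sT (contZ (cont_ln a0))) => t tI /=.
  by rewrite ln_powR.
have lnX : bfc (@ln R) X = p *: Z.
  by rewrite /Z (lnpow _ _ _ _ mp0 sX) scalerA mulfV ?scale1r // gt_eqF.
pose k := p^-1 * ln (Specht (h `^ p)).
have ek : expR k = Specht (h `^ p) `^ p^-1 by rewrite powRE.
have sC j : spec (m `^ p) (M `^ p) (bpow p (A j)) by exact: spec_bpow (ltW p0) (sA j).
have sB j : spec (M `^ (- p)) (m `^ (- p)) (bpow (- p) (A j)).
  exact: spec_bpowN (ltW p0) (sA j).
have lnC (r : R) : wsum w (fun j => bfc (@ln R) (bpow r (A j))) = r *: L.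
  rewrite /L /wsum scaler_sumr; apply: eq_bigr => j _.
  by rewrite (lnpow _ _ _ _ m0 (sA j)) !scalerA mulrC.
have pk : ln (Specht (h `^ p)) = p * k by rewrite /k mulVKf // gt_eqF.
have ZL : ble Z (L + k *: (1 : bop H)).
  move=> x; have := ln_mono mp0 mp0 sX (spec_wsum w_prob sC) X1 x.
  move=> /le_trans/(_ (ln_reverse_jensen w_prob mp0 (powR_strict p0) sC x)).
  by rewrite powR_ratio lnX lnC pk !qfD !qfZ qf1 -mulrA -mulrDr ler_pM2l.
(* The logarithm turns the bound on X^-1 into one with all signs changed, hence the opposite
   inequality. *)
have LZ : ble L (Z + k *: (1 : bop H)).
  move=> x; have sX1 := spec_bpowN mp0 ler01 sX.
  have := ln_mono _ mn0 sX1 (spec_wsum w_prob sB) X2 x.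
  move=> /(_ (powR_gt0 _ (powR_gt0 _ M0))).
  move=> /le_trans/(_ (ln_reverse_jensen w_prob mn0 (powRN_strict p0) sB x)).
  rewrite powR_ratioN (lnpow _ _ _ _ mp0 sX) lnX lnC pk !qfD !qfZ qf1 -mulrA.
  rewrite !mulNr mul1r => hh.
  have : p * qf L x <= p * (qf Z x + k * ip x x) by lra.
  by rewrite ler_pM2l.
have expk (a b : R) (T : bop H) : spec a b T -> spec (a + k) (b + k) (T + k *: (1 : bop H)) /\
   bfc (@expR R) (T + k *: (1 : bop H)) = expR k *: bfc (@expR R) T.
  move=> sT; split.
    split=> [|x]; first by apply: saD (spec_sa sT) _; exact/saZ/sa1.
    by rewrite qfD qfZ qf1 !mulrDl !lerD2r; exact: sT.2.
  have -> : T + k *: (1 : bop H) = bfc (fun t => 1 * t + k) T.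
    by rewrite (bfc_affine _ _ sT) scale1r.
  rewrite (bfc_comp sT (c := a + k) (d := b + k) (@cont_affine _ a b 1 k) _ (@cont_exp _ _ _)).
  - rewrite -(bfcZ sT _ (@cont_exp _ _ _)).
    apply: (eq_bfc sT (contZ (@cont_exp _ _ _))) => t tI /=.
    by rewrite mul1r expRD mulrC.
  - by move=> t; rewrite !in_itv /= mul1r !lerD2r.
  apply: cont_pt => t tI; apply: continuous_comp; last exact: continuous_expR.
  by apply: cvgD; [apply: cvgM; [exact: cvg_cst|exact: cvg_id]|exact: cvg_cst].
have [sLk eLk] := expk _ _ _ sL; have [sZk eZk] := expk _ _ _ sZ.
have r1 := exp_reverse_monotone h1 sZ sLk ZL; rewrite eLk GZ ek scalerA in r1.
have r2 := exp_reverse_monotone h1 sL sZk LZ; rewrite eZk GZ ek scalerA in r2.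
split=> // x; move: (r1 x); rewrite !qfZ => rx.
by rewrite powRN -invfM ler_pdivrMl ?mulr_gt0 ?powR_gt0.
Qed.

End Core.

(** * Rank-one operators and the representing function of a mean *)

Section Bridge.
Context {R : realType} {H : hilbert R}.
Implicit Types (S T : bop H) (a b c : R) (x y : H) (A B : H -> H).

Definition psd T := sa T /\ forall x, 0 <= qf T x.

Lemma psd_opP T : psd_op T <-> psd T.
Proof. by rewrite /psd_op positiveP; split=> [[]//|?]; split=> //; exact: bfunP. Qed.

Lemma spec_inverse a b T : 0 < a -> spec a b T -> is_inverse T (bpow (- 1) T).
Proof.
move=> a0 sT; have Tr := bpowNr 1 a0 sT; have Tl := bpowNl 1 a0 sT.
rewrite (bpow1 a0 sT) in Tr Tl.
split; first exact: bfunP.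
  by apply/funext => x /=; rewrite -[LHS]mulE Tr.
by apply/funext => x /=; rewrite -[LHS]mulE Tl.
Qed.

Lemma spec_psd a b T : 0 <= a -> spec a b T -> psd T.
Proof.
move=> a0 [sT Tab]; split=> // x.
by have /andP[h _] := Tab x; apply: le_trans h; rewrite mulr_ge0 ?ip_ge0.
Qed.

Lemma spec_pd a b T : 0 < a -> spec a b T -> pd_op T.
Proof.
move=> a0 sT; split; first by apply/psd_opP; exact: spec_psd (ltW a0) sT.
by split; [exact: bfunP|exists (bpow (- 1) T); exact: spec_inverse sT].
Qed.

Lemma sa_upper T : sa T -> exists2 c, 0 <= c & forall x, qf T x <= c * ip x x.
Proof.
move=> sT; have [c c0 cP] := bop_nrm_bound T; exists c => // x.
apply: le_trans (ler_norm _) _; apply: le_trans (ip_nrm _ _) _.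
by rewrite -sqr_nrm expr2 mulrA ler_wpM2r ?nrm_ge0.
Qed.

(** If d bounds the inverse and c the form, then |x|^2 <= d^2 |T x|^2 <= d^2 c <T x, x>. The added 1
    avoids dividing by zero. *)
Lemma pd_spec T : pd_op T -> exists a b, 0 < a /\ spec a b T.
Proof.
move=> [/psd_opP[sT T0] [_ [B [bB TB BT]]]].
have [c c0 cP] := sa_upper sT; have [d d0 dP] := bop_nrm_bound (Bop bB).
pose e := (d ^+ 2 * c + 1)^-1.
have e0 : 0 < e by rewrite invr_gt0 ltr_wpDl // mulr_ge0 ?sqr_ge0.
exists e, c; split=> //; split=> // x; rewrite cP andbT.
have h1 : ip x x <= d ^+ 2 * ip (T x) (T x).
  have := dP (T x); rewrite /= -[B (T x)]/((B \o T) x) BT /= => h.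
  by rewrite -!sqr_nrm -exprMn ler_sqr ?nnegrE ?mulr_ge0 ?nrm_ge0.
have h2 := psd_nrm x sT T0 cP.
rewrite /e mulrC ler_pdivrMr ?ltr_wpDl // ?mulr_ge0 ?sqr_ge0 //.
apply: le_trans h1 _; have := ler_wpM2l (sqr_ge0 d) h2; have := T0 x; lra.
Qed.

Lemma is_inverse_uniq A B B' : is_inverse A B -> is_inverse A B' -> B = B'.
Proof.
move=> [_ AB BA] [_ AB' BA']; apply/funext => x.
by rewrite -[B x]/((B \o idfun) x) -AB' /= -[B (A _)]/((B \o A) _) BA.
Qed.

Lemma opinvE a b T : 0 < a -> spec a b T -> opinv T = bpow (- 1) T.
Proof.
move=> a0 sT; have h := spec_inverse a0 sT.
apply: (is_inverse_uniq (A := T) _ h).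
by have := @xgetPex _ 0 [set B : H -> H | is_inverse T B] (ex_intro _ _ h).
Qed.

Definition toB A : bop H :=
  match pselect (bounded_op A) with left p => Bop p | right _ => 0 end.

Lemma toBK A : bounded_op A -> toB A = A :> (H -> H).
Proof. by move=> bA; rewrite /toB; case: pselect. Qed.

Lemma bfun_inj S T : bfun S = bfun T -> S = T.
Proof. by move=> ST; apply: bopP => x; rewrite ST. Qed.

Lemma bfunM S T : bfun (S * T) = S \o T. Proof. by []. Qed.

Lemma bfun_sum n (w : 'I_n -> R) (B : 'I_n -> bop H) :
  \sum_j (w j)%:C *: (B j : H -> H) = wsum w B.
Proof. by apply/funext => x; rewrite fct_sumE /wsum bop_sumE. Qed.

End Bridge.

(** * Rank-one operators and operators with two eigenvalues *)

Section RankOne.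
Context {R : realType} {H : hilbert R}.
Implicit Types (S T : bop H) (a b c s t : R) (x y z : H).

Lemma rk_bounded x : bounded_op (fun y : H => '[y, x] *: x).
Proof.
split; first by move=> a y z; rewrite linearDl /= linearZl_LR scalerDl scalerA.
exists ((nrm x * 2 * nrm x)%:C) => y; rewrite normrZ !norm_nrm.
(* Real and imaginary parts each obey the real Cauchy-Schwarz inequality, whence the factor 2 in the
   bound. *)
have -> : '[y, x] = (ip y x)%:C + 'i%C * (ip (Complex 0 (-1) *: y) x)%:C.
  rewrite {1}[LHS]complexE; congr (_ + _ * _%:C).
  by rewrite /ip linearZl_LR /=; case: '[y, x] => u v /=; ring.
have b z : `|(ip z x)%:C| <= (nrm z * nrm x)%:C.
  rewrite normc_def /= expr0n addr0 sqrtr_sqr lecR; exact: ip_nrm.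
have iy : nrm (Complex 0 (-1) *: y) = nrm y.
  apply: complexI; rewrite -!norm_nrm normrZ.
  by rewrite normc_def /= expr0n sqrrN expr1n add0r sqrtr1 mul1r.
have ni : `|'i%C| = 1 :> R[i] by rewrite normc_def /= expr0n expr1n add0r sqrtr1.
apply: (@le_trans _ _ ((nrm y * nrm x + nrm y * nrm x)%:C * (nrm x)%:C)).
  rewrite ler_wpM2r ?(lecR 0) ?nrm_ge0 // (le_trans (ler_normD _ _)) //.
  rewrite rmorphD lerD ?b // normrM ni mul1r -iy; exact: b.
by rewrite -!rmorphM lecR le_eqVlt; apply/orP; left; apply/eqP; ring.
Qed.

(** This is [ip x x] times the orthogonal projection onto the line of x, left unnormalised so that
    no unit vector is needed. *)
Definition rk x : bop H := Bop (rk_bounded x).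

Lemma rkE x y : rk x y = '[y, x] *: x. Proof. by []. Qed.

Lemma Re_mulJ (z v : R[i]) : complex.Im v = 0 ->
  complex.Re (z * (Num.conj z * v)) = complex.Re (z * Num.conj z) * complex.Re v.
Proof. by case: z => a b; case: v => c d /= ->; ring. Qed.

Lemma sa_rk x : sa (rk x).
Proof.
move=> y z; rewrite !rkE /ip linearZl_LR linearZr_LR /= mulrC.
by congr (complex.Re (_ * _)); exact: inner_conj.
Qed.

Lemma qf_rkE x y : qf (rk x) y = complex.Re ('[y, x] * Num.conj '[y, x]).
Proof. by rewrite /qf rkE /ip linearZl_LR /= (inner_conj x y). Qed.

Lemma qf_rk_ge0 x y : 0 <= qf (rk x) y.
Proof.
by rewrite qf_rkE; case: '[y, x] => a b /=; rewrite mulrN opprK addr_ge0 // -expr2 sqr_ge0.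
Qed.

Lemma qf_rk_image T x y : sa T -> qf T (rk x y) = qf (rk x) y * qf T x.
Proof.
move=> sT; rewrite qf_rkE rkE /qf /ip bopZ linearZl_LR linearZr_LR /=.
exact/Re_mulJ/sa_Im.
Qed.

Lemma rk_sandwich T x : sa T -> rk x * T * rk x = qf T x *: rk x.
Proof.
move=> sT; apply: bopP => y; rewrite !mulE scaleE !rkE bopZ linearZl_LR /=.
have -> : '[T x, x] = (qf T x)%:C.
  by rewrite [LHS]complexE (sa_Im x sT) mulr0 addr0.
by rewrite scalerA mulrC.
Qed.

Lemma rk_sqr x : rk x * rk x = ip x x *: rk x.
Proof. by have := rk_sandwich x (@sa1 _ H); rewrite mulr1 qf1. Qed.

Lemma qf_rk_real x y : complex.Im '[y, x] = 0 -> qf (rk x) y = ip y x ^+ 2.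
Proof. by rewrite qf_rkE /ip; case: '[y, x] => a b /= ->; ring. Qed.

Lemma qf_rk_self x : qf (rk x) x = ip x x ^+ 2.
Proof. by apply: qf_rk_real; rewrite inner_ip. Qed.

(* As qf (rk x) y = |<y, x>|^2, this is the Cauchy-Schwarz inequality of the
   form of T. *)
Lemma rk_le_inv T T' x y : sa T -> (forall z, 0 <= qf T z) -> T * T' = 1 ->
  qf (rk x) y <= qf T' x * qf T y.
Proof.
move=> sT T0 TT.
have TK z : T (T' z) = z by rewrite -mulE TT.
have tE z : qf T (T' z) = qf T' z by rewrite /qf TK ipC.
have sT' : sa T' by move=> u v; rewrite -{2}(TK u) sT TK.
have := psd_CS (T' (rk x y)) y sT T0; rewrite TK tE -/(qf (rk x) y) qf_rk_image //.
have c0 := qf_rk_ge0 x y; rewrite expr2 -mulrA => h.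
have [->|cn] := eqVneq (qf (rk x) y) 0; first by rewrite mulr_ge0 // -tE.
by rewrite -(ler_pM2l (x := qf (rk x) y)) // lt_def cn.
Qed.

Lemma rk_le1 x : ble (rk x) (ip x x *: (1 : bop H)).
Proof.
move=> y; rewrite qfZ -qf1.
by apply: rk_le_inv; rewrite ?mulr1 // => z; rewrite qf1 ip_ge0.
Qed.

(** For unit x: eigenvalue s along x and t on the orthogonal complement, so the calculus acts on s
    and t alone. *)
Definition two_point x s t : bop H := s *: rk x + t *: ((1 : bop H) - rk x).

Lemma qf_two_point x s t y : qf (two_point x s t) y = s * qf (rk x) y + t * (ip y y - qf (rk x) y).
Proof. by rewrite qfD !qfZ qfB qf1. Qed.

Lemma sa_two_point x s t : sa (two_point x s t).
Proof.
by apply: saD; apply: saZ; [exact: sa_rk|apply: saB; [exact: sa1|exact: sa_rk]].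
Qed.

Lemma spec_two_point x s t : ip x x = 1 -> spec (Num.min s t) (Num.max s t) (two_point x s t).
Proof.
move=> x1; split=> [|y]; first exact: sa_two_point.
rewrite qf_two_point; have := rk_le1 x y; rewrite x1 scale1r qf1 => h; have c0 := qf_rk_ge0 x y.
set c := qf (rk x) y in h c0 *; set d := ip y y in h *.
have -> : Num.min s t * d = Num.min s t * c + Num.min s t * (d - c) by ring.
have -> : Num.max s t * d = Num.max s t * c + Num.max s t * (d - c) by ring.
have d0 : 0 <= d - c by rewrite subr_ge0.
by rewrite !lerD ?ler_wpM2r ?le_max ?ge_min ?lexx ?orbT.
Qed.

Lemma rk_proj x y : ip x x = 1 -> rk x (rk x y) = rk x y.
Proof. by move=> x1; rewrite -mulE rk_sqr x1 scale1r. Qed.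

Lemma two_point_eigen x s t y : ip x x = 1 -> two_point x s t (rk x y) = s%:C *: rk x y.
Proof.
move=> x1; rewrite /two_point addE !scaleE addE oppE oneE rk_proj //.
by rewrite subrr scaler0 addr0.
Qed.

Lemma two_point_eigen_compl x s t y : ip x x = 1 -> two_point x s t (y - rk x y) = t%:C *: (y - rk x y).
Proof.
move=> x1; rewrite /two_point addE !scaleE addE oppE oneE bopB rk_proj //.
by rewrite subrr scaler0 add0r subr0.
Qed.

Lemma bfc_two_point x s t f : ip x x = 1 -> cont (Num.min s t) (Num.max s t) f ->
  bfc f (two_point x s t) = two_point x (f s) (f t).
Proof.
move=> x1 cf; have sT := spec_two_point s t x1; apply: bopP => y.
rewrite -{1}(subrK (rk x y) y) bopD.
rewrite (bfc_eigen sT cf (t := t) _ (two_point_eigen_compl s t y x1)); last first.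
  by rewrite in_itv /= ge_min le_max lexx !orbT.
rewrite (bfc_eigen sT cf (t := s) _ (two_point_eigen s t y x1)); last first.
  by rewrite in_itv /= ge_min le_max lexx.
by rewrite /two_point addE !scaleE addE oppE oneE addrC.
Qed.

End RankOne.

(** * Forms on a plane spanned by two orthonormal vectors *)

Section TwoDim.
Context {R : realType} {H : hilbert R}.
Implicit Types (S T Z : bop H) (a b c s t l : R) (x y z : H).

Definition orthonormal2 (e1 e2 : H) := [/\ ip e1 e1 = 1, ip e2 e2 = 1 & '[e1, e2] = 0].

Variables (e1 e2 : H).
Hypothesis e12 : orthonormal2 e1 e2.

Definition lincomb (a b : R) : H := a%:C *: e1 + b%:C *: e2.

Lemma inner_lincomb a b c d : '[lincomb a b, lincomb c d] = (a * c + b * d)%:C.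
Proof.
have [i1 i2 i12] := e12; have i21 : '[e2, e1] = 0 by rewrite inner_conj i12 rmorph0.
rewrite /lincomb linearDl /= !linearDr /= !linearZl_LR !linearZr_LR /= !inner_ip i1 i2 i12 i21.
have conjr (r : R) (z : R[i]) : Num.conj r%:C * z = r%:C * z.
  by congr (_ * z); apply/eqP; rewrite eq_complex /= oppr0 !eqxx.
by rewrite -![_ *: _]/(_ * _) !conjr !mulr0 addr0 add0r rmorphD !rmorphM /= !mulr1 ![c%:C * _]mulrC ![d%:C * _]mulrC.
Qed.

Lemma ip_lincomb a b c d : ip (lincomb a b) (lincomb c d) = a * c + b * d.
Proof. by rewrite /ip inner_lincomb. Qed.

Lemma qf_rk_lincomb a b c d : qf (rk (lincomb a b)) (lincomb c d) = (a * c + b * d) ^+ 2.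
Proof. by rewrite qf_rk_real ?inner_lincomb // ip_lincomb; ring. Qed.

Lemma qf_eigen_lincomb Z f1 f2 a b : Z e1 = f1%:C *: e1 -> Z e2 = f2%:C *: e2 ->
  qf Z (lincomb a b) = a ^+ 2 * f1 + b ^+ 2 * f2.
Proof.
move=> z1 z2; rewrite /qf; have -> : Z (lincomb a b) = lincomb (a * f1) (b * f2).
  by rewrite /lincomb bopD !bopZ z1 z2 !scalerA !rmorphM.
by rewrite ip_lincomb; ring.
Qed.

Lemma sqr_sqrt1 l : 0 <= l <= 1 -> Num.sqrt l ^+ 2 = l /\ Num.sqrt (1 - l) ^+ 2 = 1 - l.
Proof. by move=> /andP[l0 l1]; rewrite !sqr_sqrtr ?subr_ge0. Qed.

(** Forms diagonal in [e1], [e2] take on it the convex combination of the eigenvalues with weights l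
    and 1 - l. *)
Definition mix_vector l : H := lincomb (Num.sqrt l) (Num.sqrt (1 - l)).

Lemma ip_mix_vector l : 0 <= l <= 1 -> ip (mix_vector l) (mix_vector l) = 1.
Proof. by move=> /sqr_sqrt1[h1 h2]; rewrite ip_lincomb -!expr2 h1 h2 subrKC. Qed.

Lemma qf_mix_vector l Z f1 f2 : 0 <= l <= 1 -> Z e1 = f1%:C *: e1 -> Z e2 = f2%:C *: e2 ->
  qf Z (mix_vector l) = l * f1 + (1 - l) * f2.
Proof. by move=> /sqr_sqrt1[h1 h2] z1 z2; rewrite (qf_eigen_lincomb _ _ z1 z2) h1 h2. Qed.

(** The hypothesis is tested at the preimage of the mix vector under [Z], of coordinates sqrt l / f1
    and sqrt (1 - l) / f2. With z the left side of the conclusion it reads g z^2 <= z. *)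
Lemma mix_vector_inverse_bound l Z f1 f2 g : 0 <= l <= 1 -> Z e1 = f1%:C *: e1 -> Z e2 = f2%:C *: e2 ->
  0 < f1 -> 0 < f2 -> 0 < g -> (forall y, g * qf (rk (mix_vector l)) y <= qf Z y) ->
  l / f1 + (1 - l) / f2 <= g^-1.
Proof.
move=> l01 z1 z2 f10 f20 g0 h; have [h1 h2] := sqr_sqrt1 l01.
have := h (lincomb (Num.sqrt l / f1) (Num.sqrt (1 - l) / f2)).
rewrite (qf_eigen_lincomb _ _ z1 z2) /mix_vector qf_rk_lincomb !mulrA -!expr2 !exprMn !exprVn h1 h2.
have -> : l / f1 ^+ 2 * f1 + (1 - l) / f2 ^+ 2 * f2 = l / f1 + (1 - l) / f2.
  by field; rewrite !gt_eqF.
set z := l / f1 + _.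
have : 0 <= z by case/andP: l01 => ? ?; rewrite addr_ge0 // divr_ge0 ?subr_ge0 // ltW.
rewrite le_eqVlt => /orP[/eqP <- _|z0]; first by rewrite invr_ge0 ltW.
rewrite -[X in _ <= X -> _]mul1r ler_pM2r // => k.
by rewrite -[leRHS]mul1r ler_pdivlMr // mulrC.
Qed.

Lemma two_point_e1 s t : two_point e1 s t e1 = s%:C *: e1.
Proof.
have [i1 _ _] := e12; have h : rk e1 e1 = e1 by rewrite rkE inner_ip i1 scale1r.
by have := two_point_eigen s t e1 i1; rewrite h.
Qed.

Lemma two_point_e2 s t : two_point e1 s t e2 = t%:C *: e2.
Proof.
have [i1 _ i12] := e12; have h : rk e1 e2 = 0 by rewrite rkE inner_conj i12 rmorph0 scale0r.
by have := two_point_eigen_compl s t e2 i1; rewrite h subr0.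
Qed.

End TwoDim.

Section Dichotomy.
Context {R : realType} {H : hilbert R}.

Lemma one_dim_or_orthonormal (x0 : H) : x0 != 0 ->
  (exists e1 e2 : H, orthonormal2 e1 e2) \/ (forall y : H, exists c : R[i], y = c *: x0).
Proof.
move=> x00; have i0 : 0 < ip x0 x0 by rewrite ip_gt0.
have [[y hy]|h] := pselect (exists y : H, forall c, y != c *: x0); last first.
  right=> y; apply/not_existsP => hy; apply: h; exists y => c; apply/eqP.
  exact: hy.
left; pose z := y - ('[y, x0] / '[x0, x0]) *: x0.
have z0 : z != 0 by rewrite subr_eq0.
have zx : '[x0, z] = 0.
  rewrite inner_conj /z linearBl /= linearZl_LR /= divfK ?subrr ?rmorph0 //.
  by rewrite inner_ip; apply: contraTneq i0 => /complexI ->; rewrite ltxx.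
have unit (u : H) : u != 0 -> ip ((nrm u)^-1%:C *: u) ((nrm u)^-1%:C *: u) = 1.
  move=> u0; rewrite ipZl ipZr -sqr_nrm mulrA -expr2 -exprMn mulVf ?expr1n //.
  by rewrite nrm_eq0.
exists ((nrm x0)^-1%:C *: x0), ((nrm z)^-1%:C *: z); split; try exact: unit.
by rewrite linearZl_LR linearZr_LR /= zx !mulr0.
Qed.

End Dichotomy.

(** The second inequality is concavity of the adjoint function at the points 1 / s and 1 / t. *)
Definition concave_pair {R : realType} (f : R -> R) := forall s t l : R,
  0 < s -> 0 < t -> 0 <= l <= 1 ->
  l * f s + (1 - l) * f t <= f (l * s + (1 - l) * t) /\
  l / f s + (1 - l) / f t <= (f (l / s + (1 - l) / t)^-1)^-1.

(** * Concavity of operator monotone functions by compression *)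

Section OperatorMonotoneConcave.
Context {R : realType} {K : hilbert R}.
Implicit Types (s t l : R) (x y : K).

Lemma mix_gt0 s t l : 0 < s -> 0 < t -> 0 <= l <= 1 -> 0 < l * s + (1 - l) * t.
Proof.
move=> s0 t0 /andP[]; rewrite le_eqVlt => /orP[/eqP <- _|l0 l1].
  by rewrite mul0r add0r subr0 mul1r.
by rewrite ltr_pwDl ?mulr_gt0 // mulr_ge0 ?subr_ge0 // ltW.
Qed.

(** The compressions only hold after an arbitrarily small dilation, upwards (r = 1) or downwards (r
    = -1); this removes it. *)
Lemma le_lim_dilate (F : R -> R) a u (r : R) : `|r| <= 1 -> {for a, continuous F} ->
  (forall d, 0 < d < 1 -> u <= F (a * (1 + r * d))) -> u <= F a.
Proof.
move=> r1 cF h; apply/ler_addgt0Pr => e e0.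
have /cvgrPdist_le/(_ _ e0)/nbhs_ballP[q /= q0 qP] := cF.
pose d := Num.min (1 / 2) (q / (2 * (`|a| + 1))).
have a1 : 0 < `|a| + 1 by rewrite ltr_wpDl.
have d0 : 0 < d by rewrite lt_min !divr_gt0 ?mulr_gt0.
have d1 : d < 1 by rewrite gt_min ltr_pdivrMr // mul1r ltr1n.
have /qP : ball a q (a * (1 + r * d)).
  rewrite /ball /= mulrDr mulr1 opprD addrA subrr sub0r normrN !normrM (gtr0_norm d0).
  have : d <= q / (2 * (`|a| + 1)) by rewrite ge_min lexx orbT.
  rewrite ler_pdivlMr ?mulr_gt0 // => h1.
  have h2 := mulr_ge0 (normr_ge0 a) (ltW d0).
  have : `|a| * (`|r| * d) <= `|a| * d by rewrite mulrCA ler_piMl.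
  nra.
have := h d; rewrite d0 d1 => /(_ isT) h1.
rewrite ler_norml => /andP[h2 h3]; lra.
Qed.

Variables (f : R -> R).
Hypothesis cf : forall t, 0 < t -> {for t, continuous f}.
Hypothesis f0 : forall t, 0 < t -> 0 < f t.
Hypothesis mf : forall (A B : bop K) a b, 0 < a -> spec a b A -> spec a b B -> ble A B ->
  ble (bfc f A) (bfc f B).

Let contf a b : 0 < a -> cont a b f.
Proof. by move=> a0; apply: cont_pt => t tI; apply: cf; exact: itv_gt0 tI. Qed.

Lemma bfc_two_point_pos x s t : ip x x = 1 -> 0 < s -> 0 < t ->
  bfc f (two_point x s t) = two_point x (f s) (f t).
Proof. by move=> x1 s0 t0; apply: bfc_two_point => //; apply: contf; rewrite lt_min s0. Qed.

Lemma common_spec a b c d (A B : bop K) : 0 < a -> 0 < c -> spec a b A -> spec c d B ->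
  exists a' b', [/\ 0 < a', spec a' b' A & spec a' b' B].
Proof.
move=> a0 c0 sA sB; exists (Num.min a c), (Num.max b d); split.
- by rewrite lt_min a0.
- by apply: spec_wide sA; rewrite ?ge_min ?le_max lexx ?orbT.
- by apply: spec_wide sB; rewrite ?ge_min ?le_max lexx ?orbT.
Qed.

(* With P the projection on x, splitting y = P y + (1 - P) y and AM-GM give
   B <= (1 + d) <B x, x> P + (1 + 1 / d) b (1 - P); apply f and let d -> 0. *)
Lemma compress_upper a b (B : bop K) x : 0 < a -> spec a b B -> ip x x = 1 ->
  qf (bfc f B) x <= f (qf B x).
Proof.
move=> a0 sB x1; have sB' := spec_sa sB.
have B0 y : 0 <= qf B y.
  by have /andP[h _] := sB.2 y; apply: le_trans h; rewrite mulr_ge0 ?ip_ge0 // ltW.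
have qx0 : 0 < qf B x by have /andP[h _] := sB.2 x; apply: lt_le_trans h; rewrite x1 mulr1.
have b0 : 0 < b.
  by have /andP[_ h] := sB.2 x; apply: lt_le_trans qx0 _; rewrite x1 mulr1 in h.
apply: (@le_lim_dilate _ _ _ 1); [by rewrite normr1|exact: cf|].
move=> d /andP[d0 d1]; rewrite mul1r.
have D0 : 0 < (1 + d^-1) * b by rewrite mulr_gt0 // addr_gt0 ?invr_gt0.
have p0 : 0 < qf B x * (1 + d) by rewrite mulr_gt0 // addr_gt0.
have BD : ble B (two_point x (qf B x * (1 + d)) ((1 + d^-1) * b)).
  move=> y; set u := rk x y; set v := y - u.
  have yE : y = u + v by rewrite /v subrKC.
  have e1 : qf B y = qf B u + 2 * ip (B u) v + qf B v.
    rewrite {1}yE; move: u v {yE} => u v.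
    by rewrite /qf bopD ipDl !ipDr (ipC (B v) u) -(sB' u v); ring.
  have e2 : 2 * ip (B u) v <= d * qf B u + d^-1 * qf B v.
    move: u v {yE e1} => u v.
    have := B0 (d%:C *: u - v); rewrite /qf bopB bopZ ipBl !ipBr !ipZl !ipZr.
    rewrite (ipC (B v) u) -(sB' u v) -/(qf B u) -/(qf B v) => h.
    have di : 0 <= d^-1 by rewrite invr_ge0 ltW.
    have := ler_wpM2l di h; rewrite mulr0.
    have -> : d^-1 * (d * (d * qf B u) - d * ip (B u) v - (d * ip (B u) v - qf B v)) =
      d * qf B u - 2 * ip (B u) v + d^-1 * qf B v by field; rewrite gt_eqF.
    lra.
  have e3 : qf B u = qf (rk x) y * qf B x by exact: qf_rk_image.
  have e4 : qf B v <= b * (ip y y - qf (rk x) y).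
    have /andP[_ h] := sB.2 v; apply: le_trans h _; rewrite ler_wpM2l ?(ltW b0) //.
    have uu : ip u u = qf (rk x) y.
      by have := qf_rk_image x y (@sa1 _ K); rewrite !qf1 x1 mulr1.
    have uy : ip u y = qf (rk x) y by [].
    by rewrite /v ipBl !ipBr [ip y u]ipC uu uy; lra.
  rewrite qf_two_point e1; have di : 0 <= 1 + d^-1 by rewrite addr_ge0 ?invr_ge0 ?(ltW d0).
  have e5 := ler_wpM2l di e4.
  rewrite e3 in e2 *; lra.
have s0 : 0 < Num.min (qf B x * (1 + d)) ((1 + d^-1) * b) by rewrite lt_min p0.
have [a' [b' [a'0 sBa sDa]]] := common_spec a0 s0 sB (spec_two_point (qf B x * (1 + d)) ((1 + d^-1) * b) x1).
have := mf a'0 sBa sDa BD x; rewrite bfc_two_point_pos // qf_two_point qf_rk_self x1 expr1n subrr mulr0 addr0.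
by rewrite mulr1.
Qed.

(* Cauchy-Schwarz gives B >= P / <B^-1 x, x>, hence
   B >= (1 - d) / <B^-1 x, x> P + d a (1 - P); apply f and let d -> 0. *)
Lemma compress_lower a b (B B' : bop K) x y : 0 < a -> spec a b B -> B * B' = 1 -> ip x x = 1 ->
  0 < qf B' x -> f (qf B' x)^-1 * qf (rk x) y <= qf (bfc f B) y.
Proof.
move=> a0 sB BB x1 q0; have sB' := spec_sa sB.
have B0 z : 0 <= qf B z.
  by have /andP[h _] := sB.2 z; apply: le_trans h; rewrite mulr_ge0 ?ip_ge0 // ltW.
have i0 : 0 < (qf B' x)^-1 by rewrite invr_gt0.
rewrite -lerN2; apply: (@le_lim_dilate (fun t => - (f t * qf (rk x) y)) _ _ (-1)).
- by rewrite normrN1.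
- by apply: cvgN; apply: cvgM; [exact: cf|exact: cvg_cst].
move=> d /andP[d0 d1]; rewrite mulN1r lerN2.
have p0 : 0 < (qf B' x)^-1 * (1 - d) by rewrite mulr_gt0 // subr_gt0.
have D0 : 0 < d * a by rewrite mulr_gt0.
have DB : ble (two_point x ((qf B' x)^-1 * (1 - d)) (d * a)) B.
  move=> z; rewrite qf_two_point.
  have h1 : (qf B' x)^-1 * qf (rk x) z <= qf B z.
    by rewrite ler_pdivrMl //; exact: rk_le_inv.
  have /andP[h2 _] := sB.2 z.
  have d1' : 0 <= 1 - d by rewrite subr_ge0 ltW.
  have h3 := ler_wpM2l d1' h1.
  have h4 := ler_wpM2l (ltW d0) h2.
  have h5 : 0 <= d * a * qf (rk x) z by rewrite mulr_ge0 ?qf_rk_ge0 // ltW.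
  lra.
have s0 : 0 < Num.min ((qf B' x)^-1 * (1 - d)) (d * a) by rewrite lt_min p0.
have [a' [b' [a'0 sBa sDa]]] := common_spec a0 s0 sB (spec_two_point ((qf B' x)^-1 * (1 - d)) (d * a) x1).
apply: le_trans (mf a'0 sDa sBa DB y); rewrite bfc_two_point_pos // qf_two_point lerDl.
rewrite mulr_ge0 ?(ltW (f0 _)) // subr_ge0; have := rk_le1 x y.
by rewrite x1 scale1r qf1.
Qed.

(** For B with eigenvalues s and t, the forms of B and B^-1 at the mix vector are l s + (1 - l) t
    and l / s + (1 - l) / t. The two compression bounds then give one inequality each. *)
Lemma opmon_concave_pair (e1 e2 : K) : orthonormal2 e1 e2 -> concave_pair f.
Proof.
move=> e12 s t l s0 t0 l01; have [i1 _ _] := e12.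
pose B := two_point e1 s t; have sB := spec_two_point s t i1.
have m0 : 0 < Num.min s t by rewrite lt_min s0.
have x1 := ip_mix_vector e12 l01.
have cB : cont (Num.min s t) (Num.max s t) f by exact: contf.
have ts : t \in `[Num.min s t, Num.max s t] by rewrite in_itv /= ge_min le_max lexx !orbT.
have ss : s \in `[Num.min s t, Num.max s t] by rewrite in_itv /= ge_min le_max lexx.
have z1 := bfc_eigen sB cB ss (two_point_e1 e12 s t).
have z2 := bfc_eigen sB cB ts (two_point_e2 e12 s t).
split.
  rewrite -(qf_mix_vector e12 l01 z1 z2) -(qf_mix_vector e12 l01 (two_point_e1 e12 s t) (two_point_e2 e12 s t)).
  exact: compress_upper m0 sB x1.
pose B' := bpow (- 1) B.
have BB : B * B' = 1 by have := bpowNr 1 m0 sB; rewrite (bpow1 m0 sB).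
have b1 : B' e1 = (s^-1)%:C *: e1.
  by rewrite /B' (bfc_eigen sB (cont_powR m0) ss (two_point_e1 e12 s t)) powR_inv1 // ltW.
have b2 : B' e2 = (t^-1)%:C *: e2.
  by rewrite /B' (bfc_eigen sB (cont_powR m0) ts (two_point_e2 e12 s t)) powR_inv1 // ltW.
have qE := qf_mix_vector e12 l01 b1 b2.
have q0 : 0 < qf B' (mix_vector e1 e2 l) by rewrite qE mix_gt0 // invr_gt0.
have := mix_vector_inverse_bound e12 l01 z1 z2 (f0 s0) (f0 t0) (f0 _) (fun y => compress_lower y m0 sB BB x1 q0).
by rewrite qE => ->//; rewrite invr_gt0 -qE.
Qed.

End OperatorMonotoneConcave.

(** * The representing function of an operator mean, from the axioms *)

Section Sigma.
Context {R : realType} {H : hilbert R}.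
Implicit Types (S T C X A Z : bop H) (a b c s t l : R) (x y : H).

Lemma psdZ c T : 0 <= c -> psd T -> psd (c *: T).
Proof. by move=> c0 [sT T0]; split=> [|x]; [exact: saZ|rewrite qfZ mulr_ge0]. Qed.
Lemma psd1 : psd (1 : bop H).
Proof. by split=> [|x]; [exact: sa1|rewrite qf1 ip_ge0]. Qed.
Lemma psd_rk x : psd (rk x).
Proof. by split=> [|y]; [exact: sa_rk|exact: qf_rk_ge0]. Qed.
Lemma psd_conj C T : psd C -> psd T -> psd (C * T * C).
Proof.
move=> [sC _] [sT T0]; split=> [x y|x]; last by rewrite qf_conj.
by rewrite !mulE sC sT sC.
Qed.
Hint Resolve psd1 psd_rk : core.

Variable sigma : (H -> H) -> (H -> H) -> H -> H.
Hypothesis sigma_mean : operator_mean sigma.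

Definition bsigma S T : bop H := toB (sigma S T).

Lemma bsigmaE S T : psd S -> psd T -> sigma S T = bsigma S T.
Proof.
move=> pS pT; rewrite toBK //.
by have [] := mean_psd sigma_mean ((psd_opP S).2 pS) ((psd_opP T).2 pT).
Qed.

Lemma psd_bsigma S T : psd S -> psd T -> psd (bsigma S T).
Proof.
move=> pS pT; apply/psd_opP; rewrite -bsigmaE //.
exact: (mean_psd sigma_mean ((psd_opP S).2 pS) ((psd_opP T).2 pT)).
Qed.

Lemma bsigma_mono S T S' T' : psd S -> psd T -> psd S' -> psd T' -> ble S S' -> ble T T' ->
  ble (bsigma S T) (bsigma S' T').
Proof.
move=> pS pT pS' pT' SS TT.
apply: (loewnerP (psd_bsigma pS pT).1 (psd_bsigma pS' pT').1).1.
rewrite -!bsigmaE //; apply: (mean_monotone sigma_mean); try exact/psd_opP.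
  exact: (loewnerP pS.1 pS'.1).2.
exact: (loewnerP pT.1 pT'.1).2.
Qed.

Lemma bsigma_trans C S T : psd C -> psd S -> psd T ->
  ble (C * bsigma S T * C) (bsigma (C * S * C) (C * T * C)).
Proof.
move=> pC pS pT.
apply: (loewnerP (psd_conj pC (psd_bsigma pS pT)).1 (psd_bsigma (psd_conj pC pS) (psd_conj pC pT)).1).1.
rewrite -bsigmaE; [|exact: psd_conj..].
rewrite !bfunM -bsigmaE //.
by apply: (mean_transformer sigma_mean); exact/psd_opP.
Qed.

Lemma scal_conj c T : 0 <= c -> (Num.sqrt c *: (1 : bop H)) * T * (Num.sqrt c *: (1 : bop H)) = c *: T.
Proof.
move=> c0; rewrite -bscaleAl mul1r -bscaleAr mulr1 scalerA -expr2 sqr_sqrtr //.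
Qed.

(** The transformer inequality for the scalar sqrt c is one half; the same for 1 / c is the
    other. *)
Lemma bsigmaZ c S T : 0 < c -> psd S -> psd T -> bsigma (c *: S) (c *: T) = c *: bsigma S T.
Proof.
move=> c0 pS pT.
have half d U V : 0 < d -> psd U -> psd V -> ble (d *: bsigma U V) (bsigma (d *: U) (d *: V)).
  move=> d0 pU pV; have pd : psd (Num.sqrt d *: (1 : bop H)) by apply: psdZ.
  by have := bsigma_trans pd pU pV; rewrite !scal_conj ?(ltW d0).
have pcS := psdZ (ltW c0) pS; have pcT := psdZ (ltW c0) pT.
have i0 : 0 < c^-1 by rewrite invr_gt0.
apply: ble_anti.
- exact: (psd_bsigma pcS pcT).1.
- exact/saZ/(psd_bsigma pS pT).1.
- move=> x; have := half _ _ _ i0 pcS pcT x.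
  by rewrite !scalerA mulVf ?gt_eqF // !scale1r !qfZ ler_pdivrMl.
- exact: half.
Qed.

Lemma bsigma11 : bsigma 1 1 = 1.
Proof. by apply: bfun_inj; rewrite -bsigmaE //; exact: mean_normalized. Qed.

Variable x0 : H.
Hypothesis x00 : x0 != 0.
Let i0 : 0 < ip x0 x0. Proof. by rewrite ip_gt0. Qed.

Definition rep t : R := qf (bsigma 1 (t *: (1 : bop H))) x0 / ip x0 x0.

(* The transformer inequality with C = <., x> x shows that
   |x|^4 (1 sigma t) - <(1 sigma t) x, x> C is positive; its form vanishes at x. *)
Lemma bsigma1_eigen t x : 0 < t -> exists c, bsigma 1 (t *: (1 : bop H)) x = c%:C *: x.
Proof.
move=> t0; have pt : psd (t *: (1 : bop H)) by apply: psdZ => //; exact: ltW.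
have [->|xn] := eqVneq x 0; first by exists 0; rewrite bop0 scaler0.
set T := bsigma 1 _; have pT : psd T by exact: psd_bsigma.
set N := ip x x; have N0 : 0 < N by rewrite ip_gt0.
have N2 : 0 < N ^+ 2 by rewrite exprn_gt0.
have pN c : 0 <= c -> psd (c *: (1 : bop H)) by move=> c0; apply: psdZ.
have pC c : 0 <= c -> psd (c *: rk x) by move=> c0; apply: psdZ.
have CN : ble (rk x) (N *: (1 : bop H)) by exact: rk_le1.
have h : ble (qf T x *: rk x) (N ^+ 2 *: T).
  rewrite -rk_sandwich; last exact: pT.1.
  apply: ble_trans (bsigma_trans (psd_rk x) psd1 pt) _.
  rewrite mulr1 -bscaleAr -bscaleAl mulr1 rk_sqr scalerA -/N mulrC -scalerA.
  have -> : N ^+ 2 *: T = bsigma (N ^+ 2 *: (1 : bop H)) (N ^+ 2 *: (t *: (1 : bop H))) by rewrite bsigmaZ.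
  apply: bsigma_mono.
  - exact/pC/ltW.
  - by apply: psdZ; [exact: ltW|apply: pC; exact: ltW].
  - exact/pN/ltW.
  - by apply: psdZ; [exact: ltW|exact: pt].
  - by move=> y; rewrite !qfZ expr2 -mulrA ler_pM2l // -qfZ; exact: CN.
  - move=> y; rewrite !qfZ expr2 -mulrA ler_pM2l // [leRHS]mulrCA.
    by rewrite ler_pM2l // -qfZ; exact: CN.
have /psd_qf0 : qf (N ^+ 2 *: T - qf T x *: rk x) x = 0.
  by rewrite qfB !qfZ qf_rk_self mulrC subrr.
move=> e; exists (qf T x / N).
have {e} : (N ^+ 2 *: T - qf T x *: rk x) x = 0.
  apply: psd_qf0.
  - apply: saB; apply: saZ; [exact: pT.1|exact: sa_rk].
  - by move=> y; rewrite qfB subr_ge0; exact: h.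
  by rewrite qfB !qfZ qf_rk_self mulrC subrr.
rewrite addE oppE !scaleE rkE inner_ip -/N => /eqP; rewrite subr_eq0 => /eqP e.
have : (N ^- 2)%:C *: ((N ^+ 2)%:C *: T x) = (N ^- 2)%:C *: ((qf T x)%:C *: (N%:C *: x)) by rewrite e.
rewrite !scalerA -!rmorphM mulVf ?gt_eqF // rmorph1 scale1r => ->.
by congr (_%:C *: _); field; rewrite gt_eqF.
Qed.

(** By [bsigma1_eigen] every vector is an eigenvector. Different eigenvalues at x0 and y would make
    them orthogonal, yet x0 + y is an eigenvector too. In particular [rep] does not depend on x0. *)
Lemma bsigma1E t : 0 < t -> bsigma 1 (t *: (1 : bop H)) = rep t *: (1 : bop H).
Proof.
move=> t0; have pt : psd (t *: (1 : bop H)) by apply: psdZ => //; exact: ltW.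
set T := bsigma 1 _; have pT : psd T by exact: psd_bsigma.
have qE x c : T x = c%:C *: x -> qf T x = c * ip x x by move=> e; rewrite /qf e ipZl.
have [c0 e0] := bsigma1_eigen x0 t0; rewrite -/T in e0.
have -> : rep t = c0 by rewrite /rep -/T (qE _ _ e0) mulfK // gt_eqF.
apply: bopP => y; rewrite scaleE oneE.
have [->|yn] := eqVneq y 0; first by rewrite bop0 scaler0.
have [c e] := bsigma1_eigen y t0; rewrite -/T in e.
rewrite e; have [->//|cc] := eqVneq c c0.
have orth : ip x0 y = 0.
  have := pT.1 x0 y; rewrite e0 e ipZl ipZr => /eqP; rewrite -subr_eq0 -mulrBl mulf_eq0.
  by rewrite subr_eq0 eq_sym (negPf cc) => /eqP.
have [d ed] := bsigma1_eigen (x0 + y) t0; rewrite -/T bopD e0 e in ed.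
have d0 : c0 = d.
  have : ip (c0%:C *: x0 + c%:C *: y) x0 = ip (d%:C *: (x0 + y)) x0 by rewrite ed.
  rewrite ipDl !ipZl ipDl (ipC y x0) orth mulr0 !addr0 => /eqP.
  by rewrite -subr_eq0 -mulrBl mulf_eq0 (gt_eqF i0) orbF subr_eq0 => /eqP.
have dc : c = d.
  have : ip (c0%:C *: x0 + c%:C *: y) y = ip (d%:C *: (x0 + y)) y by rewrite ed.
  rewrite ipDl !ipZl ipDl orth mulr0 !add0r => /eqP.
  by rewrite -subr_eq0 -mulrBl mulf_eq0 ip_eq0 (negPf yn) orbF subr_eq0 => /eqP.
by rewrite dc d0.
Qed.

Lemma rep1 : rep 1 = 1.
Proof. by rewrite /rep scale1r bsigma11 qf1 mulfV // gt_eqF. Qed.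

Lemma psdc c : 0 < c -> psd (c *: (1 : bop H)).
Proof. by move=> c0; apply: psdZ => //; exact: ltW. Qed.

Lemma rep_mono s t : 0 < s -> s <= t -> rep s <= rep t.
Proof.
move=> s0 st; have t0 := lt_le_trans s0 st.
rewrite ler_pM2r ?invr_gt0 //; apply: bsigma_mono => //; try exact: psdc.
by move=> x; rewrite !qfZ ler_wpM2r ?ip_ge0.
Qed.

Lemma rep_gt0 t : 0 < t -> 0 < rep t.
Proof.
move=> t0; have [t1|t1] := leP 1 t.
  by apply: lt_le_trans ltr01 _; rewrite -rep1; exact: rep_mono.
(* For t < 1 monotonicity gives 1 sigma t >= t sigma t = t. *)
apply: (lt_le_trans t0); rewrite ler_pdivlMr //.
have -> : t * ip x0 x0 = qf (bsigma (t *: (1 : bop H)) (t *: (1 : bop H))) x0 by rewrite bsigmaZ // bsigma11 qfZ.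
apply: bsigma_mono => //; try exact: psdc.
by move=> x; rewrite qfZ qf1 ler_piMl ?ip_ge0 // ltW.
Qed.

Lemma bsigma_scal a b : 0 < a -> 0 < b -> bsigma (a *: (1 : bop H)) (b *: (1 : bop H)) = (a * rep (b / a)) *: (1 : bop H).
Proof.
move=> a0 b0; have -> : b *: (1 : bop H) = a *: ((b / a) *: (1 : bop H)).
  by rewrite scalerA mulrCA mulfV ?mulr1 // gt_eqF.
by rewrite bsigmaZ ?bsigma1E ?scalerA ?divr_gt0 //; apply: psdc; rewrite divr_gt0.
Qed.

(* Compress by C = <., x> x, then use C <= |x|^2. *)
Lemma bsigma_upper X A x : psd X -> psd A -> 0 < qf X x -> 0 < qf A x ->
  qf (bsigma X A) x <= qf X x * rep (qf A x / qf X x).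
Proof.
move=> pX pA a0 b0; have xn : x != 0.
  by apply: contraTneq a0 => ->; rewrite /qf ip0r ltxx.
set N := ip x x; have N0 : 0 < N by rewrite ip_gt0.
have CN : ble (rk x) (N *: (1 : bop H)) by exact: rk_le1.
have pS := psd_bsigma pX pA.
have h : ble (qf (bsigma X A) x *: rk x) (bsigma ((qf X x * N) *: (1 : bop H)) ((qf A x * N) *: (1 : bop H))).
  rewrite -rk_sandwich; last exact: pS.1.
  apply: ble_trans (bsigma_trans (psd_rk x) pX pA) _.
  rewrite !rk_sandwich; [|exact: pA.1|exact: pX.1].
  apply: bsigma_mono; try (by apply: psdZ; rewrite ?mulr_ge0 // ltW).
  - by move=> y; rewrite -scalerA !(qfZ (qf X x)) ler_pM2l //; exact: CN.
  - by move=> y; rewrite -scalerA !(qfZ (qf A x)) ler_pM2l //; exact: CN.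
have := h x; rewrite bsigma_scal ?mulr_gt0 // !qfZ qf1 qf_rk_self -/N.
have -> : qf A x * N / (qf X x * N) = qf A x / qf X x by field; rewrite !gt_eqF.
have -> : qf X x * N * rep (qf A x / qf X x) * N = qf X x * rep (qf A x / qf X x) * N ^+ 2 by ring.
by rewrite ler_pM2r // exprn_gt0.
Qed.

(* X >= C / <X^-1 x, x> and A >= C / <A^-1 x, x> for C = <., x> x. *)
Lemma bsigma_lower X X' A A' x y : psd X -> psd A -> X * X' = 1 -> A * A' = 1 ->
  0 < qf X' x -> 0 < qf A' x ->
  (qf X' x)^-1 * rep (qf X' x / qf A' x) * qf (rk x) y <= qf (bsigma X A) y.
Proof.
move=> pX pA XX AA a0 b0; have xn : x != 0.
  by apply: contraTneq a0 => ->; rewrite /qf ip0r ltxx.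
set N := ip x x; have N0 : 0 < N by rewrite ip_gt0.
set t := qf X' x / qf A' x; have t0 : 0 < t by rewrite divr_gt0.
have pr c : 0 < c -> psd (c *: rk x) by move=> c0; apply: psdZ => //; exact: ltW.
have h1 : ble (rep t *: rk x) (bsigma (rk x) (t *: rk x)).
  move=> z; have := bsigma_trans (psd_rk x) psd1 (psdc t0) z.
  rewrite bsigma1E // -!bscaleAr -!bscaleAl !mulr1 rk_sqr.
  have -> : t *: (ip x x *: rk x) = N *: (t *: rk x) by rewrite !scalerA mulrC.
  have -> : rep t *: (ip x x *: rk x) = N *: (rep t *: rk x) by rewrite !scalerA mulrC.
  by rewrite bsigmaZ ?qfZ ?ler_pM2l //; exact: pr.
have ia : 0 < (qf X' x)^-1 by rewrite invr_gt0.
have h2 : ble ((qf X' x)^-1 *: bsigma (rk x) (t *: rk x)) (bsigma X A).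
  rewrite -bsigmaZ //; last exact: pr.
  have it : (qf X' x)^-1 * t = (qf A' x)^-1 by rewrite /t mulrA mulVf ?mul1r // gt_eqF.
  apply: bsigma_mono => //; try exact: pr.
  - by rewrite scalerA it; apply: pr; rewrite invr_gt0.
  - by move=> z; rewrite qfZ ler_pdivrMl //; apply: rk_le_inv XX; [exact: pX.1|exact: pX.2].
  - move=> z; rewrite scalerA it qfZ ler_pdivrMl //.
    by apply: rk_le_inv AA; [exact: pA.1|exact: pA.2].
apply: le_trans (h2 y); rewrite qfZ -mulrA ler_pM2l // -qfZ; exact: h1.
Qed.

(** [bsigma_lower] at y = Z' x: its right side becomes <Z' x, x> and its left side a multiple of <Z'
    x, x>^2, so one factor cancels. *)
Lemma bsigma_lower_inv X X' A A' Z' x : psd X -> psd A -> X * X' = 1 -> A * A' = 1 ->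
  bsigma X A * Z' = 1 -> 0 < qf X' x -> 0 < qf A' x ->
  qf Z' x <= qf X' x * (rep (qf A' x / qf X' x)^-1)^-1.
Proof.
move=> pX pA XX AA ZZ a0 b0; have pZ := psd_bsigma pX pA.
have ZK z : bsigma X A (Z' z) = z by rewrite -mulE ZZ.
have qz : qf (bsigma X A) (Z' x) = qf Z' x by rewrite /qf ZK ipC.
have z0 : 0 <= qf Z' x by rewrite -qz pZ.2.
have im : complex.Im '[Z' x, x] = 0.
  by rewrite -{2}(ZK x) inner_conj; have := sa_Im (Z' x) pZ.1; case: '[_, _] => u v /= ->; rewrite oppr0.
have -> : (qf A' x / qf X' x)^-1 = qf X' x / qf A' x by rewrite invf_div.
have := bsigma_lower (Z' x) pX pA XX AA a0 b0.
rewrite qz qf_rk_real // -/(qf Z' x).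
set r := rep _; have r0 : 0 < r by rewrite rep_gt0 // divr_gt0.
move: z0; rewrite le_eqVlt => /orP[/eqP <- _|z0].
  by rewrite mulr_ge0 ?invr_ge0 // ltW.
rewrite expr2 mulrA -{3}[qf Z' x]mul1r ler_pM2r // => h.
rewrite ler_pdivlMr // mulrC -[leRHS]mulr1.
by rewrite -ler_pdivrMl // mulrA.
Qed.

(** The test operators are those of [opmon_concave_pair], but 1 sigma B is not yet known to be a
    function of B. At an eigenvector of B the upper and lower compression bounds meet, which makes
    it an eigenvector of 1 sigma B with eigenvalue given by [rep]. *)
Lemma rep_concave_pair2 e1 e2 : @orthonormal2 R H e1 e2 -> concave_pair rep.
Proof.
move=> e12 s t l s0 t0 l01; have [i1 i2 _] := e12.
pose B := two_point e1 s t; have sB := spec_two_point s t i1.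
have m0 : 0 < Num.min s t by rewrite lt_min s0.
have pB : psd B by exact: spec_psd (ltW m0) sB.
pose B' := bpow (- 1) B.
have BB : B * B' = 1 by have := bpowNr 1 m0 sB; rewrite (bpow1 m0 sB).
have ts : t \in `[Num.min s t, Num.max s t] by rewrite in_itv /= ge_min le_max lexx !orbT.
have ss : s \in `[Num.min s t, Num.max s t] by rewrite in_itv /= ge_min le_max lexx.
have b1 : B' e1 = (s^-1)%:C *: e1.
  by rewrite /B' (bfc_eigen sB (cont_powR m0) ss (two_point_e1 e12 s t)) powR_inv1 // ltW.
have b2 : B' e2 = (t^-1)%:C *: e2.
  by rewrite /B' (bfc_eigen sB (cont_powR m0) ts (two_point_e2 e12 s t)) powR_inv1 // ltW.
have x1 := ip_mix_vector e12 l01.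
have qB := qf_mix_vector e12 l01 (two_point_e1 e12 s t) (two_point_e2 e12 s t).
have qB' := qf_mix_vector e12 l01 b1 b2.
have q0 : 0 < qf B (mix_vector e1 e2 l) by rewrite qB mix_gt0.
have q0' : 0 < qf B' (mix_vector e1 e2 l) by rewrite qB' mix_gt0 // invr_gt0.
pose Z := bsigma 1 B; have pZ : psd Z by exact: psd_bsigma.
have up x : ip x x = 1 -> 0 < qf B x -> qf Z x <= rep (qf B x).
  by move=> xx bx; have := bsigma_upper psd1 pB _ bx; rewrite qf1 xx divr1 mul1r; exact.
have lo x y : ip x x = 1 -> 0 < qf B' x -> rep (qf B' x)^-1 * qf (rk x) y <= qf Z y.
  move=> xx bx; have := bsigma_lower y psd1 pB (mulr1 _) BB _ bx.
  by rewrite qf1 xx invr1 div1r mul1r; apply.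
have eig e r : ip e e = 1 -> 0 < r -> B e = r%:C *: e -> B' e = (r^-1)%:C *: e ->
    Z e = (rep r)%:C *: e.
  move=> ee r0 Be Be'.
  have qe : qf B e = r by rewrite /qf Be ipZl ee mulr1.
  have qe' : qf B' e = r^-1 by rewrite /qf Be' ipZl ee mulr1.
  have u1 : qf Z e <= rep r by rewrite -qe up // qe.
  have l1 y : rep r * qf (rk e) y <= qf Z y.
    by have := lo e y ee; rewrite qe' invr_gt0 invrK => /(_ r0).
  have l2 := l1 e; rewrite qf_rk_self ee expr1n mulr1 in l2.
  have : (Z - rep r *: rk e) e = 0.
    apply: psd_qf0; first by apply: saB; [exact: pZ.1|apply: saZ; exact: sa_rk].
      by move=> y; rewrite qfB qfZ subr_ge0.
    rewrite qfB qfZ qf_rk_self ee expr1n mulr1; apply/eqP; rewrite subr_eq0.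
    by rewrite eq_le u1.
  by rewrite addE oppE scaleE rkE inner_ip ee scale1r => /eqP; rewrite subr_eq0 => /eqP.
have z1 := eig e1 s i1 s0 (two_point_e1 e12 s t) b1.
have z2 := eig e2 t i2 t0 (two_point_e2 e12 s t) b2.
split; first by rewrite -(qf_mix_vector e12 l01 z1 z2) -qB up.
have := mix_vector_inverse_bound e12 l01 z1 z2 (rep_gt0 s0) (rep_gt0 t0) (rep_gt0 _)
  (fun y => lo _ y x1 q0').
by rewrite qB' => -> //; rewrite invr_gt0 -qB'.
Qed.

(* On a one-dimensional H the axioms of sigma see only scalars; concavity comes
   from the operator monotonicity of f on a larger space. *)
Lemma rep_concave_pair1 (K : hilbert R) (e1 e2 : K) : orthonormal2 e1 e2 ->
  (forall y : H, exists c : R[i], y = c *: x0) -> concave_pair rep.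
Proof.
move=> e12 dim1.
have [f [[cf mf] f0 f1 fE]] : exists f : R -> R,
      [/\ operator_monotone f, forall t, 0 < t -> 0 <= f t, f 1 = 1 &
          forall A B : H -> H, pd_op A -> pd_op B ->
            sigma A B =
            op_pow A (2^-1)
              \o fcalc f (op_pow A (- 2^-1) \o B \o op_pow A (- 2^-1))
              \o op_pow A (2^-1)].
  apply: (mean_representation sigma_mean); exists 1%N, (fun=> x0) => y.
  by have [c ->] := dim1 y; exists (fun=> c); rewrite big_ord1.
have cf' t : 0 < t -> {for t, continuous f}.
  by move=> t0; apply: cf; rewrite in_itv /= t0.
have specc c : spec c c (c *: (1 : bop H)).
  by split=> [|x]; [exact/saZ/sa1|rewrite qfZ lexx].
have calc1 g c : cont c c g -> bfc g (c *: (1 : bop H)) = g c *: (1 : bop H).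
  move=> cg; apply: bopP => y; rewrite (bfc_eigen (specc c) cg (t := c)) //.
  by rewrite in_itv /= lexx.
have rE t : 0 < t -> rep t = f t.
  move=> t0; have s1 := specc 1; rewrite scale1r in s1.
  have pw r : op_pow (1 : bop H) r = (1 : bop H).
    have c1 : cont 1 1 (fun t : R => t `^ r) by exact: cont_powR.
    rewrite /op_pow (fcalcE s1 c1); congr bfun.
    by have := calc1 _ _ c1; rewrite scale1r powR1 scale1r.
  have := fE _ _ (spec_pd ltr01 s1) (spec_pd t0 (specc t)).
  rewrite !pw (bsigmaE psd1 (psdc t0)) => e.
  have ct : cont t t f by apply: cont_pt => u uI; apply: cf'; exact: itv_gt0 uI.
  have e2' : fcalc f ((1 : bop H) \o (t *: (1 : bop H)) \o (1 : bop H)) = bfc f (t *: (1 : bop H)).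
    by rewrite -(fcalcE (specc t) ct).
  rewrite e2' calc1 // in e.
  have : bsigma 1 (t *: (1 : bop H)) x0 = (f t)%:C *: x0 by rewrite e.
  by rewrite /rep /qf => ->; rewrite ipZl mulfK // gt_eqF.
have mon (A B : bop K) a b : 0 < a -> spec a b A -> spec a b B -> ble A B ->
    ble (bfc f A) (bfc f B).
  move=> a0 sA sB AB.
  have ca : cont a b f by apply: cont_pt => u uI; apply: cf'; exact: itv_gt0 uI.
  apply: (loewnerP (bfc_sa sA ca) (bfc_sa sB ca)).1.
  rewrite -(fcalcE sA ca) -(fcalcE sB ca).
  apply: mf; [exact: spec_pd sA|exact: spec_pd sB|].
  exact: (loewnerP (spec_sa sA) (spec_sa sB)).2.
have fp t : 0 < t -> 0 < f t by move=> t0; rewrite -rE // rep_gt0.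
have cp := opmon_concave_pair cf' fp mon e12.
move=> s t l s0 t0 l01; have := cp s t l s0 t0 l01.
rewrite !rE //; first by rewrite invr_gt0 mix_gt0 // invr_gt0.
exact: mix_gt0.
Qed.

End Sigma.

(** * The Euclidean plane C^2 *)

Section C2.
Context (R : realType).

(* The library equips products with the maximum norm; this copy of C x C carries
   the Euclidean one. *)
Definition C2 : Type := (R[i] * R[i])%type.
HB.instance Definition _ := Choice.on C2.
HB.instance Definition _ := GRing.Lmodule.copy C2 (R[i]^o * R[i]^o)%type.

Definition sqn (x : C2) : R :=
  complex.Re x.1 ^+ 2 + complex.Im x.1 ^+ 2 + complex.Re x.2 ^+ 2 + complex.Im x.2 ^+ 2.

Lemma sqn_ge0 x : 0 <= sqn x.
Proof. by rewrite !addr_ge0 ?sqr_ge0. Qed.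

Definition norm2 (x : C2) : R[i] := (Num.sqrt (sqn x))%:C.

Lemma norm2D (x y : C2) : norm2 (x + y) <= norm2 x + norm2 y.
Proof.
rewrite /norm2 -rmorphD lecR; set u := Num.sqrt (sqn x); set v := Num.sqrt (sqn y).
have u0 : 0 <= u by exact: sqrtr_ge0.
have v0 : 0 <= v by exact: sqrtr_ge0.
have -> : u + v = Num.sqrt ((u + v) ^+ 2) by rewrite sqrtr_sqr ger0_norm ?addr_ge0.
rewrite ler_sqrt ?sqr_ge0 // sqrrD !sqr_sqrtr ?sqn_ge0 //.
pose d := (sqn (x + y) - sqn x - sqn y) / 2.
have h : d <= u * v.
  apply: le_trans (ler_norm _) _; rewrite -ler_sqr ?nnegrE ?mulr_ge0 //.
  rewrite real_normK ?num_real // [leRHS]exprMn !sqr_sqrtr ?sqn_ge0 // -subr_ge0 /d /sqn.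
  case: x {u u0 d} => [[a1 a2] [a3 a4]]; case: y {v v0} => [[b1 b2] [b3 b4]] /=.
  (* Lagrange's identity: the defect in Cauchy-Schwarz is a sum of six squares. *)
  set q := (X in 0 <= X).
  have -> : q = (a1 * b2 - a2 * b1) ^+ 2 + (a1 * b3 - a3 * b1) ^+ 2 + (a1 * b4 - a4 * b1) ^+ 2
     + (a2 * b3 - a3 * b2) ^+ 2 + (a2 * b4 - a4 * b2) ^+ 2 + (a3 * b4 - a4 * b3) ^+ 2.
    by rewrite /q; field.
  by rewrite !addr_ge0 ?sqr_ge0.
by move: h; rewrite /d -mulr_natl => h; lra.
Qed.

Lemma norm2Z (l : R[i]) (x : C2) : norm2 (l *: x) = `|l| * norm2 x.
Proof.
rewrite normc_def /norm2 -rmorphM -sqrtrM ?addr_ge0 ?sqr_ge0 //.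
congr (Num.sqrt _)%:C; rewrite /sqn.
by case: l => u v; case: x => [[a1 a2] [a3 a4]] /=; ring.
Qed.

Lemma norm2_eq0 (x : C2) : norm2 x = 0 -> x = 0.
Proof.
move=> /complexI/eqP; rewrite sqrtr_eq0 => h.
have {h} : sqn x = 0 by apply/eqP; rewrite eq_le h sqn_ge0.
case: x => [[a1 a2] [a3 a4]]; rewrite /sqn /= => h.
have s1 := sqr_ge0 a1; have s2 := sqr_ge0 a2; have s3 := sqr_ge0 a3; have s4 := sqr_ge0 a4.
have z (a : R) : a ^+ 2 <= 0 -> a = 0.
  by move=> k; apply/eqP; rewrite -sqrf_eq0 eq_le k sqr_ge0.
have -> : a1 = 0 by apply: z; lra.
have -> : a2 = 0 by apply: z; lra.
have -> : a3 = 0 by apply: z; lra.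
have -> : a4 = 0 by apply: z; lra.
reflexivity.
Qed.

HB.instance Definition _ := Lmodule_isNormed.Build R[i] C2 norm2D norm2Z norm2_eq0.

Lemma norm2E (x : C2) : `|x| = norm2 x. Proof. by []. Qed.

Definition is_coord (p : C2 -> R) :=
  [\/ p = (fun x => complex.Re x.1), p = (fun x => complex.Im x.1),
      p = (fun x => complex.Re x.2) | p = (fun x => complex.Im x.2)].

Lemma coord_le (x y : C2) (p : C2 -> R) : is_coord p ->
  `|p x - p y|%:C <= `|x - y|.
Proof.
move=> hp; rewrite norm2E /norm2 lecR -sqrtr_sqr ler_sqrt ?sqr_ge0 ?sqn_ge0 //.
move: x y => [[a1 a2] [a3 a4]] [[b1 b2] [b3 b4]]; rewrite /sqn /=.
have s1 := sqr_ge0 (a1 - b1); have s2 := sqr_ge0 (a2 - b2).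
have s3 := sqr_ge0 (a3 - b3); have s4 := sqr_ge0 (a4 - b4).
by case: hp => [->|->|->|->] /=; lra.
Qed.

Lemma coord_cvg (F : set_system C2) (FF : ProperFilter F) p :
  is_coord p ->
  cauchy F -> exists l : R, p @ F --> l.
Proof.
move=> hp /cauchy_ballP cF.
suff /R_complete cp : cauchy (p @ F) by exists (lim (p @ F)).
apply/cauchy_ballP => e e0.
have e0' : 0 < e%:C :> R[i] by rewrite (ltcR 0).
have [[P Q] /= [FP FQ] PQ] := cF _ e0'.
exists ([set p x | x in P], [set p x | x in Q]) => /=.
  by split; [apply: filterS FP|apply: filterS FQ] => x ?; exists x.
move=> [u v] /= [[x Px <-] [y Qy <-]].
have := PQ (x, y) (conj Px Qy); rewrite /= -ball_normE /= => h.
by rewrite /ball /= -ltcR; apply: le_lt_trans h; exact: coord_le.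
Qed.

Lemma C2_complete (F : set_system C2) : ProperFilter F -> cauchy F -> cvg F.
Proof.
move=> FF cF.
have [l1 h1] := coord_cvg FF (Or41 _ _ _ erefl) cF.
have [l2 h2] := coord_cvg FF (Or42 _ _ _ erefl) cF.
have [l3 h3] := coord_cvg FF (Or43 _ _ _ erefl) cF.
have [l4 h4] := coord_cvg FF (Or44 _ _ _ erefl) cF.
apply/cvg_ex; exists ((l1 +i* l2, l3 +i* l4) : C2).
apply/cvgrPdist_le => -[e ?]; rewrite ltcE /= => /andP[/eqP -> e0].
(* Four coordinates, each off by at most e / 2, have squares summing to at most e^2. *)
have e4 : 0 < e / 2 by rewrite divr_gt0.
move/cvgrPdist_le: h1 => /(_ _ e4) h1; move/cvgrPdist_le: h2 => /(_ _ e4) h2.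
move/cvgrPdist_le: h3 => /(_ _ e4) h3; move/cvgrPdist_le: h4 => /(_ _ e4) h4.
have key (x : C2) : `|l1 - complex.Re x.1| <= e / 2 -> `|l2 - complex.Im x.1| <= e / 2 ->
    `|l3 - complex.Re x.2| <= e / 2 -> `|l4 - complex.Im x.2| <= e / 2 ->
    `|((l1 +i* l2, l3 +i* l4) : C2) - x| <= e%:C.
  have sq (a : R) : `|a| <= e / 2 -> a ^+ 2 <= e ^+ 2 / 4.
    rewrite -ler_sqr ?nnegrE ?(ltW e4) // real_normK ?num_real //.
    by have -> : (e / 2) ^+ 2 = e ^+ 2 / 4 by field.
  move=> /sq k1 /sq k2 /sq k3 /sq k4.
  rewrite norm2E /norm2 lecR -[leRHS](gtr0_norm e0) -sqrtr_sqr ler_sqrt ?sqr_ge0 //.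
  by case: x k1 k2 k3 k4 => [[a1 a2] [a3 a4]] /=; rewrite /sqn /=; lra.
near=> x; apply: key; near: x; assumption.
Unshelve. all: by end_near.
Qed.

HB.instance Definition _ := Uniform_isComplete.Build C2 C2_complete.

Definition inner2 (x y : C2) : R[i] := x.1 * Num.conj y.1 + x.2 * Num.conj y.2.

Lemma inner2_bilinear : bilinear_for *%R (Num.conj \; *%R) inner2.
Proof.
have h1 (a p q r s u v : R[i]) :
  (a * p + q) * u + (a * r + s) * v = a * (p * u + r * v) + (q * u + s * v) by ring.
have h2 (a p q u v z t : R[i]) : p * Num.conj (a * u + v) + q * Num.conj (a * z + t) =
    Num.conj a * (p * Num.conj u + q * Num.conj z) + (p * Num.conj v + q * Num.conj t).
  by rewrite !rmorphD !rmorphM; ring.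
by split=> [y a x z|x a y z] /=; [exact: h1|exact: h2].
Qed.

HB.instance Definition _ := bilinear_isBilinear.Build R[i] C2 C2 R[i] *%R (Num.conj \; *%R)
  inner2 inner2_bilinear.

Lemma inner2_hermitian (x y : C2) : inner2 x y = (-1) ^+ false * Num.conj (inner2 y x).
Proof.
have h (p q r s : R[i]) : p * Num.conj r + q * Num.conj s =
    (-1) ^+ false * Num.conj (r * Num.conj p + s * Num.conj q).
  rewrite expr0 mul1r; move: p q r s => [p1 p2] [q1 q2] [r1 r2] [s1 s2].
  by apply/eqP; rewrite eq_complex /=; apply/andP; split; apply/eqP; ring.
exact: h.
Qed.

HB.instance Definition _ := isHermitianSesquilinear.Build R[i] C2 false Num.conj inner2 inner2_hermitian.

Lemma inner2_sqn (x : C2) : inner2 x x = (sqn x)%:C.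
Proof.
case: x => [[a1 a2] [a3 a4]]; apply/eqP; rewrite eq_complex /sqn /=.
by apply/andP; split; apply/eqP; ring.
Qed.

Lemma inner2_gt0 (x : C2) : x != 0 -> 0 < inner2 x x.
Proof.
move=> x0; rewrite inner2_sqn (ltcR 0) lt_def sqn_ge0 andbT.
apply: contra_neq x0 => h; apply: norm2_eq0.
by rewrite /norm2 h sqrtr0.
Qed.

HB.instance Definition _ := isDotProduct.Build R[i] C2 inner2 inner2_gt0.

Lemma inner2_norm (x : C2) : `|x| ^+ 2 = inner2 x x.
Proof. by rewrite norm2E /norm2 -rmorphXn /= sqr_sqrtr ?sqn_ge0 // inner2_sqn. Qed.

Definition C2_hilbert : hilbert R := @Hilbert R C2 inner2 inner2_norm.

Lemma C2_orthonormal : exists e1 e2 : C2_hilbert, orthonormal2 e1 e2.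
Proof.
exists ((1 +i* 0, 0 +i* 0) : C2), ((0 +i* 0, 1 +i* 0) : C2).
split; rewrite /ip /= /inner2 /=; [ring|ring|].
by apply/eqP; rewrite eq_complex /=; apply/andP; split; apply/eqP; ring.
Qed.

End C2.

(** * Deformed means *)

Section Supergradient.
Context {R : realType}.
Implicit Types (g f : R -> R) (s t l : R).

Definition concave_pos g := forall s t l, 0 < s -> 0 < t -> 0 <= l <= 1 ->
  l * g s + (1 - l) * g t <= g (l * s + (1 - l) * t).

Lemma concave_slopes g s t : concave_pos g -> 0 < s -> s < 1 -> 1 < t ->
  (g t - g 1) / (t - 1) <= (g 1 - g s) / (1 - s).
Proof.
move=> cg s0 s1 t1; have ts : 0 < t - s by lra.
have l01 : 0 <= (t - 1) / (t - s) <= 1.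
  by rewrite divr_ge0 ?ler_pdivrMr //; lra.
have t0 : 0 < t by lra.
have := cg s t _ s0 t0 l01.
have -> : (t - 1) / (t - s) * s + (1 - (t - 1) / (t - s)) * t = 1 by field; rewrite gt_eqF.
have -> : (t - 1) / (t - s) * g s + (1 - (t - 1) / (t - s)) * g t =
  ((t - 1) * g s + (1 - s) * g t) / (t - s) by field; rewrite gt_eqF.
rewrite ler_pdivrMr // => h.
rewrite ler_pdivrMr ?subr_gt0 // mulrAC ler_pdivlMr ?subr_gt0 //; lra.
Qed.

(** The slope is the infimum of the chord slopes to the left of 1, which by [concave_slopes] is at
    least every chord slope to the right. *)
Lemma supergradient g : concave_pos g -> exists c, forall t, 0 < t -> g t <= g 1 + c * (t - 1).
Proof.
move=> cg; pose S := [set (g 1 - g s) / (1 - s) | s in [set s | 0 < s < 1]].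
have S0 : S !=set0.
  by exists ((g 1 - g 2^-1) / (1 - 2^-1)); exists 2^-1 => //=; rewrite invr_gt0 ltr0n invf_lt1 ?ltr1n.
have lbS t : 1 < t -> lbound S ((g t - g 1) / (t - 1)).
  by move=> t1 _ [s /= /andP[s0 s1] <-]; exact: concave_slopes.
exists (inf S) => t t0; rewrite -lerBlDl.
have [t1|t1|->] := ltgtP t 1; last by rewrite !subrr mulr0.
  have : inf S <= (g 1 - g t) / (1 - t).
    apply: ge_inf; first by exists ((g 2 - g 1) / (2 - 1)); apply: lbS; rewrite ltr1n.
    by exists t => //=; rewrite t0 t1.
  by rewrite ler_pdivlMr ?subr_gt0 //; lra.
have : (g t - g 1) / (t - 1) <= inf S by apply: lb_le_inf => //; exact: lbS.
by rewrite ler_pdivrMr ?subr_gt0.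
Qed.

(** 1 is the mean of t and 1 / t with weights 1 / (1 + t) and t / (1 + t). A value above the minimum
    at t would contradict concavity. *)
Lemma concave_min_const g : concave_pos g -> (forall t, 0 < t -> g 1 <= g t) ->
  forall t, 0 < t -> g t = g 1.
Proof.
move=> cg h t t0; apply/eqP; rewrite eq_le h // andbT.
have t1 : 0 < 1 + t by lra.
have ti : 0 < t^-1 by rewrite invr_gt0.
have l01 : 0 <= (1 + t)^-1 <= 1 by rewrite invr_ge0 invf_le1 //; lra.
have := cg t t^-1 _ t0 ti l01.
have -> : (1 + t)^-1 * t + (1 - (1 + t)^-1) * t^-1 = 1 by field; rewrite !gt_eqF.
have h1 := h _ ti.
have l1 : 0 <= 1 - (1 + t)^-1 by lra.
have h2 := ler_wpM2l l1 h1.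
move=> h3; have : (1 + t)^-1 * g t <= (1 + t)^-1 * g 1 by lra.
by rewrite ler_pM2l ?invr_gt0.
Qed.

(* Concavity of f alone allows a zero slope at 1 for a nonconstant f; then the
   adjoint t |-> 1 / f (1 / t) has an interior minimum at 1, and its concavity
   forces f = 1. *)
Lemma concave_pair_tangents f : concave_pair f -> f 1 = 1 -> (forall t, 0 < t -> 0 < f t) ->
  (forall s t, 0 < s -> s <= t -> f s <= f t) ->
  (forall t, 0 < t -> f t = 1) \/
  exists a b, [/\ 0 < a, 0 < b, forall t, 0 < t -> f t <= 1 + a * (t - 1) &
    forall t, 0 < t -> (f t^-1)^-1 <= 1 + b * (t - 1)].
Proof.
move=> cf f1 f0 fm; pose g t := (f t^-1)^-1.
have c1 : concave_pos f by move=> s t l s0 t0 l01; have [] := cf s t l s0 t0 l01.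
have c2 : concave_pos g.
  move=> s t l s0 t0 l01; have is0 : 0 < s^-1 by rewrite invr_gt0.
  have it0 : 0 < t^-1 by rewrite invr_gt0.
  by have [_] := cf s^-1 t^-1 l is0 it0 l01; rewrite !invrK.
have g1 : g 1 = 1 by rewrite /g invr1 f1 invr1.
have gm s t : 0 < s -> s <= t -> g s <= g t.
  move=> s0 st; have t0 := lt_le_trans s0 st.
  by rewrite lef_pV2 ?posrE ?f0 ?invr_gt0 // fm ?invr_gt0 // lef_pV2 ?posrE.
have [a ha] := supergradient c1; have [b hb] := supergradient c2.
rewrite f1 in ha; rewrite g1 in hb.
have [a0|a0] := ltP 0 a; last first.
  left; have f_le1 t : 0 < t -> f t <= 1.
    move=> t0; have [t1|t1] := leP 1 t.
      by apply: le_trans (ha t t0) _; rewrite gerDl mulr_le0_ge0 ?subr_ge0.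
    by rewrite -f1 fm // ltW.
  have gE := concave_min_const c2 _; move=> t t0.
  have it0 : 0 < t^-1 by rewrite invr_gt0.
  have : g t^-1 = 1.
    rewrite -g1; apply: gE => // u u0; rewrite g1 /g invf_ge1 ?f0 ?invr_gt0 //.
    by rewrite f_le1 ?invr_gt0.
  by rewrite /g invrK => /(congr1 (fun u => u^-1)); rewrite invrK invr1.
have [b0|b0] := ltP 0 b; last first.
  left; have g_le1 t : 0 < t -> g t <= 1.
    move=> t0; have [t1|t1] := leP 1 t.
      by apply: le_trans (hb t t0) _; rewrite gerDl mulr_le0_ge0 ?subr_ge0.
    by rewrite -g1 gm // ltW.
  move=> t t0; rewrite -f1; apply: (concave_min_const c1) => // u u0.
  rewrite f1; have := g_le1 u^-1; rewrite invr_gt0 /g invrK => /(_ u0).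
  by rewrite invf_le1 ?f0.
by right; exists a, b.
Qed.

End Supergradient.

(** * Tangent bounds for a nontrivial operator mean *)

Section MeanBounds.
Context {R : realType} {H : hilbert R}.
Implicit Types (S T X A Z : bop H) (a b c s t l : R) (x y : H).
Variable sigma : (H -> H) -> (H -> H) -> H -> H.
Hypothesis sigma_mean : operator_mean sigma.
Variable x0 : H.
Hypothesis x00 : x0 != 0.
Local Notation bsigma := (bsigma sigma).
Local Notation rep := (rep sigma x0).

Lemma rep_concave_pair : concave_pair rep.
Proof.
have [[e1 [e2 e12]]|h] := one_dim_or_orthonormal x00.
  exact: rep_concave_pair2 e12.
have [e1 [e2 e12]] := C2_orthonormal R.
exact: rep_concave_pair1 e12 h.
Qed.

Lemma inverse_pair a b T : 0 < a -> spec a b T ->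
  [/\ psd T, T * bpow (- 1) T = 1, bpow (- 1) T * T = 1 &
     forall x, x != 0 -> 0 < qf T x /\ 0 < qf (bpow (- 1) T) x].
Proof.
move=> a0 sT; have Tr := bpowNr 1 a0 sT; have Tl := bpowNl 1 a0 sT.
rewrite (bpow1 a0 sT) in Tr Tl.
have pos c d S x : 0 < c -> spec c d S -> x != 0 -> 0 < qf S x.
  move=> c0 sS xn; have /andP[h _] := sS.2 x; apply: lt_le_trans h.
  by rewrite mulr_gt0 // ip_gt0.
split=> //; first exact: spec_psd (ltW a0) sT.
move=> x xn; split; first exact: pos sT xn.
have ab : 0 < b.
  have := pos _ _ _ x a0 sT xn; have /andP[_ h] := sT.2 x.
  by move=> /lt_le_trans/(_ h); rewrite pmulr_lgt0 // ip_gt0.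
by apply: pos (spec_bpowN a0 ler01 sT) xn; rewrite powR_gt0.
Qed.

(** The upper compression gives X sigma A <= X. For the converse the lower one is used with test
    vector X y, where <X^-1 X y, X y> = <X y, y> and the rank-one form at y is <X y, y>^2. *)
Lemma bsigma_left_pd a b X A : 0 < a -> spec a b X -> spec a b A ->
  (forall t, 0 < t -> rep t = 1) -> bsigma X A = X.
Proof.
move=> a0 sX sA r1.
have [pX XX XX' qX] := inverse_pair a0 sX; have [pA AA _ qA] := inverse_pair a0 sA.
apply: ble_anti; [exact: (psd_bsigma sigma_mean pX pA).1|exact: pX.1| |] => y.
  have [->|yn] := eqVneq y 0; first by rewrite /qf !ip0r.
  have [[x1 _] [x2 _]] := (qX y yn, qA y yn).
  by have := bsigma_upper sigma_mean x00 pX pA x1 x2; rewrite r1 ?mulr1 // divr_gt0.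
have [->|yn] := eqVneq y 0; first by rewrite /qf !ip0r.
have [q0 _] := qX y yn.
have Xyn : X y != 0 by apply: contraTneq q0; rewrite /qf => ->; rewrite ip0l ltxx.
have [[_ x1] [_ x2]] := (qX _ Xyn, qA _ Xyn).
have qE : qf (bpow (- 1) X) (X y) = qf X y by rewrite /qf -mulE XX' oneE ipC.
have := bsigma_lower sigma_mean x00 y pX pA XX AA x1 x2.
rewrite r1 ?divr_gt0 // mulr1 qE qf_rk_real.
  by rewrite (ipC y) -/(qf X y) expr2 mulKf // gt_eqF.
by rewrite inner_conj; have := sa_Im y pX.1; case: '[_, _] => u v /= ->; rewrite oppr0.
Qed.

Lemma decreasing_to_shift T : decreasing_to (fun k => T + k.+1%:R^-1 *: (1 : bop H)) T.
Proof.
split=> [k x|x].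
  have -> : (T + k.+1%:R^-1 *: (1 : bop H) : H -> H) - (T + k.+2%:R^-1 *: (1 : bop H) : H -> H) =
     ((k.+1%:R^-1 - k.+2%:R^-1) *: (1 : bop H) : bop H).
    apply/funext => z.
    transitivity ((T + k.+1%:R^-1 *: (1 : bop H)) z - (T + k.+2%:R^-1 *: (1 : bop H)) z) => //.
    by rewrite !addE !scaleE oneE opprD addrACA subrr add0r rmorphB scalerBl.
  move: x; apply/positiveP; split; first exact/saZ/sa1.
  move=> x; rewrite qfZ qf1 mulr_ge0 ?ip_ge0 // subr_ge0 lef_pV2 ?posrE //.
  by rewrite ler_nat.
apply/cvg_nrmP => e e0; have n0 : 0 < nrm x + 1 by rewrite ltr_wpDl ?nrm_ge0.
have d0 := divr_gt0 e0 n0.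
have := near_infty_natSinv_lt (PosNum d0); apply: filterS => k /= h.
suff : nrm ((T + k.+1%:R^-1 *: (1 : bop H)) x - T x) <= e by [].
rewrite addE addrC addKr scaleE oneE nrmZ gtr0_norm ?invr_gt0 //.
have := ler_wpM2r (nrm_ge0 x) (ltW h).
move=> /le_trans; apply; rewrite mulrAC ler_pdivrMr // ler_pM2l // lerDl //.
Qed.

(** [left_trivial] concerns all positive operators, [bsigma_left_pd] only invertible ones: shift
    both arguments by 1 / (k + 1) and use the continuity axiom. *)
Lemma rep_const_left_trivial : (forall t, 0 < t -> rep t = 1) -> left_trivial sigma.
Proof.
move=> r1 A0 B0 pA0 pB0; pose A := toB A0; pose B := toB B0.
have AE : A0 = A by rewrite /A toBK //; exact: pA0.1.
have BE : B0 = B by rewrite /B toBK //; exact: pB0.1.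
rewrite AE BE in pA0 pB0 *; move: (A) (B) pA0 pB0 => {AE BE} {}A {}B pA0 pB0.
have pA := (psd_opP A).1 pA0; have pB := (psd_opP B).1 pB0.
pose sh T k : bop H := T + k.+1%:R^-1 *: (1 : bop H).
have iv (k : nat) : 0 < k.+1%:R^-1 :> R by rewrite invr_gt0.
have sp T k : psd T -> exists2 b, True & spec k.+1%:R^-1 b (sh T k).
  move=> pT; have [c c0 cP] := sa_upper pT.1; exists (c + k.+1%:R^-1) => //; split.
    by apply: saD; [exact: pT.1|exact/saZ/sa1].
  by move=> x; rewrite qfD qfZ qf1 mulrDl lerD2r cP lerDr pT.2.
have psh T k : psd T -> psd_op (sh T k).
  by move=> pT; have [b _ sb] := sp T k pT; apply/psd_opP; exact: spec_psd (ltW (iv k)) sb.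
have E k : sigma (sh A k) (sh B k) = sh A k.
  have [b _ sb] := sp A k pA; have [b' _ sb'] := sp B k pB.
  rewrite bsigmaE //; [|exact/psd_opP/psh..]; congr bfun.
  apply: (@bsigma_left_pd (k.+1%:R^-1) (Num.max b b')) => //.
    by apply: spec_wide sb; rewrite ?le_max lexx.
  by apply: spec_wide sb'; rewrite ?le_max lexx ?orbT.
have [_ h] := mean_continuous sigma_mean (fun k => psh A k pA) (fun k => psh B k pB)
  pA0 pB0 (decreasing_to_shift A) (decreasing_to_shift B).
have [_ h'] := decreasing_to_shift A.
apply/funext => x; have hx := h x; have hx' := h' x.
have EE : (fun k => sigma (sh A k) (sh B k) x) = (fun k => sh A k x).
  by apply/funext => k; rewrite E.
rewrite /sot_cvg /= in hx; rewrite EE in hx.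
exact: cvg_unique hx hx'.
Qed.

Hypothesis sigma_nontrivial : ~ left_trivial sigma.

Lemma bsigma_tangents : exists a b, [/\ 0 < a, 0 < b,
  forall c d X A x, 0 < c -> spec c d X -> spec c d A ->
    qf (bsigma X A) x <= (1 - a) * qf X x + a * qf A x &
  forall c d X A Z' x, 0 < c -> spec c d X -> spec c d A -> bsigma X A * Z' = 1 ->
    qf Z' x <= (1 - b) * qf (bpow (- 1) X) x + b * qf (bpow (- 1) A) x].
Proof.
have [|[a [b [a0 b0 ha hb]]]] := concave_pair_tangents rep_concave_pair
  (rep1 sigma_mean x00) (rep_gt0 sigma_mean x00) (rep_mono sigma_mean x00).
  by move/rep_const_left_trivial.
exists a, b; split=> // [c d X A x c0 sX sA|c d X A Z' x c0 sX sA ZZ].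
  have [pX _ _ qX] := inverse_pair c0 sX; have [pA _ _ qA] := inverse_pair c0 sA.
  have [->|xn] := eqVneq x 0; first by rewrite /qf !ip0r !mulr0 addr0.
  have [[x1 _] [x2 _]] := (qX x xn, qA x xn).
  apply: le_trans (bsigma_upper sigma_mean x00 pX pA x1 x2) _.
  have := ler_wpM2l (ltW x1) (ha _ (divr_gt0 x2 x1)).
  move=> /le_trans; apply; rewrite le_eqVlt; apply/orP; left; apply/eqP.
  by field; rewrite gt_eqF.
have [pX XX _ qX] := inverse_pair c0 sX; have [pA AA _ qA] := inverse_pair c0 sA.
have [->|xn] := eqVneq x 0; first by rewrite /qf !ip0r !mulr0 addr0.
have [[_ x1] [_ x2]] := (qX x xn, qA x xn).
apply: le_trans (bsigma_lower_inv sigma_mean x00 pX pA XX AA ZZ x1 x2) _.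
have := ler_wpM2l (ltW x1) (hb _ (divr_gt0 x2 x1)).
move=> /le_trans; apply; rewrite le_eqVlt; apply/orP; left; apply/eqP.
by field; rewrite gt_eqF.
Qed.

(** Monotonicity between c sigma c = c and d sigma d = d. *)
Lemma bsigma_spec c d X A : 0 < c -> spec c d X -> spec c d A -> spec c d (bsigma X A).
Proof.
move=> c0 sX sA; have pX := spec_psd (ltW c0) sX; have pA := spec_psd (ltW c0) sA.
have d0 : 0 < d.
  have /andP[h1 h2] := sX.2 x0; have i0 : 0 < ip x0 x0 by rewrite ip_gt0.
  by have := le_trans h1 h2; rewrite ler_pM2r // => /(lt_le_trans c0).
split=> [|x]; first exact: (psd_bsigma sigma_mean pX pA).1.
have lo e : 0 < e -> bsigma (e *: (1 : bop H)) (e *: (1 : bop H)) = e *: (1 : bop H).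
  by move=> e0; rewrite (bsigmaZ sigma_mean e0 psd1 psd1) bsigma11.
rewrite -!qf1 -!qfZ -(lo c c0) -(lo d d0).
have pc e : 0 < e -> psd (e *: (1 : bop H)) by exact: psdc.
have spl T : spec c d T -> ble (c *: (1 : bop H)) T /\ ble T (d *: (1 : bop H)).
  by move=> sT; split=> y; rewrite qfZ qf1; have /andP[] := sT.2 y.
have [[h1 h2] [h3 h4]] := (spl _ sX, spl _ sA).
by apply/andP; split; apply: (bsigma_mono sigma_mean) => //; exact: pc.
Qed.

End MeanBounds.

(** * Strong limits of decreasing sequences of operators *)

Section MonotoneLimits.
Context {R : realType} {H : hilbert R}.
Implicit Types (c d e : R) (x y : H).

Lemma cvg_ip (u : nat -> H) l y : u k @[k --> \oo] --> l ->
  ip (u k) y @[k --> \oo] --> ip l y.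
Proof.
move=> /cvg_nrmP h; apply/cvgrPdist_le => e e0.
have n0 : 0 < nrm y + 1 by rewrite ltr_wpDl ?nrm_ge0.
have d0 := divr_gt0 e0 n0; have := h _ d0; apply: filterS => k hk.
rewrite -ipBl; apply: le_trans (ip_nrm _ _) _; rewrite nrmB.
apply: le_trans (ler_wpM2r (nrm_ge0 y) hk) _.
by rewrite mulrAC ler_pdivrMr // ler_pM2l // lerDl.
Qed.

Lemma spec_sot_limit c d (X_ : nat -> bop H) (X : bop H) : (forall k, spec c d (X_ k)) ->
  (forall x, X_ k x @[k --> \oo] --> X x) -> spec c d X.
Proof.
move=> sX cX.
have cq x : qf (X_ k) x @[k --> \oo] --> qf X x by exact: cvg_ip.
split=> [x y|x].
  have h1 := cvg_ip (y := y) (cX x); have h2 := cvg_ip (y := x) (cX y).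
  have E : (fun k => ip (X_ k x) y) = (fun k => ip (X_ k y) x).
    by apply/funext => k; rewrite (sX k).1 ipC.
  rewrite (ipC x); rewrite E in h1; exact: cvg_unique h1 h2.
apply/andP; split.
  by apply: (cvgr_to_ge (cq x)); near=> k; have /andP[] := (sX k).2 x.
by apply: (cvgr_to_le (cq x)); near=> k; have /andP[] := (sX k).2 x.
Unshelve. all: by end_near.
Qed.

(** Vigier's theorem. The forms decrease and are bounded below, hence converge; [psd_nrm] for
    differences, which are at most d - c, makes X_k x a Cauchy sequence. *)
Lemma decreasing_sot_limit c d (X_ : nat -> bop H) : c <= d -> (forall k, spec c d (X_ k)) ->
  (forall k, ble (X_ k.+1) (X_ k)) ->
  exists X : bop H, spec c d X /\ forall x, X_ k x @[k --> \oo] --> X x.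
Proof.
move=> cd sX dX.
have mono j k : (k <= j)%N -> ble (X_ j) (X_ k).
  elim: j => [|j IH]; first by rewrite leqn0 => /eqP ->.
  rewrite leq_eqVlt => /orP[/eqP -> //|]; rewrite ltnS => /IH h x.
  exact: le_trans (dX j x) (h x).
have dist j k x : (k <= j)%N ->
    ip (X_ k x - X_ j x) (X_ k x - X_ j x) <= (d - c) * (qf (X_ k) x - qf (X_ j) x).
  move=> kj; rewrite -qfB; apply: (@psd_nrm _ _ (X_ k - X_ j)).
  - by apply: saB; exact: (sX _).1.
  - by move=> z; rewrite qfB subr_ge0 mono.
  move=> z; rewrite qfB; have /andP[_ h1] := (sX k).2 z; have /andP[h2 _] := (sX j).2 z.
  lra.
have cX x : exists l : H, X_ k x @[k --> \oo] --> l.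
  apply: nrm_cauchy_cvg => e e0.
  have qc : cvgn (fun k => qf (X_ k) x).
    apply: nonincreasing_is_cvgn; first by move=> k j kj; exact: mono.
    by exists (c * ip x x) => _ [k _ <-]; have /andP[] := (sX k).2 x.
  set l := limn (fun k => qf (X_ k) x) in qc.
  have lq k : l <= qf (X_ k) x.
    by apply: (nonincreasing_cvgn_ge _ qc) => i j ij; exact: mono.
  have dc0 : 0 < d - c + 1 by rewrite ltr_wpDl ?subr_ge0.
  have r0 : 0 < e ^+ 2 / (d - c + 1) by rewrite divr_gt0 ?exprn_gt0.
  move/cvgrPdist_le: qc => /(_ _ r0)[N _ hN]; exists N.
  have key k j : (N <= k)%N -> (k <= j)%N -> nrm (X_ k x - X_ j x) <= e.
    move=> Nk kj; rewrite -ler_sqr ?nnegrE ?nrm_ge0 ?(ltW e0) // sqr_nrm.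
    apply: le_trans (dist j k x kj) _; have := hN k Nk; rewrite distrC.
    move=> /(le_trans (ler_norm _)) h; have := lq j => lj.
    have h3 : qf (X_ k) x - qf (X_ j) x <= e ^+ 2 / (d - c + 1).
      by apply: le_trans h; rewrite lerD2l lerN2.
    have cd0 : 0 <= d - c by rewrite subr_ge0.
    apply: le_trans (ler_wpM2l cd0 h3) _.
    by rewrite mulrA ler_pdivrMr // mulrC ler_pM2l ?exprn_gt0 // lerDl.
  move=> j k Nj Nk; have [kj|/ltnW jk] := leqP k j; last exact: key.
  by rewrite nrmB; exact: key.
pose L x := projT1 (cid (cX x)).
have cL x : X_ k x @[k --> \oo] --> L x by exact: (projT2 (cid (cX x))).
have [b b0 bP] := bop_nrm_bound (X_ 0%N).
have LP : bounded_op L.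
  apply: (pointwise_limit (c := b + (d - c)) _ cL) => k x.
  have := nrmD (X_ 0%N x) (X_ k x - X_ 0%N x); rewrite subrKC nrmB => /le_trans; apply.
  rewrite mulrDl lerD // -ler_sqr ?nnegrE ?mulr_ge0 ?nrm_ge0 ?subr_ge0 //.
  rewrite sqr_nrm exprMn sqr_nrm; apply: le_trans (dist k 0%N x (leq0n k)) _.
  rewrite expr2 -mulrA ler_wpM2l ?subr_ge0 //.
  have /andP[_ h1] := (sX 0%N).2 x; have /andP[h2 _] := (sX k).2 x; lra.
by exists (Bop LP); split=> //; exact: (spec_sot_limit (X := Bop LP) sX cL).
Qed.

End MonotoneLimits.

(** * Bounds and existence for the fixed point equation *)

Section DeformedMean.
Context {R : realType} {H : hilbert R}.
Variable x0 : H.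
Hypothesis x00 : x0 != 0.
Variables (n : nat) (w : 'I_n -> R).
Hypothesis w_prob : probability_vector w.
Variable MM : ('I_n -> H -> H) -> H -> H.
Hypothesis MM_mean : multivariate_mean MM.
Hypothesis MM_ge : forall B : 'I_n -> H -> H, (forall j, pd_op (B j)) ->
  harm_mean w B <=L MM B.
Hypothesis MM_le : forall B : 'I_n -> H -> H, (forall j, pd_op (B j)) ->
  MM B <=L arith_mean w B.
Variable sigma : (H -> H) -> (H -> H) -> H -> H.
Hypothesis sigma_mean : operator_mean sigma.
Hypothesis sigma_nontrivial : ~ left_trivial sigma.
Implicit Types (c d : R) (X Y : bop H) (A Z : 'I_n -> bop H) (x : H).

Definition bmean Z : bop H := toB (MM (fun j => Z j)).

Lemma spec_le_bounds c d X : 0 < c -> spec c d X -> c <= d.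
Proof.
move=> c0 sX; have /andP[h1 h2] := sX.2 x0.
by have := le_trans h1 h2; rewrite ler_pM2r // ip_gt0.
Qed.

Lemma spec_family_bounds c d Z : 0 < c -> (forall j, spec c d (Z j)) -> c <= d.
Proof.
move=> c0 sZ; have n0 : (0 < n)%N.
  (* There is at least one index because the weights sum to 1. *)
  case: (posnP n) => // n0; have := w_prob.2; rewrite big1.
    by move=> /eqP; rewrite eq_sym oner_eq0.
  by move=> j; have := ltn_ord j; rewrite {2}n0.
exact: spec_le_bounds c0 (sZ (Ordinal n0)).
Qed.

Lemma harm_meanE c d Z : 0 < c -> c <= d -> (forall j, spec c d (Z j)) ->
  harm_mean w (fun j => Z j) = bpow (- 1) (wsum w (fun j => bpow (- 1) (Z j))).
Proof.
move=> c0 cd sZ; have d0 := lt_le_trans c0 cd.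
have sI j : spec (d `^ (- 1)) (c `^ (- 1)) (bpow (- 1) (Z j)) by exact: spec_bpowN ler01 (sZ j).
rewrite /harm_mean -(opinvE (powR_gt0 _ d0) (spec_wsum w_prob sI)); congr opinv.
rewrite -bfun_sum; apply: eq_bigr => j _; congr (_ *: _).
exact: opinvE (sZ j).
Qed.

(** [pd_spec] yields only some interval for the mean; the weighted harmonic and arithmetic means,
    both in [c, d], then pin it to [c, d]. *)
Lemma bmeanP c d Z : 0 < c -> (forall j, spec c d (Z j)) ->
  [/\ MM (fun j => Z j) = bmean Z, spec c d (bmean Z), ble (bmean Z) (wsum w Z) &
     ble (bpow (- 1) (bmean Z)) (wsum w (fun j => bpow (- 1) (Z j)))].
Proof.
move=> c0 sZ.
have pZ j : pd_op (Z j) by exact: spec_pd (sZ j).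
have pM := mmean_pd MM_mean pZ.
have ME : MM (fun j => Z j) = bmean Z by rewrite /bmean toBK //; exact: pM.1.1.
rewrite ME in pM; have [a [b [a0 sM]]] := pd_spec pM.
have cd := spec_family_bounds c0 sZ.
have d0 := lt_le_trans c0 cd.
have up : ble (bmean Z) (wsum w Z).
  apply: (loewnerP (spec_sa sM) (spec_sa (spec_wsum w_prob sZ))).1.
  by rewrite -ME -bfun_sum; exact: MM_le.
have sI j : spec (d `^ (- 1)) (c `^ (- 1)) (bpow (- 1) (Z j)) by exact: spec_bpowN ler01 (sZ j).
have sW := spec_wsum w_prob sI; have dn : 0 < d `^ (- 1) by exact: powR_gt0.
have lo : ble (bpow (- 1) (wsum w (fun j => bpow (- 1) (Z j)))) (bmean Z).
  apply: (loewnerP (bpow_sa (- 1) dn sW) (spec_sa sM)).1.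
  by rewrite -ME -(harm_meanE c0 cd sZ); exact: MM_ge.
have sWi := spec_bpowN dn ler01 sW.
have cE (e : R) : 0 < e -> (e `^ (- 1)) `^ (- 1) = e.
  by move=> e0; rewrite -powRrM mulrNN mulr1 powRr1 // ltW.
rewrite !cE // in sWi.
have sMcd : spec c d (bmean Z).
  split=> [|x]; first exact: spec_sa sM.
  have /andP[h1 _] := sWi.2 x; have /andP[_ h2] := (spec_wsum w_prob sZ).2 x.
  by rewrite (le_trans h1 (lo x)) (le_trans (up x) h2).
split=> //.
have := bpow_antimono c0 c0 sWi sMcd ler01 (lexx 1) lo.
by rewrite (bpow_comp _ _ dn sW) mulrNN mul1r (bpow1 dn sW).
Qed.

(** Averaging the tangent bounds turns the fixed point equation into X <= (1 - s) X + s (sum w A),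
    where the positive slope s cancels whatever the sign of 1 - s; likewise for inverses. *)
Lemma deformed_bounds c d A X : 0 < c -> (forall j, spec c d (A j)) -> pd_op X ->
  X = MM (fun j => sigma X (A j)) :> (H -> H) ->
  [/\ spec c d X, ble X (wsum w A) & ble (bpow (- 1) X) (wsum w (fun j => bpow (- 1) (A j)))].
Proof.
move=> c0 sA pX XE.
have [a [b [a0 sX]]] := pd_spec pX.
(* A provisional interval shared by X and all A_j, until the bounds confine X to [c, d]. *)
pose a' := Num.min a c; pose b' := Num.max b d.
have a'0 : 0 < a' by rewrite lt_min a0.
have sX' : spec a' b' X by apply: spec_wide sX; rewrite ?ge_min ?le_max lexx.
have sA' j : spec a' b' (A j) by apply: spec_wide (sA j); rewrite ?ge_min ?le_max lexx ?orbT.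
have p (T : bop H) : spec a' b' T -> psd T by move=> sT; exact: spec_psd (ltW a'0) sT.
pose Z j := bsigma sigma X (A j).
have sZ j : spec a' b' (Z j) := bsigma_spec sigma_mean x00 a'0 sX' (sA' j).
have ZE : (fun j => sigma X (A j)) = (fun j => Z j : H -> H).
  by apply/funext => j; rewrite bsigmaE //; exact: p.
have [ME sM up lo] := bmeanP a'0 sZ.
have XM : X = bmean Z by apply: bfun_inj; rewrite -ME -ZE.
have [s [t [s0 t0 hs ht]]] := bsigma_tangents sigma_mean x00 sigma_nontrivial.
have cd := spec_family_bounds c0 sA.
have XA : ble X (wsum w A).
  move=> x; have := up x; rewrite -XM !qf_wsum => h.
  have h2 : \sum_j w j * qf (Z j) x <= \sum_j w j * ((1 - s) * qf X x + s * qf (A j) x).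
    by apply: le_wsum => // j; exact: hs a'0 sX' (sA' j).
  have E : \sum_j w j * ((1 - s) * qf X x + s * qf (A j) x) =
     (1 - s) * qf X x + s * \sum_j w j * qf (A j) x.
    rewrite -{2}(wsum_cst w_prob ((1 - s) * qf X x)) mulr_sumr -big_split /=.
    by apply: eq_bigr => j _; ring.
  rewrite E in h2; have : s * qf X x <= s * \sum_j w j * qf (A j) x by lra.
  by rewrite ler_pM2l.
have XI : ble (bpow (- 1) X) (wsum w (fun j => bpow (- 1) (A j))).
  move=> x; have := lo x; rewrite -XM !qf_wsum => h.
  have h2 : \sum_j w j * qf (bpow (- 1) (Z j)) x <=
     \sum_j w j * ((1 - t) * qf (bpow (- 1) X) x + t * qf (bpow (- 1) (A j)) x).
    apply: le_wsum => // j; apply: (ht _ _ _ _ _ _ a'0 sX' (sA' j)).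
    by have := bpowNr 1 a'0 (sZ j); rewrite (bpow1 a'0 (sZ j)).
  have E : \sum_j w j * ((1 - t) * qf (bpow (- 1) X) x + t * qf (bpow (- 1) (A j)) x) =
     (1 - t) * qf (bpow (- 1) X) x + t * \sum_j w j * qf (bpow (- 1) (A j)) x.
    rewrite -{2}(wsum_cst w_prob ((1 - t) * qf (bpow (- 1) X) x)) mulr_sumr -big_split /=.
    by apply: eq_bigr => j _; ring.
  rewrite E in h2.
  have : t * qf (bpow (- 1) X) x <= t * \sum_j w j * qf (bpow (- 1) (A j)) x by lra.
  by rewrite ler_pM2l.
split=> //; split=> [|x]; first exact: spec_sa sX.
have /andP[_ h2] := (spec_wsum w_prob sA).2 x.
rewrite (le_trans (XA x) h2) andbT -qf1 -qfZ.
have [_ XX XX' _] := inverse_pair a0 sX.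
(* The lower end c comes from X^-1 <= c^-1 by inversion. *)
apply: (@ble_inv _ _ (bpow (- 1) X) (c^-1 *: (1 : bop H)) X (c *: (1 : bop H))) => //.
- exact: bpow_sa a0 sX.
- by move=> z; exact: bpow_ge0 a0 sX.
- by rewrite -bscaleAl mul1r scalerA mulVf ?scale1r // gt_eqF.
have sI j : spec (d `^ (- 1)) (c `^ (- 1)) (bpow (- 1) (A j)) by exact: spec_bpowN ler01 (sA j).
move=> z; have /andP[_ h] := (spec_wsum w_prob sI).2 z.
by apply: le_trans (XI z) _; rewrite qfZ qf1 -powR_inv1 // ltW.
Qed.

(** The continuity axiom of [sigma] covers decreasing sequences only, so the iteration starts at the
    top d of an interval that it never leaves; its first step then goes down, and monotonicity
    propagates this. *)
Lemma deformed_exists c d A : 0 < c -> (forall j, spec c d (A j)) ->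
  exists X, pd_op X /\ X = MM (fun j => sigma X (A j)) :> (H -> H).
Proof.
move=> c0 sA.
have cd := spec_family_bounds c0 sA.
have d0 := lt_le_trans c0 cd.
pose step X := bmean (fun j => bsigma sigma X (A j)).
pose X_ k := iter k step (d *: (1 : bop H)).
have p (T : bop H) : spec c d T -> psd T by move=> sT; exact: spec_psd (ltW c0) sT.
have sZ X j : spec c d X -> spec c d (bsigma sigma X (A j)).
  by move=> sX; exact: (bsigma_spec sigma_mean x00 c0 sX (sA j)).
have s_step X : spec c d X -> spec c d (step X).
  by move=> sX; have [] := bmeanP c0 (fun j => sZ X j sX).
have stepE X : spec c d X -> step X = MM (fun j => bsigma sigma X (A j)) :> (H -> H).
  by move=> sX; have [] := bmeanP c0 (fun j => sZ X j sX).
have step_mono X Y : spec c d X -> spec c d Y -> ble X Y -> ble (step X) (step Y).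
  move=> sX sY XY.
  apply: (loewnerP (spec_sa (s_step _ sX)) (spec_sa (s_step _ sY))).1.
  rewrite !stepE //; apply: (mmean_monotone MM_mean) => j.
  - exact: spec_pd c0 (sZ X j sX).
  - exact: spec_pd c0 (sZ Y j sY).
  apply: (loewnerP (spec_sa (sZ X j sX)) (spec_sa (sZ Y j sY))).2.
  by apply: (bsigma_mono sigma_mean) => //; apply: p.
have s0 : spec c d (d *: (1 : bop H)).
  by split=> [|x]; [exact/saZ/sa1|rewrite qfZ qf1 lexx andbT ler_wpM2r ?ip_ge0].
have sX k : spec c d (X_ k) by elim: k => //= k IH; exact: s_step.
have dX k : ble (X_ k.+1) (X_ k).
  elim: k => [x|k IH]; last exact: (step_mono _ _ (sX k.+1) (sX k) IH).
  by rewrite /= qfZ qf1; have /andP[] := (s_step _ s0).2 x.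
have [X [sXl cX]] := decreasing_sot_limit cd sX dX.
exists X; split; first exact: spec_pd sXl.
have lo (S T : bop H) : spec c d S -> spec c d T -> ble S T -> S <=L T.
  by move=> sS sT; exact: (loewnerP (spec_sa sS) (spec_sa sT)).2.
have dec j : decreasing_to (fun k => bsigma sigma (X_ k) (A j) : H -> H) (bsigma sigma X (A j)).
  have := mean_continuous sigma_mean (A_ := fun k => X_ k) (B_ := fun=> A j)
    (fun k => (psd_opP _).2 (p _ (sX k))) (fun k => (psd_opP _).2 (p _ (sA j)))
    ((psd_opP _).2 (p _ sXl)) ((psd_opP _).2 (p _ (sA j))).
  have -> : (fun k => sigma (X_ k) (A j)) = (fun k => bsigma sigma (X_ k) (A j) : H -> H).
    by apply/funext => k; rewrite bsigmaE //; apply: p.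
  rewrite (bsigmaE sigma_mean (p _ sXl) (p _ (sA j))); apply.
    by split=> // k; apply: lo.
  split=> [k|x]; first exact: lo.
  exact: cvg_cst.
have lim := mmean_continuous MM_mean (A_ := fun j k => bsigma sigma (X_ k) (A j))
  (fun j k => spec_pd c0 (sZ _ j (sX k))) (fun j => spec_pd c0 (sZ X j sXl))
  (or_intror dec).
apply/funext => x.
(* [X_ k.+1] is the mean built from [X_ k], so the shifted sequence tends to both sides of the fixed
   point equation. *)
have h1 : X_ k.+1 x @[k --> \oo] --> X x.
  apply/cvg_nrmP => e e0; have /cvg_nrmP/(_ _ e0)[N _ hN] := cX x.
  by exists N => // k Nk; apply: hN; exact: leqW.
have h2 := lim x.
have EE : (fun k => MM (fun j => bsigma sigma (X_ k) (A j)) x) = (fun k => X_ k.+1 x).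
  by apply/funext => k; rewrite /= stepE.
rewrite /= EE in h2.
have -> : (fun j => sigma X (A j)) = (fun j => bsigma sigma X (A j) : H -> H).
  by apply/funext => j; rewrite bsigmaE //; exact: p.
exact: cvg_unique h1 h2.
Qed.

(** Existence makes the choice in [deformed] return a solution and not the default 0; the bounds
    hold for whichever solution is returned. *)
Lemma deformedP c d A : 0 < c -> (forall j, spec c d (A j)) ->
  exists X, [/\ deformed MM sigma (fun j => A j) = X, spec c d X, ble X (wsum w A) &
     ble (bpow (- 1) X) (wsum w (fun j => bpow (- 1) (A j)))].
Proof.
move=> c0 sA; have [X0 [pX0 X0E]] := deformed_exists c0 sA.
have := @xgetPex _ 0 [set X : H -> H | pd_op X /\ X = MM (fun j => sigma X (A j))]
  (ex_intro _ (X0 : H -> H) (conj pX0 X0E)).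
rewrite -/(deformed MM sigma (fun j => A j)); set D := deformed _ _ _.
move=> [pD DE]; have DK : toB D = D :> (H -> H) by rewrite toBK //; exact: pD.1.1.
exists (toB D); rewrite -DK in pD DE.
by have [? ? ?] := deformed_bounds c0 sA pD DE; rewrite DK.
Qed.

End DeformedMean.

(** * Power-mean inequalities for deformed means *)

Theorem theorem4p1 (R : realType) (H : hilbert R) (n : nat)
    (A : 'I_n -> H -> H) (m M : R)
    (A_pd : forall j, pd_op (A j))
    (m_gt0 : 0 < m) (m_lt_M : m < M)
    (A_ge : forall j, scalar_op m <=L A j)
    (A_le : forall j, A j <=L scalar_op M)
    (MM : ('I_n -> H -> H) -> H -> H) (MM_mean : multivariate_mean MM)
    (w : 'I_n -> R) (w_prob : probability_vector w)
    (MM_ge : forall B : 'I_n -> H -> H, (forall j, pd_op (B j)) ->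
       harm_mean w B <=L MM B)
    (MM_le : forall B : 'I_n -> H -> H, (forall j, pd_op (B j)) ->
       MM B <=L arith_mean w B)
    (sigma : (H -> H) -> (H -> H) -> H -> H)
    (sigma_mean : operator_mean sigma)
    (sigma_neq_left : ~ left_trivial sigma) :
  let h := M / m in
  let G p := op_pow (deformed MM sigma (fun j => op_pow (A j) p)) p^-1 in
  [/\ forall p q : R, 1 <= q -> q <= p ->
        (Kantorovich (h `^ p) (- (q / p)) `^ (- q^-1))%:C *: G p <=L G q /\
        G q <=L (Kantorovich (h `^ p) (- (q / p)) `^ (q^-1))%:C *: G p,
      forall p q : R, 0 < q -> q < 1 -> q < p ->
        ((Kantorovich (h `^ q) q^-1)^-1 *
         Kantorovich (h `^ p) (- (q / p)) `^ (- q^-1))%:C *: G p <=L G q /\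
        G q <=L (Kantorovich (h `^ q) q^-1 *
                 Kantorovich (h `^ p) (- (q / p)) `^ (q^-1))%:C *: G p &
      forall p : R, 0 < p ->
        ((Specht h)^-1 * Specht (h `^ p) `^ (- p^-1))%:C *: G p
          <=L op_exp (\sum_j (w j)%:C *: op_log (A j)) /\
        op_exp (\sum_j (w j)%:C *: op_log (A j))
          <=L (Specht h * Specht (h `^ p) `^ (p^-1))%:C *: G p].
Proof.
move=> h G.
(* On the zero space all inequalities are trivial; otherwise x0 is the vector from which the
   representing function is defined. *)
have [[x0 x00]|triv] := pselect (exists x : H, x != 0); last first.
  have all_le (S T : H -> H) : S <=L T.
    move=> x; have -> : x = 0.
      by apply/eqP; apply/negPn/negP => xn; apply: triv; exists x.
    by rewrite linear0r.
  by split=> *; split; exact: all_le.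
pose B j := toB (A j).
have AE j : A j = B j by rewrite /B toBK //; exact: (A_pd j).1.1.
have sB j : spec m M (B j) by apply: loewner_spec; rewrite -AE.
have M_gt0 : 0 < M := lt_trans m_gt0 m_lt_M.
(* From here on the means enter only through [between], and the three claims become statements about
   such operators. *)
have GP p : 0 < p -> exists2 X : bop H, between w B m M p X & G p = bpow p^-1 X.
  move=> p0; have p0' := ltW p0.
  have sp j : spec (m `^ p) (M `^ p) (bpow p (B j)) by exact: spec_bpow p0' (sB j).
  have mp0 : 0 < m `^ p by exact: powR_gt0.
  have [X [DE sX X1 X2]] := deformedP x00 w_prob MM_mean MM_ge MM_le sigma_mean
    sigma_neq_left mp0 sp.
  exists X.
    split; [exact: sX|exact: X1|apply: ble_trans X2 _ => x].
    rewrite !qf_wsum; apply: le_wsum => // j.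
    by rewrite (bpow_comp _ _ m_gt0 (sB j)) mulrN1.
  rewrite /G; have -> : (fun j => op_pow (A j) p) = (fun j => bpow p (B j) : H -> H).
    by apply/funext => j; rewrite /op_pow AE (fcalcE (sB j) (cont_powR m_gt0)).
  by rewrite DE /op_pow (fcalcE sX (cont_powR mp0)).
have le_of (S T : bop H) : sa S -> sa T -> ble S T -> S <=L T.
  by move=> sS sT; exact: (loewnerP sS sT).2.
have saG p X : 0 < p -> between w B m M p X -> sa (bpow p^-1 X).
  by move=> p0 bX; exact: spec_sa (between_spec1 m_gt0 m_lt_M p0 bX).
split.
- move=> p q q1 qp; have q0 := lt_le_trans ltr01 q1; have p0 := lt_le_trans q0 qp.
  have [X bX ->] := GP p p0; have [Y bY ->] := GP q q0.
  have [h1 h2] := power_mean_ge1 w_prob m_gt0 m_lt_M sB q1 qp bX bY.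
  have sX := saG _ _ p0 bX; have sY := saG _ _ q0 bY.
  by split; [exact: (le_of _ _ (saZ _ sX) sY h1)|exact: (le_of _ _ sY (saZ _ sX) h2)].
- move=> p q q0 q1 qp; have p0 := lt_trans q0 qp.
  have [X bX ->] := GP p p0; have [Y bY ->] := GP q q0.
  have [h1 h2] := power_mean_lt1 w_prob m_gt0 m_lt_M sB q0 q1 qp bX bY.
  have sX := saG _ _ p0 bX; have sY := saG _ _ q0 bY.
  by split; [exact: (le_of _ _ (saZ _ sX) sY h1)|exact: (le_of _ _ sY (saZ _ sX) h2)].
move=> p p0; have [X bX ->] := GP p p0; have sX := saG _ _ p0 bX.
have [h1 h2] := power_mean_exp w_prob m_gt0 m_lt_M sB p0 bX.
set L := wsum w _ in h1 h2.
have sL : spec (ln m) (ln M) L.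
  apply: (spec_wsum w_prob) => j; apply: (bfc_spec (sB j) (cont_ln m_gt0)) => t tI.
  have t0 := itv_gt0 m_gt0 tI; move: tI; rewrite !in_itv /= => /andP[t1 t2].
  by rewrite !ler_ln ?posrE // t1.
have -> : \sum_j (w j)%:C *: op_log (A j) = L.
  rewrite -bfun_sum; apply: eq_bigr => j _; congr (_ *: _).
  by rewrite /op_log AE (fcalcE (sB j) (cont_ln m_gt0)).
rewrite /op_exp (fcalcE sL (@cont_exp _ _ _)).
have sE := bfc_sa sL (@cont_exp _ (ln m) (ln M)).
by split; [exact: (le_of _ _ (saZ _ sX) sE h1)|exact: (le_of _ _ sE (saZ _ sX) h2)].
Qed.
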